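(* Let $\mathbb{F}$ be an infinite field. Let $\Delta$ be a simplicial $2$-sphere with a semi-proper bi-coloring $\pi$ satisfying: $e(\Delta_W)\le 2|W|-3$ for every set $W$ of blue vertices with $|W|\ge 2$. Then $\Delta$ has the $\pi$-colored SLP over $\mathbb{F}$.
   Context: $\Delta_W=\{\sigma\in\Delta:\sigma\subseteq W\}$ and $e(\cdot)$ is the number of edges. $\mathbb{F}[\Delta]=\mathbb{F}[x_v:v\in V(\Delta)]/I_\Delta$ is the Stanley--Reisner ring, $I_\Delta$ generated by monomials $x_{v_1}\cdots x_{v_k}$ with $\{v_1,\dots,v_k\}\notin\Delta$; subscript $2$ is the degree-$2$ part. A bi-coloring is $\pi:V(\Delta)\to\{b,r\}$ (blue/red vertices); it is semi-proper if no edge has two red vertices. A linear form $\sum\alpha_vx_v$ is blue (resp. red) if $\alpha_v=0$ for all non-blue (resp. non-red) $v$; a $(2,1)$-colored sequence is $\theta_1,\theta_2,\theta_3$ with $\theta_1,\theta_2$ blue and $\theta_3$ red. $\Delta$ has the $\pi$-colored SLP over $\mathbb{F}$ if there are a $(2,1)$-colored sequence $\Theta$ and a linear form $w$ with $(\mathbb{F}[\Delta]/(\Theta,w)\mathbb{F}[\Delta])_2=0$. *)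

(* Defs.v *)
From mathcomp Require Export all_boot all_order all_algebra.
From mathcomp Require Export all_classical all_reals all_analysis.
(* The notations of mpoly clash with those of MathComp-Analysis. *)
From mathcomp Require Export -(notations) mpoly.
Export numFieldNormedType.Exports.

Set Implicit Arguments.
Unset Strict Implicit.
Unset Printing Implicit Defensive.

Import Order.TTheory GRing.Theory Num.Theory.

Local Open Scope classical_set_scope.
Local Open Scope ring_scope.

(* Every element of V is a vertex of the complex, i.e. V = V(D). *)
Definition simplicial_complex (V : finType) (D : {set {set V}}) : Prop :=
  (forall v : V, [set v]%SET \in D) /\
  (forall s t : {set V}, s \in D -> t \subset s -> t \in D).

(* Barycentric coordinates: row vectors indexed by V through enum_rank. *)
Definition geometric_realization (R : realType) (V : finType)
    (D : {set {set V}}) : set 'rV[R]_#|V| :=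
  [set x : 'rV[R]_#|V| |
    [/\ forall i, 0 <= x 0 i,
        \sum_i x 0 i = 1 &
        [set v : V | x 0 (enum_rank v) != 0]%SET \in D]].

Definition unit_sphere (R : realType) (d : nat) : set 'rV[R]_d.+1 :=
  [set x : 'rV[R]_d.+1 | \sum_i x 0 i ^+ 2 = 1].

(* A and B, with their subspace topologies, are homeomorphic. *)
Definition homeomorphic (T U : topologicalType) (A : set T) (B : set U) :=
  exists (f : T -> U) (g : U -> T),
    [/\ {within A, continuous f},
        {within B, continuous g},
        (forall x, A x -> B (f x) /\ g (f x) = x) &
        (forall y, B y -> A (g y) /\ f (g y) = y)].

Definition simplicial_sphere (R : realType) (d : nat) (V : finType)
    (D : {set {set V}}) : Prop :=
  simplicial_complex D /\
  homeomorphic (@geometric_realization R V D) (@unit_sphere R d).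

Definition edges (V : finType) (D : {set {set V}}) : {set {set V}} :=
  [set s in D | #|s| == 2%N]%SET.

Definition induced (V : finType) (D : {set {set V}}) (W : {set V}) :
  {set {set V}} := [set s in D | s \subset W]%SET.

Variant color := Blue | Red.

Definition semi_proper (V : finType) (D : {set {set V}}) (c : V -> color) :=
  forall u v : V, u != v -> [set u; v]%SET \in D -> ~ (c u = Red /\ c v = Red).

Definition ideal_gen (A : comNzRingType) (S : set A) : set A :=
  [set p | exists2 s : seq (A * A), (forall q, q \in s -> S q.2) &
                                    p = \sum_(q <- s) q.1 * q.2].

(* The polynomial ring F[x_v : v in V]. *)
Notation polyV F V := (mpoly #|V| F).

Definition varV (F : fieldType) (V : finType) (v : V) : polyV F V :=
  mpolyX F (mnm1 (enum_rank v)).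

Definition stanley_reisner_ideal (F : fieldType) (V : finType)
    (D : {set {set V}}) : set (polyV F V) :=
  ideal_gen [set p | exists2 s : {set V}, s \notin D &
                                          p = \prod_(v in s) varV F v].

(* For T a set of homogeneous elements, the degree-k part of F[D] / (T)F[D]
   vanishes.  This ring is the quotient of the polynomial ring by the
   homogeneous ideal I_D + (T), so its degree-k part consists of the classes of
   the homogeneous polynomials of degree k. *)
Definition sr_quotient_part_eq0 (F : fieldType) (V : finType)
    (D : {set {set V}}) (T : set (polyV F V)) (k : nat) : Prop :=
  forall p : polyV F V, p \is ishomog1 k (@mdeg #|V|) ->
    ideal_gen (@stanley_reisner_ideal F V D `|` T) p.

Definition linear_form (F : fieldType) (V : finType) (a : V -> F) :
  polyV F V := \sum_(v : V) a v *: varV F v.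

Definition colored_form (F : fieldType) (V : finType) (c : V -> color)
    (k : color) (p : polyV F V) : Prop :=
  exists2 a : V -> F, (forall v, c v <> k -> a v = 0) & p = linear_form a.

Definition colored_SLP (F : fieldType) (V : finType) (D : {set {set V}})
    (c : V -> color) : Prop :=
  exists (t1 t2 t3 : polyV F V) (a : V -> F),
    [/\ colored_form c Blue t1,
        colored_form c Blue t2,
        colored_form c Red t3 &
        sr_quotient_part_eq0 D [set t1; t2; t3; linear_form a] 2].

(* Main.v *)
(* The degree-2 part of the quotient vanishes once there are positions p_v in F^4
   of the vertices, with third coordinate 0 for v blue and first two coordinates 0
   for v red, admitting no nonzero symmetric stress on the 1-skeleton.  Such
   positions exist for every planar graph with a semi-proper bi-coloring whose
   blue part satisfies the Laman-type bound.  The induction contracts a blue edge,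
   as in Whiteley's vertex splitting, chosen so that the bound is kept; edges in
   too many triangles yield clique cuts, since K5 and K33 are not planar.
   Planarity is MacLane's criterion over the field with two elements.  A
   triangulated sphere satisfies it because an edge lies in at most two triangles
   (three would embed K33 in the plane) and a 1-cocycle is a coboundary off any
   given edge (a sphere minus a point is contractible). *)

From HB Require Import structures.
Require Import Defs.
From mathcomp Require Import all_boot all_order all_algebra.
From mathcomp Require Import zify ring lra.

Set Implicit Arguments.
Unset Strict Implicit.
Unset Printing Implicit Defensive.
Import Order.TTheory GRing.Theory Num.Theory.
Local Open Scope ring_scope.

(** * Planar graphs *)

Section Planar.
Variable V : finType.
Implicit Types (e : rel V) (u v w : V).

(** The bound is what blue positions can carry. They use three coordinates, so a stress on n blue
    vertices and m edges has n + m entries, against 3n equations of which three are automatic,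
    [P^T L P] being symmetric; independence thus asks for m <= 2n - 3.

    Contracting [x v] spends the budget of a vertex, two edges, but is only sure to lose one. A blue
    set through [x] and [v] that attains the bound and contains no common neighbour of them blocks
    the contraction. Splitting the merged vertex again needs [x], [v] and their common neighbours in
    linearly independent positions, in dimension 4, and 3 for the blue ones: at most two common
    neighbours, at most one of them blue. Planarity answers both demands: a blue set attaining the
    bound contains a triangle, since triangle-free planar graphs have at most 2n - 4 edges, and
    three common neighbours force a separating triangle.

    Only blue edges are contracted, as a blue and a red vertex have no common colour to merge into.
    The induction leaves triangulated spheres at once, hence the class of all sparse planar graphs.
    MacLane's criterion makes deletion and contraction linear algebra. *)

Definition graph e := symmetric e /\ irreflexive e.

(** The vertex [v] stays behind, isolated, so the vertex type is the same throughout an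
    induction. *)
Definition contract x v e : rel V := fun i j =>
  [&& i != v, j != v, i != j &
      [|| e i j, (i == x) && e v j | (j == x) && e i v]].

Definition common x v e := [set k | e x k && e v k].

(** Ordered pairs count every edge twice, so the bounds below are doubled: [2 * #|W| - 3] edges
    become [4 * #|W| - 6] pairs. *)
Definition pairs e (W : {set V}) : {set V * V} :=
  [set p : V * V | [&& p.1 \in W, p.2 \in W & e p.1 p.2]].

Definition del_edge a b e : rel V := fun i j =>
  e i j && ~~ ((i == a) && (j == b) || (i == b) && (j == a)).

Definition add_edge a b e : rel V := fun i j =>
  e i j || ((i == a) && (j == b) || (i == b) && (j == a)).

(* Chains are taken modulo 2, on ordered pairs; bool is the field with two
   elements. *)
Definition cycle_on e (z : {ffun V * V -> bool}) :=
  [/\ forall u v, z (u, v) = z (v, u), forall u v, z (u, v) -> e u v &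
      forall u, \sum_v z (u, v) = 0].

(* MacLane's planarity criterion, with the outer face included. *)
Definition planar e := exists (I : finType) (f : I -> {ffun V * V -> bool}),
  [/\ forall i, cycle_on e (f i),
      forall p, #|[set i | f i p]| \in [:: 0; 2]%N &
      forall z, cycle_on e z -> exists J : {set I}, z = \sum_(i in J) f i].

Lemma eq_planar e e' : e =2 e' -> planar e -> planar e'.
Proof.
move=> ee'; have -> // : e' = e.
by apply/funext => i; apply/funext => j; rewrite ee'.
Qed.

Lemma sum_ffun_bool (I : finType) (J : {set I}) (f : I -> {ffun V * V -> bool}) p :
  (\sum_(i in J) f i) p = \sum_(i in J) f i p.
Proof. by rewrite sum_ffunE. Qed.

Lemma addffE (y z : {ffun V * V -> bool}) p : (y + z) p = y p (+) z p.
Proof. by rewrite ffunE. Qed.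

Lemma cycle_add e y z : cycle_on e y -> cycle_on e z -> cycle_on e (y + z).
Proof.
case=> y1 y2 y3 [z1 z2 z3]; split=> [u v|u v|u].
- by rewrite !addffE y1 z1.
- by rewrite addffE; case yuv : (y (u, v)) => /=; [move=> _; apply: y2|apply: z2].
- have -> : \sum_v (y + z) (u, v) = \sum_v (y (u, v) + z (u, v)).
    by apply: eq_bigr => v _; rewrite ffunE.
  by rewrite big_split /= y3 z3 addr0.
Qed.

Lemma cycle_sum e (I : finType) (J : {set I}) f :
  (forall i, cycle_on e (f i)) -> cycle_on e (\sum_(i in J) f i).
Proof.
move=> h; elim/big_rec: _ => [|i z _]; last by apply: cycle_add; exact: h.
split=> [u v|u v|u]; rewrite ?ffunE //.
by rewrite big1 // => v _; rewrite ffunE.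
Qed.

(** * Planarity under deletion and contraction *)

Lemma addbb0 (b : bool) : b + b = 0. Proof. by case: b. Qed.

(** If [a b] lies on two faces, deleting it fuses them: one becomes their sum and the other the
    empty face, which the definition allows. A cycle missing [a b] uses both of these faces or
    neither, so it remains a sum of faces. *)
Lemma planar_del_edge a b e : planar e -> planar (del_edge a b e).
Proof.
case=> I [f [f1 f2 f3]].
have sub z : cycle_on (del_edge a b e) z -> cycle_on e z /\ z (a, b) = false.
  case=> z1 z2 z3; split; first by split=> // u v /z2 /andP[].
  by apply/negP => /z2; rewrite /del_edge !eqxx andbF.
have sup z : cycle_on e z -> z (a, b) = false -> cycle_on (del_edge a b e) z.
  case=> z1 z2 z3 zab; split=> // u v zuv; rewrite /del_edge z2 //=.
  apply/negP => /orP[] /andP[/eqP ua /eqP vb]; move: zuv; rewrite ua vb ?zab //.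
  by rewrite z1 zab.
have := f2 (a, b); rewrite !inE => /orP[|].
  rewrite cards_eq0 => /eqP f0; exists I, f; split=> //.
    move=> i; apply: sup => //; apply/negP => fi.
    by have := in_set0 i; rewrite -f0 inE fi.
  by move=> z /sub[/f3].
case/cards2P => i1 [i2 [i12 f12]].
have fab i : f i (a, b) = (i == i1) || (i == i2).
  by have := congr1 (fun A : {set I} => i \in A) f12; rewrite !inE.
pose g i := if i == i1 then f i1 + f i2 else if i == i2 then 0 else f i.
exists I, g; split.
- move=> i; apply: sup.
    rewrite /g; case: eqP => _; first exact: cycle_add.
    case: eqP => // _; split=> [u v|u v|u]; rewrite ?ffunE //.
    by rewrite big1 // => v _; rewrite ffunE.
  rewrite /g; case: eqP => [_|i1'].
    by rewrite addffE !fab !eqxx orbT.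
  case: eqP => [_|i2']; first by rewrite ffunE.
  by rewrite fab; do 2 case: eqP.
- move=> p; have := f2 p.
  rewrite (cardsD1 i1) (cardsD1 i2) [in X in _ -> X](cardsD1 i1).
  rewrite [in X in _ -> X](cardsD1 i2) !inE /g eqxx [i2 == i1]eq_sym.
  rewrite (negbTE i12) eqxx addffE ffunE /=.
  have -> : [set i | (if i == i1 then f i1 + f i2 else
      if i == i2 then 0 else f i) p] :\ i1 :\ i2 = [set i | f i p] :\ i1 :\ i2.
    apply/setP => i; rewrite !inE.
    by case: (eqVneq i i2) => // ni2; case: (eqVneq i i1) => // ni1.
  by case: (f i1 p); case: (f i2 p); rewrite /= ?add0n ?add1n;
    case: #|_| => [|[|[|]]].
- move=> z /sub[/f3[J zJ] zab].
  have iJ : (i1 \in J) = (i2 \in J).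
    move: zab; rewrite zJ sum_ffun_bool.
    have h i : i \in J -> f i (a, b) = (i == i1) + (i == i2).
      by move=> _; rewrite fab; case: eqP => [->|_] //; rewrite (negbTE i12).
    rewrite (eq_bigr _ h) big_split /=.
    have s1 k : \sum_(i in J) (i == k : bool) = (k \in J).
      case kJ : (k \in J).
        rewrite (bigD1 k) //= eqxx big1 ?addr0 // => i /andP[_ /negbTE] -> //.
      by rewrite big1 // => i iJ; apply/negbTE; apply: contraTneq iJ => ->; rewrite kJ.
    by rewrite !s1; case: (i1 \in J); case: (i2 \in J).
  exists J; rewrite zJ; case i1J : (i1 \in J).
    have i2J : i2 \in J by rewrite -iJ.
    have i2J1 : (i2 \in J) && (i2 != i1) by rewrite i2J eq_sym.
    rewrite [LHS](bigD1 i1) //= [in LHS](bigD1 i2) //=.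
    rewrite [RHS](bigD1 i1) //= [in RHS](bigD1 i2) //=.
    rewrite /g !eqxx [i2 == i1]eq_sym (negbTE i12) add0r addrA; congr (_ + _).
    by apply: eq_bigr => i /andP[/andP[_ /negbTE ->] /negbTE ->].
  apply: eq_bigr => i iJ'; rewrite /g; case: eqP => [ii|_].
    by move: iJ'; rewrite ii i1J.
  by case: eqP => [ii|//]; move: iJ'; rewrite ii -iJ i1J.
Qed.

Lemma planar_sub e e' : graph e' -> subrel e' e -> planar e -> planar e'.
Proof.
move=> [s' i'].
pose D (e : rel V) := [set p : V * V | e p.1 p.2 && ~~ e' p.1 p.2].
have [m] := ubnP #|D e|; elim: m e => // m IH e; rewrite ltnS => De ee' pe.
case: (pickP [pred p : V * V | e p.1 p.2 && ~~ e' p.1 p.2]) => [[a b] /= /andP[ab nab]|h].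
  apply: (IH (del_edge a b e)); last exact: planar_del_edge.
    apply: leq_trans De; apply: proper_card; apply/properP; split.
      by apply/subsetP => p; rewrite !inE => /andP[/andP[-> _] ->].
    by exists (a, b); rewrite !inE /= ?ab // /del_edge !eqxx andbF.
  move=> u v uv; rewrite /del_edge ee' //=; apply: contra nab.
  by case/orP => /andP[/eqP <- /eqP <-] //; rewrite s'.
apply: eq_planar pe => u v; have /= := h (u, v).
case e'uv : (e' u v); first by rewrite ee'.
by rewrite andbT.
Qed.

Lemma graph_contract x v e : graph e -> graph (contract x v e).
Proof.
case=> se ie; split=> [i j|i]; last by rewrite /contract eqxx !andbF.
rewrite /contract andbCA [e j i]se [e v i]se [e j v]se [j == i]eq_sym.
by rewrite [X in _ || X]orbC.
Qed.

(* The two edges from x and v to a vertex never coexist, so that edges of the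
   contraction correspond to edges of e. *)
Lemma planar_contract_disjoint x v e : graph e -> e x v ->
  (forall k, ~~ (e x k && e v k)) -> planar e -> planar (contract x v e).
Proof.
move=> [se ie] xv nc [I [f [f1 f2 f3]]].
have xv' : x != v by apply: contraTneq xv => ->; rewrite ie.
(* The image of a chain when [v] is sent to [x]; the edge [x v] becomes a loop and is dropped. *)
pose push (z : {ffun V * V -> bool}) : {ffun V * V -> bool} :=
  [ffun p => [&& p.1 != v, p.2 != v, p.1 != p.2 &
     z p (+) ((p.1 == x) && z (v, p.2)) (+) ((p.2 == x) && z (p.1, v))]].
have pushD y z : push (y + z) = push y + push z.
  apply/ffunP => -[i j]; rewrite addffE !ffunE /=.
  case: (i != v) => //; case: (j != v) => //; case: (i != j) => //=.
  case: (i == x); case: (j == x) => /=; rewrite -!/(addb _ _);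
  by case: (y (i, j)); case: (z (i, j)); case: (y (v, j)); case: (z (v, j));
     case: (y (i, v)); case: (z (i, v)).
have push0 : push 0 = 0.
  by apply/ffunP => -[i j]; rewrite !ffunE /= !andbF.
have push_sum (J : {set I}) : push (\sum_(i in J) f i) = \sum_(i in J) push (f i).
  by apply: (big_morph push pushD push0).
have irr z i : cycle_on e z -> z (i, i) = false.
  by case=> _ z2 _; apply/negP => /z2; rewrite ie.
have push_cycle z : cycle_on e z -> cycle_on (contract x v e) (push z).
  move=> cz; have [z1 z2 z3] := cz; split=> [i j|i j|i].
  - rewrite !ffunE /= andbCA [j == i]eq_sym (z1 j i) (z1 v i) (z1 j v).
    by rewrite addbAC.
  - rewrite ffunE /= /contract => /and4P[-> -> ->] /= .
    case zij : (z (i, j)); first by rewrite z2.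
    case: (i == x); case: (j == x); rewrite /= ?addbF //=.
    - case zvj : (z (v, j)); first by rewrite (z2 _ _ zvj) orbT.
      by move=> /= /z2 ->; rewrite !orbT.
    - by move=> /z2 ->; rewrite orbT.
    - by move=> /z2 ->; rewrite orbT.
  - case: (eqVneq i v) => [->|iv].
      by rewrite big1 // => j _; rewrite ffunE /= eqxx.
    have := z3 i; rewrite (bigD1 v) // (bigD1 x) //= => zi.
    have pv : push z (i, v) = false by rewrite ffunE /= eqxx andbF.
    rewrite (bigD1 v) // (bigD1 x) //= pv [push z (i, x)]ffunE /= iv xv' eqxx /=.
    case: (eqVneq i x) zi => [->|ix] zi.
      have := z3 v; rewrite (bigD1 v) // (bigD1 x) //= => zv.
      rewrite (eq_bigr (fun j => z (x, j) + z (v, j))); last first.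
        move=> j /andP[jv jx]; rewrite ffunE /= xv' jv [x == j]eq_sym jx eqxx /=.
        by rewrite (negbTE jx) addbF.
      rewrite big_split /=; move: zi zv; rewrite !irr // (z1 v x).
      case: (z (x, v)); case: (\sum_(i | _) z (x, i)); by case: (\sum_(i | _) _).
    rewrite (eq_bigr (fun j => z (i, j))); last first.
      move=> j /andP[jv jx]; rewrite ffunE /= iv jv (negbTE ix) (negbTE jx) /=.
      rewrite !addbF; case: (eqVneq i j) => [->|//].
      by rewrite irr.
    move: zi; rewrite addbF /=.
    by case: (z (i, v)); case: (z (i, x)); case: (\sum_(j | _) _).
(* By disjointness each pair of the contraction reads a single pair of [e] on all cycles, so being
   covered 0 or 2 times carries over. *)
have rep p : exists p', forall z, cycle_on e z -> push z p = z p'.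
  case: p => i j.
  case H : [&& i != v, j != v & i != j]; last first.
    exists (v, v) => z cz; rewrite irr // ffunE /=.
    by move: H; case: (i != v) => //=; case: (j != v) => //= ->.
  case/and3P: H => iv jv ij.
  case: (eqVneq i x) => ix.
    exists (if e x j then (x, j) else (v, j)) => z cz; have [z1 z2 z3] := cz.
    rewrite ffunE /= iv jv ij ix eqxx /= [j == x]eq_sym -ix (negbTE ij) ix addbF.
    have := nc j; case: ifP => [exj /= nvj|exj _].
      by rewrite [z (v, j)](_ : _ = false) ?addbF //; apply/negP => /z2; apply/negP.
    by rewrite [z (x, j)](_ : _ = false) //; apply/negP => /z2; rewrite exj.
  case: (eqVneq j x) => jx.
    exists (if e x i then (i, x) else (i, v)) => z cz; have [z1 z2 z3] := cz.
    rewrite ffunE /= iv jv ij (negbTE ix) jx eqxx /= addbF.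
    have := nc i; case: ifP => [exi /= nvi|exi _].
      rewrite [z (i, v)](_ : _ = false) ?addbF //; apply/negP => /z2.
      by rewrite se; apply/negP.
    by rewrite [z (i, x)](_ : _ = false) //; apply/negP => /z2; rewrite se exi.
  exists (i, j) => z cz; rewrite ffunE /= iv jv ij (negbTE ix) (negbTE jx) /=.
  by rewrite !addbF.
exists I, (push \o f); split.
- by move=> i; exact: push_cycle.
- move=> p; have [p' pp'] := rep p.
  suff -> : [set i | (push \o f) i p] = [set i | f i p'] by exact: f2.
  by apply/setP => i; rewrite !inE /= pp'.
move=> z' cz'; have [z1 z2 z3] := cz'.
(* A cycle of the contraction is lifted edge by edge. The coefficient [s] of [x v] makes the degree
   at [x] even; evenness at [v] then follows from that of [z'] at [x]. *)
pose s := \sum_j (z' (x, j) && e x j).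
pose z : {ffun V * V -> bool} := [ffun p =>
  if p.1 == p.2 then false else
  if (p.1 == x) && (p.2 == v) || (p.1 == v) && (p.2 == x) then s else
  if p.1 == x then z' p && e x p.2 else if p.2 == x then z' p && e x p.1 else
  if p.1 == v then z' (x, p.2) && e v p.2 else
  if p.2 == v then z' (p.1, x) && e v p.1 else z' p].
have vx' : v == x = false by rewrite eq_sym; apply: negbTE.
have xvF : x == v = false by apply: negbTE.
have z'v j : z' (j, v) = false.
  by apply/negP => /z2; rewrite /contract eqxx andbF.
have z'v2 j : z' (v, j) = false by rewrite z1.
have z'i j : z' (j, j) = false.
  by apply/negP => /z2; rewrite /contract eqxx !andbF.
have z'x j : z' (x, j) -> e x j (+) e v j.
  move/z2; rewrite /contract eqxx => /and4P[_ jv xj] /=.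
  rewrite eq_sym in xj; rewrite (negbTE xj) /= orbF.
  by have := nc j; case: (e x j); case: (e v j).
have cz : cycle_on e z.
  split=> [i j|i j|i].
  - rewrite !ffunE /= [j == i]eq_sym (z1 j i) (z1 x i) (z1 j x).
    case: (eqVneq i j) => // ij.
    case: (eqVneq i x) ij => [->|ix] ij; case: (eqVneq j x) ij => [->|jx] ij;
      rewrite ?eqxx ?xvF ?andbF ?orbF //= in ij *.
    - by case: (j == v).
    - by case: (i == v).
    - case: (eqVneq i v) ij => [->|iv] ij //=.
      by move: ij; rewrite eq_sym => /negbTE ->.
  - rewrite ffunE /=; case: (eqVneq i j) => // ij.
    case: ifP => [|_].
      by case/orP => /andP[/eqP -> /eqP ->]; rewrite ?[e v x]se xv.
    case: (eqVneq i x) => [->|ix]; first by case/andP.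
    case: (eqVneq j x) => [->|jx]; first by rewrite se => /andP[].
    case: (eqVneq i v) => [->|iv]; first by case/andP.
    case: (eqVneq j v) => [->|jv]; first by rewrite se => /andP[].
    by move/z2; rewrite /contract (negbTE ix) (negbTE jx) /= orbF => /and4P[].
  - have s' : s = \sum_(j | (j != v) && (j != x)) (z' (x, j) && e x j).
      by rewrite /s (bigD1 v) // (bigD1 x) //= z'v z'i /= !add0r.
    rewrite (bigD1 v) // (bigD1 x) //=.
    case: (eqVneq i x) => [->|ix].
      rewrite [z (x, v)]ffunE /= [z (x, x)]ffunE /= !eqxx xvF /= add0r.
      rewrite (eq_bigr (fun j => z' (x, j) && e x j)) -?s' ?addbb0 //.
      move=> j /andP[jv jx]; rewrite ffunE /= eqxx [x == j]eq_sym (negbTE jx).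
      by rewrite (negbTE jv) xvF.
    case: (eqVneq i v) => [->|iv].
      rewrite [z (v, v)]ffunE /= [z (v, x)]ffunE /= !eqxx vx' /= ?orbT ?add0r.
      rewrite (eq_bigr (fun j => z' (x, j) && e v j)); last first.
        move=> j /andP[jv jx]; rewrite ffunE /= eqxx [v == j]eq_sym (negbTE jv).
        by rewrite (negbTE jx) vx'.
      rewrite s' -big_split /=; have := z3 x; rewrite (bigD1 v) // (bigD1 x) //=.
      rewrite z'v z'i !add0r => h; rewrite -[RHS]h; apply: eq_bigr => j _.
      have := z'x j; case: (z' (x, j)) => //= /(_ isT).
      by case: (e x j); case: (e v j).
    have := z3 i; rewrite (bigD1 v) // (bigD1 x) //= z'v add0r.
    rewrite [z (i, v)]ffunE /= [z (i, x)]ffunE /= !eqxx xvF vx'.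
    rewrite (negbTE ix) (negbTE iv) /=.
    rewrite [\sum_(j | _) z (i, j)](eq_bigr (fun j => z' (i, j))); last first.
      move=> j /andP[jv jx]; rewrite ffunE /= (negbTE ix) (negbTE iv).
      rewrite (negbTE jv) (negbTE jx) /=; case: eqP => [->|//].
      by rewrite z'i.
    have := z'x i; rewrite (z1 x i); case: (z' (i, x)) => /= [/(_ isT)|_].
      by case: (e x i); case: (e v i); case: (\sum_(j | _) _).
    by [].
have [J zJ] := f3 z cz; exists J; rewrite -push_sum -zJ.
apply/ffunP => -[i j]; rewrite ffunE /=.
case: (eqVneq i v) => [->|iv]; first by rewrite z'v2.
case: (eqVneq j v) => [->|jv]; first by rewrite z'v.
case: (eqVneq i j) => [->|ij]; first by rewrite z'i.
rewrite /= ![z _]ffunE /= (negbTE ij) (negbTE iv) (negbTE jv) !andbF /=.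
case: (eqVneq i x) => [ix|ix].
  move: ij; rewrite ix eq_sym => jx.
  rewrite /= eqxx vx' [v == j]eq_sym (negbTE jv) (negbTE jx) /= addbF.
  by have := z'x j; case: (z' (x, j)) => //= ->.
case: (eqVneq j x) => [->|jx] /=; last by rewrite !addbF.
rewrite eqxx vx' /= addbF.
by have := z'x i; rewrite (z1 x i); case: (z' (i, x)) => //= ->.
Qed.

(** An edge from [v] to a common neighbour only duplicates one at [x] in the contraction. Deleting
    such edges first leaves the contraction unchanged and reaches the disjoint case. *)
Lemma planar_contract x v e : graph e -> e x v -> planar e ->
  planar (contract x v e).
Proof.
move=> [se ie] xv pe.
pose e0 : rel V := fun i j =>
  [&& e i j, ~~ ((i == v) && e x j) & ~~ ((j == v) && e x i)].
have g0 : graph e0.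
  split=> [i j|i]; last by rewrite /e0 ie.
  by rewrite /e0 [e j i]se andbA andbAC -andbA.
have xv' : x == v = false by apply/negP => /eqP xv'; move: xv; rewrite xv' ie.
have : planar (contract x v e0).
  apply: planar_contract_disjoint => //.
  - by rewrite /e0 xv xv' ie !andbF.
  - move=> k; rewrite /e0 eqxx /= xv' ie andbF /=.
    by case: (e x k); rewrite ?andbF.
  - by apply: planar_sub pe => // i j /and3P[].
apply: eq_planar => i j; rewrite /contract /e0 !eqxx /=.
case: (eqVneq i v) => // iv; case: (eqVneq j v) => //= jv; rewrite !andbT.
case: (eqVneq i j) => // ij; rewrite /= ?andbT.
case: (eqVneq i x) => [->|ix] /=.
  by case: (e x j); rewrite ?orbT //=; rewrite ?ie ?andbF ?andbT.
case: (eqVneq j x) => [->|jx] //=.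
rewrite [e i x]se; case: (e x i); rewrite ?orbT //=.
by rewrite ?andbT.
Qed.


(** The pairs in [Z] are redundant: they turn into loops or coincide with a pair at [x] that is
    already there, so the others map onto the pairs of the contraction. The last summand makes the
    claim trivial when [x] is outside [W]. *)
Lemma contract_pairs_sub x v e (Z : {set V * V}) (W : {set V}) :
  graph e -> v \notin W -> (forall p, p \in Z -> (p.1 == v) || (p.2 == v)) ->
  (forall p, p \in Z -> p.1 = v -> p.2 != x -> e x p.2) ->
  (forall p, p \in Z -> p.2 = v -> p.1 != x -> e p.1 x) ->
  (#|pairs (contract x v e) W| + #|Z :&: pairs e (v |: W)| <=
   #|pairs e (v |: W)| + (x \notin W) * #|pairs e (v |: W)|)%N.
Proof.
move=> [se ie] vW Zv Z1 Z2.
case xW : (x \in W); last first.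
  rewrite mul1n leq_add //; last by apply: subset_leq_card; exact: subsetIr.
  apply: subset_leq_card; apply/subsetP => -[i j]; rewrite !inE /=.
  case/and3P => iW jW /and4P[iv jv ij].
  case: (i =P x) => [ix|_]; first by rewrite -ix iW in xW.
  case: (j =P x) => [jx|_]; first by rewrite -jx jW in xW.
  by rewrite /= orbF iW jW !orbT.
rewrite mul0n addn0.
pose phi i := if i == v then x else i.
have sub : pairs (contract x v e) W \subset
    [set (phi p.1, phi p.2) | p in pairs e (v |: W) :\: Z].
  apply/subsetP => -[i j]; rewrite !inE /= => /and3P[iW jW /and4P[iv jv ij eij]].
  have phiE k : k != v -> phi k = k by rewrite /phi => /negbTE ->.
  have phiv : phi v = x by rewrite /phi eqxx.
  case eij' : (e i j).
    apply/imsetP; exists (i, j); last by rewrite /= !phiE.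
    rewrite !inE /= iW jW eij' !orbT !andbT; apply/negP => /Zv /=.
    by rewrite (negbTE iv) (negbTE jv).
  move: eij; rewrite eij' /=; case/orP => /andP[/eqP xx ev].
    apply/imsetP; exists (v, j); last by rewrite /= phiv phiE // xx.
    rewrite !inE /= eqxx jW ev !orbT !andbT; apply/negP => /Z1 /= h.
    by move: eij'; rewrite xx h // eq_sym -xx.
  apply/imsetP; exists (i, v); last by rewrite /= phiv phiE // xx.
  rewrite !inE /= eqxx iW ev !orbT !andbT; apply/negP => /Z2 /= h.
  by move: eij'; rewrite xx h // -xx.
have := leq_trans (subset_leq_card sub) (leq_imset_card _ _).
by rewrite setIC -(cardsID Z (pairs e (v |: W))) addnC leq_add2l.
Qed.

Lemma card_contract x v e : graph e -> e x v ->
  (#|pairs (contract x v e) setT| < #|pairs e setT|)%N.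
Proof.
move=> ge xv; have [se ie] := ge.
have xv' : x != v by apply: contraTneq xv => ->; rewrite ie.
have h1 p : p \in [set (x, v)] -> (p.1 == v) || (p.2 == v).
  by move/set1P => -> /=; rewrite eqxx orbT.
have h2 p : p \in [set (x, v)] -> p.1 = v -> p.2 != x -> e x p.2.
  by move/set1P => -> /= xv''; rewrite xv'' eqxx in xv'.
have h3 p : p \in [set (x, v)] -> p.2 = v -> p.1 != x -> e p.1 x.
  by move/set1P => -> /=; rewrite eqxx.
have vW : v \notin setT :\ v by rewrite !inE eqxx.
have := contract_pairs_sub ge vW h1 h2 h3.
rewrite !inE xv' mul0n addn0 setD1K ?inE //.
have -> : [set (x, v)] :&: pairs e setT = [set (x, v)].
  by apply/setIidPl; rewrite sub1set !inE.
rewrite cards1 addn1; apply: leq_ltn_trans.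
apply: subset_leq_card; apply/subsetP => p; rewrite !inE /=.
by move=> h; rewrite h; case/and4P: h => -> ->.
Qed.

(** * Euler's inequality and the graphs that it excludes *)

Lemma card_pairs_orient e W : graph e ->
  #|pairs e W| = (#|[set p in pairs e W | (enum_rank p.1 < enum_rank p.2)%N]|).*2.
Proof.
move=> [se ie]; rewrite -addnn.
rewrite -(cardsID [set p : V * V | (enum_rank p.1 < enum_rank p.2)%N]).
congr (_ + _)%N.
  by apply: eq_card => p; rewrite !inE.
have swapK : involutive (fun p : V * V => (p.2, p.1)) by case.
rewrite -(card_imset _ (inv_inj swapK)); apply: eq_card => -[i j].
apply/imsetP/idP => [[[k l]]|].
  rewrite !inE /= -leqNgt => /andP[lk /and3P[kW lW kl]] [-> ->].
  rewrite kW lW se kl /= ltn_neqAle lk andbT; apply: contraTneq kl.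
  by move/val_inj/enum_rank_inj => ->; rewrite ie.
rewrite !inE /= => /andP[/and3P[iW jW ij] lt]; exists (j, i) => //.
by rewrite !inE /= -leqNgt (ltnW lt) iW jW se.
Qed.

(** The handshake lemma modulo 2. *)
Lemma sum_sym_bool (z : V -> V -> bool) : (forall u v, z u v = z v u) ->
  (forall u, z u u = false) -> \sum_u \sum_v z u v = 0.
Proof.
move=> zs z0; rewrite pair_big /=.
rewrite (bigID (fun p : V * V => (enum_rank p.1 < enum_rank p.2)%N)) /=.
rewrite [X in _ + X](_ : _ =
    \sum_(p : V * V | (enum_rank p.1 < enum_rank p.2)%N) z p.1 p.2) ?addbb0 //.
rewrite (reindex_inj (h := fun p : V * V => (p.2, p.1))) /=; last first.
  by case=> a b [c d] /= [-> ->].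
rewrite (bigID (fun p : V * V => p.1 == p.2)) /= big1 ?add0r => [|[a b] /=].
  apply: eq_big => [[a b] /=|[a b] _]; last by rewrite zs.
  rewrite -leqNgt; case: eqP => [->|ab]; first by rewrite ltnn andbF.
  rewrite andbT leq_eqVlt; case: eqP => // /val_inj /enum_rank_inj ba.
  by case: ab.
by case/andP => _ /eqP ->; rewrite z0.
Qed.

(** The number of edges is at most [#|W| - 1] plus the dimension of the cycle space, by counting
    sets instead of dimensions. A set of edges is encoded by its odd vertices and by the
    coefficients of its sum with a chosen set of the same parities. The parity at [w0] is left out
    because the handshake lemma forces it. *)
Lemma card_oriented_pairs e (W : {set V}) w0 (I : finType)
    (f : I -> {ffun V * V -> bool}) (T : {set I}) : graph e -> w0 \in W ->
  (forall i j, e i j -> i \in W) ->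
  (forall z, cycle_on e z -> exists2 J : {set I}, J \subset T &
                                                  z = \sum_(i in J) f i) ->
  (#|[set p in pairs e W | (enum_rank p.1 < enum_rank p.2)%N]| <=
   #|W|.-1 + #|T|)%N.
Proof.
move=> [se ie] w0W eW span; set Eo := [set p in _ | _].
pose cc (Y : {set V * V}) : {ffun V * V -> bool} :=
  [ffun p => (p \in Y) || ((p.2, p.1) \in Y)].
have ccs Y u v : cc Y (u, v) = cc Y (v, u) by rewrite !ffunE /= orbC.
have cce (Y : {set V * V}) u v : Y \subset Eo -> cc Y (u, v) -> e u v.
  move=> /subsetP YE; rewrite ffunE /= => /orP[/YE|/YE]; rewrite !inE /=.
    by case/andP => /and3P[].
  by rewrite se => /andP[/and3P[]].
pose D (Y : {set V * V}) := [set v in W :\ w0 | \sum_w cc Y (v, w) : bool].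
pose rep (S : {set V}) := odflt set0 [pick Y in powerset Eo | D Y == S].
have repP (Y : {set V * V}) : Y \subset Eo ->
    rep (D Y) \subset Eo /\ D (rep (D Y)) = D Y.
  move=> YE; rewrite /rep; case: pickP => [Z /andP[]|/(_ Y)].
    by rewrite inE => ZE /eqP.
  by rewrite inE YE eqxx.
have cyc (Y Z : {set V * V}) : Y \subset Eo -> Z \subset Eo -> D Y = D Z ->
    cycle_on e (cc Y + cc Z).
  move=> YE ZE DYZ.
  have H u v : (cc Y + cc Z)%R (u, v) -> e u v.
    rewrite addffE; case cY : (cc Y (u, v)) => /=.
      by move=> _; exact: cce cY.
    exact: cce.
  have S u v : (cc Y + cc Z)%R (u, v) = (cc Y + cc Z)%R (v, u).
    by rewrite !addffE !(ccs _ u).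
  have deg0 v : v != w0 -> \sum_w (cc Y + cc Z)%R (v, w) = 0.
    move=> vw0; case vW : (v \in W); last first.
      rewrite big1 // => w _; case: ((cc Y + cc Z)%R (v, w)) (@H v w) => //.
      by move=> /(_ isT) /eW; rewrite vW.
    have -> : \sum_w (cc Y + cc Z)%R (v, w) =
              \sum_w cc Y (v, w) + \sum_w cc Z (v, w).
      by rewrite -big_split; apply: eq_bigr => w _; rewrite ffunE.
    have := congr1 (fun A : {set V} => v \in A) DYZ; rewrite !inE vw0 vW /= => ->.
    exact: addbb0.
  split=> // u; case: (eqVneq u w0) => [->|]; last exact: deg0.
  have irr v : (cc Y + cc Z)%R (v, v) = false by apply/negP => /H; rewrite ie.
  have := sum_sym_bool (z := fun u v => (cc Y + cc Z)%R (u, v)) S irr.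
  by rewrite (bigD1 w0) //= [X in _ + X](big1 _ _ _ deg0) addr0.
pose Js (z : {ffun V * V -> bool}) :=
  odflt set0 [pick J in powerset T | z == \sum_(i in J) f i].
have JsP z : cycle_on e z -> Js z \subset T /\ z = \sum_(i in Js z) f i.
  move=> /span[J JT zJ]; rewrite /Js; case: pickP => [K /andP[]|/(_ J)].
    by rewrite inE => KT /eqP.
  by rewrite inE JT zJ eqxx.
pose phi (Y : {set V * V}) := (D Y, Js (cc Y + cc (rep (D Y)))).
have phi_inj : {in powerset Eo &, injective phi}.
  move=> Y Z; rewrite !inE => YE ZE [DYZ JYZ].
  have [rY1 rY2] := repP Y YE; have [rZ1 rZ2] := repP Z ZE.
  have [_ eY] := JsP _ (cyc _ _ YE rY1 (esym rY2)).
  have [_ eZ] := JsP _ (cyc _ _ ZE rZ1 (esym rZ2)).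
  have : cc Y + cc (rep (D Y)) = cc Z + cc (rep (D Y)).
    by rewrite eY [in RHS]DYZ eZ JYZ.
  move/addIr => ccYZ.
  have recover (X : {set V * V}) : X \subset Eo -> X = [set p in Eo | cc X p].
    move=> /subsetP XE; apply/setP => -[i j]; rewrite inE ffunE /=.
    case iX : ((i, j) \in X); first by rewrite XE.
    case ij : ((i, j) \in Eo) => //=; apply/esym/negP => /XE.
    move: ij; rewrite !inE /= => /andP[_ lt1] /andP[_ lt2].
    by have := ltn_trans lt1 lt2; rewrite ltnn.
  by rewrite (recover Y YE) (recover Z ZE) ccYZ.
have : (#|phi @: powerset Eo| <= #|setX (powerset (W :\ w0)) (powerset T)|)%N.
  apply: subset_leq_card; apply/subsetP => _ /imsetP[Y YE ->].
  rewrite inE in YE; rewrite !inE /=; apply/andP; split.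
    by apply/subsetP => v; rewrite !inE => /andP[].
  by have [r1 r2] := repP Y YE; have [] := JsP _ (cyc _ _ YE r1 (esym r2)).
rewrite card_in_imset // cardsX !card_powerset -expnD leq_exp2l //.
by rewrite (cardsD1 w0 W) w0W.
Qed.

(* Every even subgraph is a sum of the nonempty faces but one, and every set of
   edges is determined modulo even subgraphs by the parities of its degrees. *)
Lemma planar_count e (W : {set V}) w0 k : graph e -> planar e -> w0 \in W ->
  (forall i j, e i j -> i \in W) ->
  (forall z, cycle_on e z -> z != 0 -> (k.*2 <= #|[set p | z p]|)%N) ->
  exists f, [/\ (k * f <= #|pairs e W|)%N,
     (f = 0 -> #|pairs e W| + 2 <= #|W|.*2)%N &
     (0 < f -> #|pairs e W| + 4 <= #|W|.*2 + f.*2)%N].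
Proof.
move=> ge [I [f [f1 f2 f3]]] w0W eW girth; have [se ie] := ge.
pose I' := [set i | f i != 0].
have pE : pairs e W = [set p | e p.1 p.2].
  apply/setP => -[i j]; rewrite !inE /=; case eij : (e i j); last by rewrite !andbF.
  by rewrite (eW i j) // (eW j i) // se.
have sumF : \sum_i f i = 0.
  apply/ffunP => p; rewrite sum_ffunE ffunE.
  have -> : \sum_i f i p = \sum_(i in [set i | f i p]) true.
    rewrite [RHS]big_mkcond; apply: eq_bigr => i _; rewrite inE.
    by case: (f i p).
  rewrite big_const; have := f2 p; rewrite !inE.
  by case/orP => /eqP ->.
exists #|I'|; split.
(* Double counting: a nonempty face has at least [k.*2] ordered pairs and a pair lies on at most two
   faces; the factor 2 cancels. *)
- have : (\sum_(i in I') #|[set p | f i p]| <= #|pairs e W|.*2)%N.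
    have -> : (\sum_(i in I') #|[set p | f i p]| =
        \sum_(p in pairs e W) #|[set i | f i p]|)%N.
      under eq_bigr => i _ do rewrite -sum1dep_card big_mkcond /=.
      under [RHS]eq_bigr => p _ do rewrite -sum1dep_card big_mkcond /=.
      rewrite exchange_big /= [LHS](bigID (fun p => p \in pairs e W)) /=.
      rewrite [X in (_ + X)%N]big1 ?addn0; last first.
        move=> [i j]; rewrite pE inE /= => nij; rewrite big1 // => l _.
        by case: ifP => // fl; move: nij; have [_ -> //] := f1 l.
      apply: eq_bigr => p _; rewrite big_mkcond /=; apply: eq_bigr => i _.
      rewrite inE; case: (eqVneq (f i) 0) => [->|//].
      by rewrite ffunE.
    apply: (@leq_trans (\sum_(p in pairs e W) 2)).
      by apply: leq_sum => p _; have := f2 p; rewrite !inE => /orP[] /eqP ->.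
    by rewrite sum_nat_const muln2.
  suff : (\sum_(i in I') k.*2 <= \sum_(i in I') #|[set p | f i p]|)%N.
    move=> h1 h2; have := leq_trans h1 h2.
    by rewrite sum_nat_const -!muln2 mulnA leq_pmul2r // mulnC.
  by apply: leq_sum => i; rewrite inE => fi; apply: girth.
- move=> /eqP; rewrite cards_eq0 => /eqP I'0.
  rewrite (card_pairs_orient W ge).
  have := @card_oriented_pairs e W w0 I f set0 ge w0W eW.
  rewrite cards0 addn0 => H; rewrite -[in X in (_ <= X.*2)%N](prednK (n := #|W|)).
    rewrite doubleS addn2 !ltnS leq_double; apply: H => z /f3[J ->].
    exists set0; first exact: sub0set.
    rewrite big_set0 big1 // => i _; apply/eqP; apply: contraT => fi.
    by have := in_set0 i; rewrite -I'0 inE fi.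
  by apply/card_gt0P; exists w0.
- move=> /card_gt0P[i1 i1I].
  rewrite (card_pairs_orient W ge).
  have := @card_oriented_pairs e W w0 I f (I' :\ i1) ge w0W eW.
  have W0 : (0 < #|W|)%N by apply/card_gt0P; exists w0.
  have I0 : (0 < #|I'|)%N by apply/card_gt0P; exists i1.
  have -> : #|I' :\ i1| = #|I'|.-1 by rewrite (cardsD1 i1 I') i1I.
  move=> H; suff H' : (#|[set p in pairs e W | (enum_rank p.1 < enum_rank p.2)%N]|
       <= #|W|.-1 + #|I'|.-1)%N.
    by move: W0 I0 H'; lia.
  apply: H => z /f3[J zJ].
  (* All faces together sum to 0, so [J] and its complement give the same cycle, and one of the two
     avoids [i1]. *)
  pose K := if i1 \in J then ~: J else J.
  have zK : z = \sum_(i in K) f i.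
    rewrite /K; case: ifP => // _.
    have := sumF; rewrite (bigID (fun i => i \in J)) /= -zJ => /eqP.
    rewrite addr_eq0 => /eqP ->.
    transitivity (\sum_(i | i \notin J) f i); last first.
      by apply: eq_bigl => i; rewrite inE.
    apply/ffunP => p; rewrite [LHS]ffunE.
    by case: (_ p).
  exists (K :&: (I' :\ i1)); first exact: subsetIr.
  rewrite zK (bigID (fun i => i \in I' :\ i1)) /= [X in _ + X]big1 ?addr0.
    by apply: eq_bigl => i; rewrite in_setI.
  move=> i /andP[iK]; rewrite !inE negb_and !negbK => /orP[/eqP ii|/eqP //].
  by move: iK; rewrite ii /K; case: ifP => [i1J|->//]; rewrite inE i1J.
Qed.

Lemma cycle_next e z u v : cycle_on e z -> z (u, v) ->
  exists2 w, w != u & z (v, w).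
Proof.
case=> z1 z2 z3 zuv; apply: contrapT => h.
have := z3 v; rewrite (bigD1 u) //= z1 zuv big1 // => w wu.
by case zvw : (z (v, w)) => //; case: h; exists w.
Qed.

Lemma cycle_edge z : z != 0 :> {ffun V * V -> bool} -> exists u v, z (u, v).
Proof.
move=> z0; apply: contrapT => h; case/eqP: z0; apply/ffunP => -[u v].
by rewrite ffunE; case zuv : (z (u, v)) => //; case: h; exists u, v.
Qed.

Lemma cycle_card6 e z : graph e -> cycle_on e z -> z != 0 ->
  (6 <= #|[set p | z p]|)%N.
Proof.
move=> [se ie] cz /cycle_edge[u [v zuv]]; have [z1 z2 z3] := cz.
have zvu : z (v, u) by rewrite z1.
have [w wu zvw] := cycle_next cz zuv; have [w' w'v zuw] := cycle_next cz zvu.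
have ne a b : z (a, b) -> a != b by move/z2; apply: contraTneq => ->; rewrite ie.
have uv := ne _ _ zuv; have vw := ne _ _ zvw; have uw := ne _ _ zuw.
pose s := [:: (u, v); (v, u); (v, w); (w, v); (u, w'); (w', u)].
rewrite -[6%N]/(size s) cardE; apply: uniq_leq_size.
  rewrite /s /= !inE !xpair_eqE !negb_or !negb_and.
  rewrite ?(eq_sym v u) ?(eq_sym w u) ?(eq_sym w v) ?(eq_sym w' u) ?(eq_sym w' v).
  rewrite eq_sym in wu; rewrite eq_sym in w'v.
  by rewrite uv wu vw uw w'v ?orbT.
move=> p; rewrite mem_enum !inE.
by move=> /or4P[|||/or3P[||]] /eqP ->; rewrite ?zuv ?zvw ?zuw // z1.
Qed.

(** The cycle continues beyond both ends of an edge [u v], to [w] and [w']. Without triangles these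
    differ, and one more step from [w] gives a fourth edge. *)
Lemma cycle_card8 e z : graph e ->
  (forall a b c, e a b -> e b c -> e a c -> False) -> cycle_on e z -> z != 0 ->
  (8 <= #|[set p | z p]|)%N.
Proof.
move=> [se ie] tri cz /cycle_edge[u [v zuv]]; have [z1 z2 z3] := cz.
have zvu : z (v, u) by rewrite z1.
have [w wu zvw] := cycle_next cz zuv; have [w' w'v zuw] := cycle_next cz zvu.
have [y yv zwy] := cycle_next cz zvw.
have ne a b : z (a, b) -> a != b by move/z2; apply: contraTneq => ->; rewrite ie.
have uv := ne _ _ zuv; have vw := ne _ _ zvw; have uw := ne _ _ zuw.
have wy := ne _ _ zwy.
have ww' : w != w'.
  apply/eqP => h; apply: (tri u v w); rewrite ?z2 //.
  by rewrite h.
have yu : y != u.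
  by apply/eqP => h; apply: (tri u v w); rewrite ?z2 // z1 -h.
pose s := [:: (u, v); (v, u); (v, w); (w, v); (u, w'); (w', u); (w, y); (y, w)].
rewrite -[8%N]/(size s) cardE; apply: uniq_leq_size.
  rewrite /s /= !inE !xpair_eqE !negb_or !negb_and.
  rewrite ?(eq_sym v u) ?(eq_sym w u) ?(eq_sym w v) ?(eq_sym w' u) ?(eq_sym w' v)
    ?(eq_sym w' w) ?(eq_sym y v) ?(eq_sym y w) ?(eq_sym y u).
  rewrite eq_sym in wu; rewrite eq_sym in w'v; rewrite eq_sym in yv.
  rewrite eq_sym in yu.
  by rewrite uv wu vw uw w'v ww' yv wy yu ?orbT.
move=> p; rewrite mem_enum !inE.
move=> /or4P[|||/or4P[|||/orP[]]] /eqP ->; rewrite ?zuv ?zvw ?zuw ?zwy //.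
- by rewrite z1.
- by rewrite z1.
- by rewrite z1.
Qed.

(** With p pairs and f faces, girth 4 gives 4f <= p, and twice Euler's bound p + 4 <= 2|W| + 2f
    becomes p + 8 <= 4|W|. Without faces, [3 <= #|W|] suffices. *)
Lemma planar_triangle_free e (W : {set V}) : graph e -> planar e -> (3 <= #|W|)%N ->
  (forall i j, e i j -> i \in W) ->
  (forall a b c, e a b -> e b c -> e a c -> False) ->
  (#|pairs e W| + 8 <= 4 * #|W|)%N.
Proof.
move=> ge pe W3 eW tri.
have [w0 w0W] : exists w0, w0 \in W by apply/card_gt0P; apply: leq_trans W3.
have [f [h1 h2 h3]] := planar_count (k := 4) ge pe w0W eW
  (fun z cz z0 => cycle_card8 ge tri cz z0).
by case: f h1 h2 h3 => [|f]; [move=> _ /(_ erefl)|move=> + _ /(_ isT)]; lia.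
Qed.

Lemma planar_forest e (W : {set V}) w0 : graph e -> planar e -> w0 \in W ->
  (forall i j, e i j -> i \in W) -> (forall z, cycle_on e z -> z = 0) ->
  (#|pairs e W| + 2 <= #|W|.*2)%N.
Proof.
move=> ge pe w0W eW forest.
(* There is no nonzero cycle, so any [k] is allowed; this one turns [k * f <= #|pairs e W|] into
   [f = 0]. *)
have [|f [h1 h2 h3]] := planar_count (k := #|pairs e W|.+1) ge pe w0W eW.
  by move=> z /forest ->; rewrite eqxx.
by case: f h1 h2 {h3} => [_ -> //|f]; rewrite mulnS; lia.
Qed.

Lemma card_pairs_clique e (A : {set V}) : graph e ->
  {in A &, forall i j, i != j -> e i j} ->
  #|pairs e A| = (#|A| * #|A| - #|A|)%N.
Proof.
move=> [se ie] clq.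
have -> : pairs e A = setX A A :\: [set (a, a) | a in A].
  apply/setP => -[i j]; rewrite !inE /= andbA andbC.
  case ijA : ((i \in A) && (j \in A)); last by rewrite !andbF.
  have [iA jA] := andP ijA; rewrite !andbT; apply/idP/idP => [eij|nij].
    by apply/imsetP => -[a _ [ia ja]]; rewrite ia ja ie in eij.
  by apply: clq => //; apply: contra nij => /eqP ->; apply: imset_f.
rewrite cardsD (setIidPr _); first by rewrite cardsX card_imset // => a b [].
by apply/subsetP => _ /imsetP[a aA ->]; rewrite inE /= aA.
Qed.

(** Girth 3 leaves at most six faces for 20 ordered pairs, whereas Euler's bound
    [20 + 4 <= 10 + f.*2] asks for seven. *)
Lemma planar_no_K5 e (A : {set V}) : planar e -> graph e -> #|A| = 5%N ->
  {in A &, forall i j, i != j -> e i j} -> False.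
Proof.
move=> pe ge A5 clq.
pose e' : rel V := fun i j => [&& i \in A, j \in A & i != j].
have ge' : graph e'.
  by split=> [i j|i]; rewrite /e' ?eqxx ?andbF // eq_sym andbCA.
have pe' : planar e'.
  by apply: planar_sub pe => // i j /and3P[iA jA ij]; apply: clq.
have [w0 w0A] : exists w0, w0 \in A by apply/card_gt0P; rewrite A5.
have e'A i j : e' i j -> i \in A by case/and3P.
have [f [h1 h2 h3]] := planar_count (k := 3) ge' pe' w0A e'A
  (fun z cz z0 => cycle_card6 ge' cz z0).
have cp : #|pairs e' A| = 20%N.
  by rewrite card_pairs_clique // ?A5 // => i j iA jA ij; rewrite /e' iA jA.
move: h1 h2 h3; rewrite cp A5.
by case: f => [|f]; [move=> _ /(_ erefl)|move=> + _ /(_ isT)]; lia.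
Qed.

(** Bipartite graphs have no triangle, and 18 ordered pairs exceed [4 * 6 - 8]. *)
Lemma planar_no_K33 e (A B : {set V}) : planar e -> graph e ->
  [disjoint A & B] -> #|A| = 3%N -> #|B| = 3%N ->
  {in A & B, forall i j, e i j} -> False.
Proof.
move=> pe ge AB A3 B3 adj; have [se ie] := ge.
pose e' : rel V := fun i j => (i \in A) && (j \in B) || (i \in B) && (j \in A).
have nAB i : i \in A -> i \in B -> False.
  by move=> iA iB; move/disjointFr: AB => /(_ i iA); rewrite iB.
have ge' : graph e'.
  split=> [i j|i]; rewrite /e'; first by rewrite orbC ![(j \in _) && _]andbC.
  by case iA : (i \in A); case iB : (i \in B) => //; case: (nAB i).
have pe' : planar e'.
  apply: planar_sub pe => // i j /orP[] /andP[iA jA]; first exact: adj.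
  by rewrite se adj.
have cAB : #|A :|: B| = 6%N.
  by rewrite cardsU A3 B3 (eqP (_ : #|A :&: B| == 0%N)) // cards_eq0 setI_eq0.
have tri a b c : e' a b -> e' b c -> e' a c -> False.
  rewrite /e' => /orP[] /andP[h1 h2] /orP[] /andP[h3 h4] /orP[] /andP[h5 h6];
  solve [apply: (nAB a) => //|apply: (nAB b) => //|apply: (nAB c) => //].
have e'W i j : e' i j -> i \in A :|: B.
  by rewrite inE => /orP[] /andP[->]; rewrite ?orbT.
have := planar_triangle_free ge' pe' _ e'W tri; rewrite cAB => /(_ isT).
have -> : #|pairs e' (A :|: B)| = 18%N; last by [].
have <- : #|setX A B :|: setX B A| = 18%N.
  rewrite cardsU !cardsX A3 B3 (eqP (_ : #|_ :&: _| == 0%N)) // cards_eq0.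
  apply/eqP/setP => -[i j]; rewrite !inE /=; apply/negP.
  by case/andP => /andP[h1 h2] /andP[h3 h4]; case: (nAB i).
apply: eq_card => -[i j]; rewrite !inE /= /e'.
by case: (i \in A); case: (i \in B); case: (j \in A); case: (j \in B).
Qed.

(** * K5 and K33 minors from three common neighbours *)

Definition avoid (s : {set V}) e : rel V :=
  fun i j => [&& i \notin s, j \notin s & e i j].

Lemma connect_map (T : finType) (r r' : rel T) (phi : T -> T) a b :
  (forall i j, r i j -> phi i = phi j \/ r' (phi i) (phi j)) ->
  connect r a b -> connect r' (phi a) (phi b).
Proof.
move=> h /connectP[p]; elim: p a => [|c p IH] a /=; first by move=> _ ->.
case/andP => /h[->|ac] pc bE; first exact: IH.
exact: connect_trans (connect1 ac) (IH _ pc bE).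
Qed.

Lemma connect_first (T : finType) (r : rel T) a b :
  connect r a b -> a != b -> exists2 c, r a c & connect r c b.
Proof.
case/connectP => -[|c p] /=; first by move=> _ ->; rewrite eqxx.
by case/andP => ac pc bE _; exists c => //; apply/connectP; exists p.
Qed.

Lemma ord3_other (i j : 'I_3) : i != j -> exists k, i != k /\ j != k.
Proof.
case: i j => [[|[|[|//]]] ?] [[|[|[|//]]] ?] //= _;
by [exists 0 | exists 1 | exists 2%:R].
Qed.

Lemma ord3_eq (i j k l : 'I_3) :
  i != j -> k != i -> k != j -> l != i -> l != j -> k = l.
Proof.
case: i j k l => [[|[|[|//]]] ?] [[|[|[|//]]] ?] [[|[|[|//]]] ?] [[|[|[|//]]] ?];
by move=> //= *; apply: val_inj.
Qed.

(* Contract towards the five vertices, into K5 or K33. *)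
Lemma planar_three_common e x y (c : 'I_3 -> V) : graph e -> planar e ->
  injective c -> e x y -> (forall i, e x (c i)) -> (forall i, e y (c i)) ->
  (forall k i j, i != k -> j != k ->
     connect (avoid [set x; y; c k] e) (c i) (c j)) -> False.
Proof.
have [m] := ubnP #|pairs e setT|; elim: m e => // m IH e; rewrite ltnS => em.
move=> ge pe cinj xy xc yc conn; have [se ie] := ge.
have ne a b : e a b -> a != b by apply: contraTneq => ->; rewrite ie.
have step v w : v \notin [set x; y] -> w \notin [set x; y] ->
    w \notin codom c -> e v w ->
    (forall k i j, i != k -> j != k ->
      connect (avoid [set x; y; c k] (contract v w e)) (c i) (c j)) -> False.
  rewrite !inE !negb_or => /andP[vx vy] /andP[wx wy] wc vw conn'.
  have cw i : c i != w by apply: contraNneq wc => <-; exact: codom_f.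
  apply: (IH (contract v w e)) => //.
  - exact: leq_trans (card_contract ge vw) em.
  - exact: graph_contract.
  - exact: planar_contract.
  - by rewrite /contract ![_ == w]eq_sym wx wy ne // xy.
  - by move=> i; rewrite /contract [x == w]eq_sym wx cw ne // xc.
  - by move=> i; rewrite /contract [y == w]eq_sym wy cw ne // yc.
(* Walks avoiding [x], [y], [c k] are rerouted from [w] to [t]. Usually [t] is the contraction
   target [u], but [u] may be the avoided [c k] itself. *)
have homo t u w k i j : w \notin codom c -> t != w ->
    (forall b, avoid [set x; y; c k] e w b ->
       t = b \/ avoid [set x; y; c k] (contract u w e) t b) ->
    i != k -> j != k ->
    connect (avoid [set x; y; c k] (contract u w e)) (c i) (c j).
  move=> wc tw h ik jk.
  have cw l : (c l == w) = false.
    by apply: contraNF wc => /eqP <-; exact: codom_f.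
  suff h' a b : avoid [set x; y; c k] e a b ->
      (if a == w then t else a) = (if b == w then t else b) \/
      avoid [set x; y; c k] (contract u w e)
        (if a == w then t else a) (if b == w then t else b).
    by have := connect_map h' (conn k i j ik jk); rewrite !cw.
  move=> ab.
  have [sct _] := graph_contract u w ge.
  have savoid e1 : symmetric e1 -> symmetric (avoid [set x; y; c k] e1).
    by move=> se1 p q; rewrite /avoid se1 andbCA.
  case: (eqVneq a w) ab => [->|aw] ab.
    case: (eqVneq b w) ab => [->|bw] ab; first by left.
    exact: h.
  case: (eqVneq b w) ab => [->|bw] ab.
    rewrite savoid // in ab; rewrite savoid //.
    by case: (h _ ab) => [->|]; [left|right].
  right; move: ab; rewrite /avoid /contract => /and3P[-> -> ab].
  by rewrite aw bw ne // ab.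
pose five := [set x; y] :|: [set c i | i : 'I_3].
have cfive v : v \notin five -> [/\ v != x, v != y & v \notin codom c].
  rewrite !inE !negb_or => /andP[/andP[-> ->] h]; split=> //.
  by apply: contra h => /codomP[i ->]; apply: imset_f.
case: (pickP [pred p : V * V | [&& p.1 \notin five, p.2 \notin five & e p.1 p.2]]).
  case=> v w /= /and3P[/cfive[vx vy vc] /cfive[wx wy wc] vw].
  apply: (step v w); rewrite ?inE ?negb_or ?vx ?vy ?wx ?wy //.
  move=> k i j ik jk; apply: (homo v v w k i j wc _ _ ik jk); first exact: ne.
  move=> b /and3P[wk bk wb]; case: (eqVneq v b) => [->|vb]; first by left.
  have vk : v \notin [set x; y; c k].
    rewrite !inE !negb_or vx vy /=; apply: contraNneq vc => ->; exact: codom_f.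
  by right; rewrite /avoid vk bk /contract ne //= eq_sym ne // vb eqxx wb !orbT.
move=> noout.
case: (pickP [pred p : V * 'I_3 | (p.1 \notin five) && e p.1 (c p.2)]).
  case=> w l /= /andP[wfive wl]; have [wx wy wc] := cfive _ wfive.
  have lx : c l \notin [set x; y].
    by rewrite !inE negb_or ![c l == _]eq_sym !ne.
  have wn b k : avoid [set x; y; c k] e w b -> exists2 i, i != k & b = c i.
    case/and3P => _; rewrite !inE !negb_or => /andP[/andP[bx by'] bk] wb.
    have := noout (w, b); rewrite /= wfive wb andbT /= => /negbFE.
    rewrite !inE (negbTE bx) (negbTE by') /= => /imsetP[i _ bi].
    by exists i => //; apply: contraNneq bk => <-; rewrite bi.
  (* Otherwise [x], [y], [w] and the three [c i] would form a K33. *)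
  have [i0 wi0] : exists i0, ~~ e w (c i0).
    apply: contrapT => h.
    apply: (@planar_no_K33 e [set x; y; w] [set c i | i : 'I_3]) => //.
    - rewrite disjoint_sym disjoints_subset; apply/subsetP => _ /imsetP[i _ ->].
      rewrite !inE !negb_or ![c i == _]eq_sym !ne //.
      by apply/negPn/negP => nwi; apply: h; exists i.
    - by rewrite setUC cardsU1 cards2 !inE negb_or wx wy (ne _ _ xy).
    - by rewrite card_imset // card_ord.
    move=> a _ + /imsetP[i _ ->]; rewrite !inE => /orP[/orP[]|] /eqP -> //.
    by apply/negPn/negP => nwi; apply: h; exists i.
  have i0l : i0 != l by apply: contraNneq wi0 => ->.
  have [m' mE] : exists m, forall i, i != l -> i != i0 -> i = m.
    have [k [ki0 kl]] := ord3_other i0l; exists k => i il ii0.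
    by apply: (ord3_eq i0l); rewrite // eq_sym.
  have wcl k : w != c k by apply: contraNneq wc => ->; exact: codom_f.
  apply: (step (c l) w) => //; rewrite ?inE ?negb_or ?wx ?wy // 1?se //.
  (* When [c l] itself is avoided, the only neighbour through which a walk can enter or leave [w] is
     [c m'], so [w] is sent there. *)
  move=> k i j ik jk; case: (eqVneq k l) => [kl|kl].
    apply: (homo (c m') _ _ _ _ _ wc _ _ ik jk); first by rewrite eq_sym.
    move=> b wb; have [i1 i1k bE] := wn _ _ wb; left; rewrite bE.
    congr c; apply/esym/mE; first by rewrite -kl.
    by apply: contraNneq wi0 => <-; rewrite -bE; case/and3P: wb.
  apply: (homo (c l) _ _ _ _ _ wc _ _ ik jk); first by rewrite eq_sym.
  move=> b wb; have [i1 i1k bE] := wn _ _ wb; case/and3P: wb => wk bk wb.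
  case: (eqVneq (c l) b) => [->|lb]; first by left.
  have bw : b != w by rewrite eq_sym ne.
  right; rewrite /avoid bk /contract [c l == w]eq_sym wcl bw lb eqxx wb !orbT.
  rewrite !andbT.
  by rewrite !inE in lx *; rewrite negb_or lx inj_eq // eq_sym.
(* No edge leaves the [c i] towards the outside any more, so a walk from [c i] to [c j] avoiding
   [x], [y] and [c k] must begin with the edge to [c j]: the five vertices form a K5. *)
move=> noc.
have cc i j : i != j -> e (c i) (c j).
  move=> ij; have [k [ik jk]] := ord3_other ij.
  have [|d /and3P[_ dk cd] dj] := connect_first (conn k i j ik jk).
    by rewrite inj_eq.
  case dF : (d \in five); last by have := noc (d, i); rewrite /= dF se cd.
  move: dF dk; rewrite /five !inE !negb_or.
  move=> dF /andP[/andP[/negbTE dx /negbTE dy]]; move: dF; rewrite dx dy /=.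
  move=> /imsetP[l _ dl]; rewrite dl in cd *; rewrite inj_eq // => lk.
  have li : l != i by have := ne _ _ cd; rewrite inj_eq // eq_sym.
  suff -> : j = l by [].
  by apply: (ord3_eq ik); rewrite // eq_sym.
apply: (@planar_no_K5 e five) => //.
- rewrite cardsU card_imset // card_ord cards2 ne //=.
  rewrite (eqP (_ : #|_ :&: _| == 0%N)) // cards_eq0 setI_eq0 disjoint_sym.
  rewrite disjoints_subset; apply/subsetP => _ /imsetP[i _ ->].
  by rewrite !inE !negb_or ![c i == _]eq_sym !ne.
- move=> a b; rewrite !inE => /orP[/orP[]/eqP ->|/imsetP[i _ ->]];
  move=> /orP[/orP[]/eqP ->|/imsetP[j _ ->]]; rewrite ?eqxx //.
  + by rewrite se.
  + by rewrite se.
  + by rewrite se.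
  + by rewrite inj_eq // => /cc.
Qed.

(** A face through [x r] leaves [r] along some [r y], and the chord [x y] splits it into the
    triangle [x r y] and the rest. The cycle [z] is there because an edge on no cycle lies on no
    face. *)
Lemma planar_chord e z x r : graph e -> planar e -> cycle_on e z -> z (x, r) ->
  exists y, [/\ y != x, e r y & (~~ e x y -> planar (add_edge x y e))].
Proof.
move=> [se ie] [I [f [f1 f2 f3]]] cz zxr.
have [i0 fi0] : exists i0, f i0 (x, r).
  apply: contrapT => h; have [J zJ] := f3 z cz.
  move: zxr; rewrite zJ sum_ffun_bool big1 // => i _.
  by case fi : (f i (x, r)) => //; case: h; exists i.
have [y yx fry] := cycle_next (f1 i0) fi0.
have [_ fe _] := f1 i0.
have xr := fe _ _ fi0; have ry := fe _ _ fry.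
exists y; split=> // nxy.
have ne a b : e a b -> a != b by apply: contraTneq => ->; rewrite ie.
have xr' := ne _ _ xr; have ry' := ne _ _ ry.
pose e1 := add_edge x y e.
have ee1 a b : e a b -> e1 a b by rewrite /e1 /add_edge => ->.
have xye1 : e1 x y by rewrite /e1 /add_edge !eqxx orbT.
pose in3 a := [|| a == x, a == r | a == y].
pose t : {ffun V * V -> bool} := [ffun p => [&& in3 p.1, in3 p.2 & p.1 != p.2]].
have se1 : symmetric e1.
  by move=> a b; rewrite /e1 /add_edge se [X in _ || X]orbC ![(a == _) && _]andbC.
have te1 a b : t (a, b) -> e1 a b.
  rewrite ffunE /= => /and3P[/or3P[] /eqP -> /or3P[] /eqP ->]; rewrite ?eqxx //.
  - by move=> _; exact: ee1.
  - by rewrite se1 => _; exact: ee1.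
  - by move=> _; exact: ee1.
  - by rewrite se1.
  - by rewrite se1 => _; exact: ee1.
have ct : cycle_on e1 t.
  split=> [a b|a b|a].
  - by rewrite !ffunE /= andbCA eq_sym.
  - exact: te1.
  - case ia : (in3 a); last by rewrite big1 // => b _; rewrite ffunE /= ia.
    have rx : r != x by rewrite eq_sym.
    have yr : y != r by rewrite eq_sym.
    rewrite (bigD1 x) // (bigD1 r) //= (bigD1 y) /= ?yx //.
    rewrite big1 ?addr0; last first.
      move=> b /andP[/andP[bx br] byy]; rewrite ffunE /= /in3 (negbTE bx).
      by rewrite (negbTE br) (negbTE byy) andbF.
    rewrite !ffunE /= ia /in3 !eqxx !orbT /=.
    case/or3P: ia => /eqP ->; rewrite ?eqxx ?(eq_sym r x) ?(eq_sym x y) ?(eq_sym y r).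
    + by rewrite xr' yx.
    + by rewrite xr' ry'.
    + by rewrite yx ry'.
have cyc1 z1 : cycle_on e z1 -> cycle_on e1 z1.
  by case=> ? z2 ?; split=> // a b /z2; exact: ee1.
have cyc2 z1 : cycle_on e1 z1 -> z1 (x, y) = false -> cycle_on e z1.
  case=> z1s z1e z1d z1xy; split=> // a b zab; have := z1e _ _ zab.
  rewrite /e1 /add_edge => /orP[//|/orP[] /andP[/eqP ax /eqP yb]].
    by rewrite ax yb z1xy in zab.
  by rewrite ax yb z1s z1xy in zab.
have fxy i : f i (x, y) = false.
  by have [_ h _] := f1 i; apply/negP => /h; apply/negP.
have xy' : x != y by rewrite eq_sym.
have txy : t (x, y) by rewrite ffunE /= /in3 !eqxx !orbT xy'.
pose g (i : option I) : {ffun V * V -> bool} :=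
  if i is Some j then if j == i0 then f i0 + t else f j else t.
have tsym a b : t (a, b) = t (b, a) by rewrite !ffunE /= andbCA eq_sym.
exists (option I), g; split.
- by case=> [j|] //=; case: eqP => _; [apply: cycle_add => //|]; exact: cyc1.
- move=> p; have sinj : injective (@Some I) by move=> i j [].
  have gE : #|[set i | g i p]| =
      (t p + (f i0 p (+) t p) + #|[set j | f j p] :\ i0|)%N.
    rewrite (cardsD1 None) (cardsD1 (Some i0)) !inE /= eqxx addffE addnA.
    congr (_ + _)%N.
    rewrite -(card_imset _ sinj); apply: eq_card => -[j|]; last first.
      by rewrite !inE; apply/esym/negP => /imsetP[].
    rewrite !inE /= (inj_eq sinj); apply/idP/imsetP.
      case/andP => ji fj; exists j => //.
      by rewrite !inE ji; rewrite (negbTE ji) in fj.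
    case=> j'; rewrite !inE => /andP[ji fj] [->].
    by rewrite ji (negbTE ji).
  have fE : #|[set j | f j p]| = (f i0 p + #|[set j | f j p] :\ i0|)%N.
    by rewrite (cardsD1 i0) inE.
  have := f2 p; rewrite gE fE !inE.
  case tp : (t p); last by rewrite addbF.
  case fp : (f i0 p) => //= .
  rewrite !add0n add1n => /orP[/eqP -> //|/eqP n2].
  suff -> : #|[set j | f j p] :\ i0| = 0%N by [].
  move: tp fp; case: p {gE fE n2} => a b; have [fs _ _] := f1 i0.
  (* A pair of the triangle that is not on the face [f i0] is the new edge, which no old face
     contains. *)
  have nfxy c d : (c, d) = (x, y) \/ (c, d) = (y, x) ->
      #|[set j | f j (c, d)] :\ i0| = 0%N.
    move=> cd; apply/eqP; rewrite cards_eq0; apply/eqP/setP => j; rewrite !inE.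
    have [fs' _ _] := f1 j.
    by case: cd => ->; rewrite ?fxy ?[f j (y, x)]fs' ?fxy andbF.
  rewrite ffunE /= => /and3P[/or3P[] /eqP -> /or3P[] /eqP ->]; rewrite ?eqxx //;
    rewrite ?fi0 ?fry ?[f i0 (r, x)]fs ?[f i0 (y, r)]fs ?fi0 ?fry //.
  + by move=> _ _; apply: nfxy; left.
  + by move=> _ _; apply: nfxy; right.
- move=> z1 cz1.
  pose z2 := if z1 (x, y) then z1 + t else z1.
  have [J z2J] : exists J : {set I}, z2 = \sum_(i in J) f i.
    apply: f3; rewrite /z2; case z1xy : (z1 (x, y)); last exact: cyc2.
    by apply: cyc2; [exact: cycle_add|rewrite addffE z1xy txy].
  have ffbb (h : {ffun V * V -> bool}) : h + h = 0.
    by apply/ffunP => p; rewrite !ffunE; exact: addbb0.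
  pose b := (i0 \in J) (+) z1 (x, y).
  exists ((if b then [set None] else set0) :|: [set Some i | i in J]).
  have z1E : z1 = \sum_(i in J) f i + (if z1 (x, y) then t else 0).
    by rewrite -z2J /z2; case: ifP; rewrite ?addr0 // -addrA ffbb addr0.
  have fJ : \sum_(i in J) f i =
      \sum_(i in J) g (Some i) + (if i0 \in J then t else 0).
    case: ifP => iJ; last first.
      rewrite addr0; apply: eq_bigr => j jJ /=; case: eqP => // ji.
      by rewrite -ji jJ in iJ.
    rewrite (bigD1 i0) //= [in RHS](bigD1 i0) //= eqxx addrAC -!addrA.
    congr (_ + _); rewrite addrA ffbb add0r.
    by apply: eq_bigr => j /andP[_ /negbTE ->].
  have gJ : \sum_(i in [set Some i | i in J]) g i = \sum_(i in J) g (Some i).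
    by rewrite big_imset // => i j _ _ [].
  rewrite z1E fJ -addrA -gJ /b.
  have nJ : None \notin [set Some i | i in J] by apply/imsetP => -[].
  case: (i0 \in J); case: (z1 (x, y)) => /=; rewrite ?ffbb ?set0U //.
  - by rewrite addr0.
  - by rewrite big_setU1 //= addr0 addrC.
  - by rewrite big_setU1 //= add0r addrC.
  - by rewrite !addr0.
Qed.

End Planar.

(** * Stresses of coloured positions *)

(** With [G] a right inverse of the matrix of [f], composing [f + t g] with [G] gives [1 + t g G].
    Its determinant is a polynomial in [t] with value 1 at 0, and wherever it is nonzero [f + t g]
    is injective. *)
Lemma linear_injective_perturb (F : fieldType) (m1 n1 m2 n2 : nat)
    (f g : 'M[F]_(m1, n1) -> 'M[F]_(m2, n2)) :
  linear f -> linear g -> (forall x, f x = 0 -> x = 0) ->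
  exists2 q : {poly F}, q != 0 &
    forall t, q.[t] != 0 -> forall x, f x + t *: g x = 0 -> x = 0.
Proof.
move=> lf lg finj.
pose f' : {linear 'M[F]_(m1, n1) -> 'M[F]_(m2, n2)} :=
  HB.pack f (GRing.isLinear.Build _ _ _ _ f lf).
pose g' : {linear 'M[F]_(m1, n1) -> 'M[F]_(m2, n2)} :=
  HB.pack g (GRing.isLinear.Build _ _ _ _ g lg).
have fE x : mxvec x *m lin_mx f' = mxvec (f x).
  exact: (mul_vec_lin f').
have gE x : mxvec x *m lin_mx g' = mxvec (g x).
  exact: (mul_vec_lin g').
have Af : row_free (lin_mx f').
  apply/row_freeP; exists (pinvmx (lin_mx f')).
  apply: mulmxVp; rewrite -kermx_eq0 -submx0; apply/rV_subP => v.
  move/sub_kermxP; rewrite -[v]vec_mxK fE => /eqP; rewrite mxvec_eq0 => /eqP.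
  by move/finj => ->; rewrite linear0 sub0mx.
have [G AG] := row_freeP Af.
pose q := \det (map_mx polyC (1%:M : 'M[F]_(m1 * n1))
                + 'X *: map_mx polyC (lin_mx g' *m G)).
have qE t : q.[t] = \det (1%:M + t *: (lin_mx g' *m G)).
  rewrite -horner_evalE -det_map_mx; congr (\det _); apply/matrixP => i j.
  by rewrite !mxE /= /horner_eval hornerD hornerM hornerX !hornerC.
exists q.
  apply/eqP => q0; have := qE 0.
  rewrite q0 horner0 scale0r addr0 det1 => /esym/eqP.
  by rewrite oner_eq0.
move=> t; rewrite qE => dt x fgx.
have: mxvec x *m (1%:M + t *: (lin_mx g' *m G)) = 0.
  rewrite -AG scalemxAl -mulmxDl mulmxA mulmxDr fE -scalemxAr gE.
  by rewrite -linearZ -linearD /= fgx linear0 mul0mx.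
move/(congr1 (mulmx^~ (invmx (1%:M + t *: (lin_mx g' *m G))))).
rewrite mulmxK ?unitmxE ?unitfE // mul0mx => /eqP.
by rewrite mxvec_eq0 => /eqP.
Qed.

Lemma poly_nonroot (F : fieldType) (q : {poly F}) :
  (forall k, exists s : 'I_k -> F, injective s) -> q != 0 ->
  exists t, q.[t] != 0.
Proof.
move=> infF q0; have [s sinj] := infF (size q).
case: (pickP (fun i => q.[s i] != 0)) => [i si|all0]; first by exists (s i).
have := max_poly_roots q0 (rs := codom s).
rewrite size_codom card_ord ltnn => H; suff: false by []; apply: H.
  by apply/allP => x /codomP[i ->]; rewrite /root; have /negbFE := all0 i.
by rewrite map_inj_uniq ?enum_uniq.
Qed.

Section Generic.
Variables (F : fieldType) (n : nat).
Implicit Types (e : rel 'I_n) (P : 'M[F]_(n, 4)) (bl : pred 'I_n).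

(* L is a linear functional on the degree-2 part of the Stanley-Reisner ring, by
   x_i x_j |-> L i j; L *m P = 0 says that it kills the ideal generated by the
   four linear forms whose coefficients are the columns of P. *)
Definition stress e P (L : 'M[F]_n) :=
  [/\ L^T = L, forall i j, i != j -> ~~ e i j -> L i j = 0 & L *m P = 0].

Definition independent e P := forall L, stress e P L -> L = 0.

(* Coordinates 0 and 1 are those of the two blue forms, coordinate 2 is that of
   the red form. *)
Definition colored_pos bl P :=
  forall i (k : 'I_4), (if bl i then k == 2 :> nat else k < 2)%N -> P i k = 0.

(** Blue rows use the coordinates 0, 1, 3 and red rows 2, 3; so three blue, two red and four in all
    are the most that can be independent. *)
Definition general_pos bl P := forall S : {set 'I_n},
  (#|S| <= 4)%N -> (#|[set i in S | bl i]| <= 3)%N ->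
  (#|[set i in S | ~~ bl i]| <= 2)%N ->
  forall x : 'rV[F]_n, (forall i, i \notin S -> x 0 i = 0) -> x *m P = 0 ->
  x = 0.

(** A substitute for Zariski openness: on each line through a point satisfying [Phi], the condition
    fails for finitely many parameters at most. *)
Definition open_cond (Phi : 'M[F]_(n, 4) -> Prop) := forall P0 P1, Phi P0 ->
  exists2 q : {poly F}, q != 0 & forall t, q.[t] != 0 -> Phi (P0 + t *: P1).

(** The map [f] collects the three defects of [L] from being a stress at [P0]. Only the equilibrium
    block depends on the position, and it is affine in [t]. *)
Lemma open_independent e : open_cond (independent e).
Proof.
move=> P0 P1 ind.
pose f (L : 'M[F]_n) : 'M[F]_(n, 4 + (n + n)) :=
  row_mx (L *m P0) (row_mx (L - L^T)
    (\matrix_(i, j) if (i != j) && ~~ e i j then L i j else 0)).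
pose g (L : 'M[F]_n) : 'M[F]_(n, 4 + (n + n)) := row_mx (L *m P1) 0.
have lf : linear f.
  move=> a x y; rewrite /f scale_row_mx add_row_mx; congr row_mx.
    by rewrite mulmxDl scalemxAl.
  rewrite scale_row_mx add_row_mx; congr row_mx.
    rewrite linearD linearZ /=.
    by rewrite scalerBr opprD addrACA.
  by apply/matrixP => i j; rewrite !mxE; case: ifP; rewrite ?mulr0 ?addr0.
have lg : linear g.
  move=> a x y; rewrite /g scale_row_mx add_row_mx scaler0 addr0.
  by rewrite mulmxDl scalemxAl.
have fP L t : f L + t *: g L = 0 <-> stress e (P0 + t *: P1) L.
  rewrite /f /g scale_row_mx add_row_mx scaler0 addr0; split.
    move/eqP; rewrite row_mx_eq0 => /andP[/eqP h1]; rewrite row_mx_eq0.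
    move=> /andP[/eqP/subr0_eq h2 /eqP h3]; split=> //; last first.
      by rewrite mulmxDr -scalemxAr.
    move=> i j ij nij; move/matrixP/(_ i j): h3; rewrite !mxE.
    by rewrite ij nij.
  case=> h2 h3 h1.
  rewrite [in L - L^T]h2 subrr scalemxAr -mulmxDr h1.
  suff -> : (\matrix_(i, j) (if (i != j) && ~~ e i j then L i j else 0)) = 0.
    by rewrite !row_mx0.
  apply/matrixP => i j; rewrite !mxE; case: ifP => // /andP[ij nij].
  exact: h3.
have [|q q0 hq] := linear_injective_perturb lf lg.
  move=> L fL0; apply: ind; have [+ _] := fP L 0.
  by rewrite !scale0r !addr0; apply.
by exists q => // t qt L /fP; apply: hq.
Qed.

Lemma open_general_pos bl : open_cond (general_pos bl).
Proof.
move=> P0 P1 gen.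
pose ok (S : {set 'I_n}) := [&& #|S| <= 4, #|[set i in S | bl i]| <= 3 &
   #|[set i in S | ~~ bl i]| <= 2]%N.
pose cond (S : {set 'I_n}) P := forall x : 'rV[F]_n,
  (forall i, i \notin S -> x 0 i = 0) -> x *m P = 0 -> x = 0.
have H S : exists q : {poly F},
    q != 0 /\ (forall t, q.[t] != 0 -> ok S -> cond S (P0 + t *: P1)).
  case okS : (ok S); last first.
    by exists 1; split; [exact: oner_neq0|].
  pose mask (x : 'rV[F]_n) : 'rV[F]_n :=
    \row_i if i \in S then 0 else x 0 i.
  pose f (x : 'rV[F]_n) : 'rV[F]_(4 + n) := row_mx (x *m P0) (mask x).
  pose g (x : 'rV[F]_n) : 'rV[F]_(4 + n) := row_mx (x *m P1) 0.
  have lf : linear f.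
    move=> a x y; rewrite /f scale_row_mx add_row_mx; congr row_mx.
      by rewrite mulmxDl scalemxAl.
    by apply/matrixP => i j; rewrite !mxE; case: ifP; rewrite ?mulr0 ?addr0.
  have lg : linear g.
    move=> a x y; rewrite /g scale_row_mx add_row_mx scaler0 addr0.
    by rewrite mulmxDl scalemxAl.
  have [|q q0 hq] := linear_injective_perturb lf lg.
    move=> x /eqP; rewrite row_mx_eq0 => /andP[/eqP h1 /eqP/matrixP h2].
    case/and3P: okS => o1 o2 o3; apply: (gen S) => // i iS.
    by have := h2 0 i; rewrite !mxE (negbTE iS).
  exists q; split=> // t qt _ x xS xP; apply: (hq t qt).
  rewrite /f /g scale_row_mx add_row_mx scaler0 addr0 scalemxAr -mulmxDr xP.
  suff -> : mask x = 0 by rewrite row_mx0.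
  by apply/matrixP => i j; rewrite !mxE; case: ifPn => // /xS.
have [q hq] := fin_all_exists H.
exists (\prod_S q S); first by apply/prodf_neq0 => S _; have [] := hq S.
move=> t qt S o1 o2 o3; have [_] := hq S; apply; last exact/and3P.
by move: qt; rewrite horner_prod => /prodf_neq0; apply.
Qed.

Lemma open_and Phi Psi :
  open_cond Phi -> open_cond Psi -> open_cond (fun P => Phi P /\ Psi P).
Proof.
move=> o1 o2 P0 P1 [h1 h2]; have [q q0 hq] := o1 P0 P1 h1.
have [r r0 hr] := o2 P0 P1 h2; exists (q * r); first by rewrite mulf_neq0.
by move=> t; rewrite hornerM mulf_eq0 negb_or => /andP[/hq ? /hr ?].
Qed.

Hypothesis infF : forall k, exists s : 'I_k -> F, injective s.

(** On the line from [P] to [Q], which stays coloured, [Phi] holds at t = 0 and [Psi] at t = 1; each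
    then fails for finitely many [t]. Composition with ['X - 1] accounts for the second base
    point. *)
Lemma colored_pos_meet bl Phi Psi : open_cond Phi -> open_cond Psi ->
  (exists2 P, colored_pos bl P & Phi P) ->
  (exists2 P, colored_pos bl P & Psi P) ->
  exists2 P, colored_pos bl P & Phi P /\ Psi P.
Proof.
move=> o1 o2 [P c1 h1] [Q c2 h2].
have [q q0 hq] := o1 P (Q - P) h1; have [r r0 hr] := o2 Q (Q - P) h2.
have [] := @poly_nonroot F (q * (r \Po ('X - 1%:P))) infF.
  by rewrite mulf_neq0 // -size_poly_eq0 size_comp_poly2 ?size_poly_eq0 //
             size_XsubC.
move=> t; rewrite hornerM horner_comp !hornerE mulf_eq0 negb_or => /andP[qt rt].
exists (P + t *: (Q - P)).
  by move=> i k ik; rewrite !mxE (c1 i k ik) (c2 i k ik) oppr0 !addr0 mulr0 addr0.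
split; first exact: hq.
have := hr _ rt; congr Psi; apply/matrixP => i j; rewrite !mxE.
by ring.
Qed.

(** Pairing the relations with the polynomial that vanishes at all nodes but [s i] isolates
    [x i]. *)
Lemma vandermonde_free (S : {set 'I_n}) (s x : 'I_n -> F) k :
  injective s -> (#|S| <= k)%N ->
  (forall j, (j < k)%N -> \sum_(i in S) x i * s i ^+ j = 0) ->
  forall i, i \in S -> x i = 0.
Proof.
move=> sinj Sk h i iS.
pose p := \prod_(j in S :\ i) ('X - (s j)%:P).
have sp : (size p <= k)%N.
  rewrite /p -big_enum size_prod_XsubC -cardE.
  by apply: leq_trans Sk; rewrite (cardsD1 i S) iS.
have : \sum_(j in S) x j * p.[s j] = 0.
  under eq_bigr => j _ do rewrite (horner_coef_wide _ sp) big_distrr /=.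
  rewrite exchange_big big1 // => l _.
  under eq_bigr => j _ do rewrite mulrCA.
  by rewrite -big_distrr /= h ?mulr0.
rewrite (bigD1 i) //= big1 ?addr0 => [/eqP|j /andP[jS ji]]; last first.
  suff -> : p.[s j] = 0 by rewrite mulr0.
  rewrite /p horner_prod; apply/eqP/prodf_eq0; exists j.
    by rewrite in_setD1 ji.
  by rewrite !hornerE subrr.
rewrite mulf_eq0 => /orP[/eqP //|]; rewrite horner_prod prodf_seq_eq0.
case/hasP => j _ /andP[]; rewrite in_setD1 !hornerE subr_eq0 => /andP[ji _].
by move/eqP/sinj => ij; rewrite ij eqxx in ji.
Qed.

Lemma general_pos_exists bl : exists2 P, colored_pos bl P & general_pos bl P.
Proof.
(* Nonzero nodes allow a factor [s i] to be taken out of the blue columns 0 and 1 when no other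
   column is available for the blue rows. *)
have [s [sinj sn0]] : exists s : 'I_n -> F, injective s /\ forall i, s i != 0.
  have [s sinj] := infF n.+1.
  case: (pickP (fun i => s i == 0)) => [i /eqP si|h].
    exists (s \o lift i); split; first by apply: inj_comp => //; exact: lift_inj.
    move=> j /=; apply/eqP; rewrite -si => /sinj/eqP.
    by rewrite eq_sym (negbTE (neq_lift _ _)).
  exists (s \o lift ord0); split.
    by apply: inj_comp => //; exact: lift_inj.
  by move=> j /=; rewrite h.
pose P : 'M[F]_(n, 4) := \matrix_(i, k)
  if bl i then [:: s i; s i ^+ 2; 0; 1]`_k else [:: 0; 0; 1; s i]`_k.
exists P.
  move=> i k; rewrite !mxE.
  by case: (bl i); case: k => -[|[|[|[|k]]]].
move=> S S4 Sb Sr x xS xP.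
have sumE (f g : 'I_n -> F) (k : 'I_4) :
    (forall i, P i k = if bl i then f i else g i) ->
    \sum_(i in [set i in S | bl i]) x 0 i * f i
    + \sum_(i in [set i in S | ~~ bl i]) x 0 i * g i = 0.
  move=> h; transitivity (\sum_i x 0 i * P i k); last first.
    by move/matrixP/(_ 0 k): xP; rewrite !mxE.
  rewrite [RHS](bigID bl) /=; congr (_ + _).
    rewrite [RHS](bigID (fun i => i \in S)) /= [X in _ + X]big1 ?addr0.
      by apply: eq_big => [i|i]; rewrite inE 1?andbC // h => /andP[-> _].
    by move=> i /andP[_ /xS ->]; rewrite mul0r.
  rewrite [RHS](bigID (fun i => i \in S)) /= [X in _ + X]big1 ?addr0.
    by apply: eq_big => [i|i]; rewrite inE 1?andbC // h => /andP[/negbTE -> _].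
  by move=> i /andP[_ /xS ->]; rewrite mul0r.
have z0 (A : {set 'I_n}) (y : 'I_n -> F) : \sum_(i in A) y i * 0 = 0.
  by rewrite big1 // => i _; rewrite mulr0.
have PE k i : P i k =
    if bl i then [:: s i; s i ^+ 2; 0; 1]`_k else [:: 0; 0; 1; s i]`_k.
  by rewrite !mxE.
have e0 : \sum_(i in [set i in S | bl i]) x 0 i * s i = 0.
  by have := sumE _ _ _ (PE 0%R); rewrite /= z0 addr0.
have e1 : \sum_(i in [set i in S | bl i]) x 0 i * s i ^+ 2 = 0.
  by have := sumE _ _ _ (PE 1%R); rewrite /= z0 addr0.
have e2 : \sum_(i in [set i in S | ~~ bl i]) x 0 i * 1 = 0.
  by have := sumE _ _ _ (PE 2%:R); rewrite /= z0 add0r.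
have e3 := sumE _ _ _ (PE 3%:R); rewrite /= in e3.
suff [hb hr] : (forall i, i \in [set i in S | bl i] -> x 0 i = 0) /\
          (forall i, i \in [set i in S | ~~ bl i] -> x 0 i = 0).
  apply/matrixP => i j; rewrite !mxE ord1.
  case jS : (j \in S); last by apply: xS; rewrite jS.
  by case bj : (bl j); [apply: hb|apply: hr]; rewrite inE jS bj.
(* At most one red row: column 2 kills it, and column 3 then serves the blue rows as a third
   Vandermonde column. Two red rows: at most two blue ones remain, columns 0 and 1 settle them, and
   column 3 is left for the red rows. *)
have [r1|r2] := leqP #|[set i in S | ~~ bl i]| 1.
  have hr : forall i, i \in [set i in S | ~~ bl i] -> x 0 i = 0.
    apply: (vandermonde_free (k := 1) sinj r1) => -[|//] _.
    by under eq_bigr do rewrite expr0.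
  split=> //; apply: (vandermonde_free (k := 3) sinj Sb) => -[|[|[|//]]] _.
  - under eq_bigr do rewrite expr0.
    by move: e3; rewrite [X in _ + X]big1 ?addr0 // => i /hr ->; rewrite mul0r.
  - by under eq_bigr do rewrite expr1.
  - exact: e1.
have Sb2 : (#|[set i in S | bl i]| <= 2)%N.
  have := cardsID [set i | bl i] S.
  have -> : S :&: [set i | bl i] = [set i in S | bl i].
    by apply/setP => i; rewrite !inE.
  have -> : S :\: [set i | bl i] = [set i in S | ~~ bl i].
    by apply/setP => i; rewrite !inE andbC.
  move=> h; move: S4; rewrite -h => S4.
  have : (#|[set i in S | bl i]| + 2 <= 4)%N.
    by apply: leq_trans S4; rewrite leq_add2l.
  by rewrite -[4%N]/(2 + 2)%N leq_add2r.
have hb : forall i, i \in [set i in S | bl i] -> x 0 i = 0.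
  move=> i iS; suff /eqP : x 0 i * s i = 0.
    by rewrite mulf_eq0 (negbTE (sn0 i)) orbF => /eqP.
  apply: (vandermonde_free (x := fun i => x 0 i * s i) (k := 2) sinj Sb2) iS.
  case=> [|[|//]] _.
    by under eq_bigr do rewrite expr0 mulr1.
  by move: e1; under eq_bigr do rewrite expr2 mulrA.
split=> //; apply: (vandermonde_free (k := 2) sinj Sr) => -[|[|//]] _.
  by under eq_bigr do rewrite expr0.
under eq_bigr do rewrite expr1.
by move: e3; rewrite [X in X + _]big1 ?add0r // => i /hb ->; rewrite mul0r.
Qed.

Definition good bl e := exists2 P, colored_pos bl P & independent e P.

Lemma good_general bl e : good bl e ->
  exists2 P, colored_pos bl P & independent e P /\ general_pos bl P.
Proof.
move=> ge; apply: colored_pos_meet => //; first exact: open_independent.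
  exact: open_general_pos.
exact: general_pos_exists.
Qed.

Definition small bl (S : {set 'I_n}) :=
  [&& #|S| <= 4, #|[set i in S | bl i]| <= 3 &
      #|[set i in S | ~~ bl i]| <= 2]%N.

(** A row of a stress is a linear relation between positions, and general position admits none with
    small support. *)
Lemma general_row bl P (L : 'M[F]_n) S i : general_pos bl P -> L *m P = 0 ->
  small bl S -> (forall j, j \notin S -> L i j = 0) -> forall j, L i j = 0.
Proof.
move=> gen LP /and3P[S4 Sb Sr] Li j.
suff /rowP/(_ j) : row i L = 0 by rewrite !mxE.
apply: (gen S) => // [k kS|]; first by rewrite mxE Li.
by rewrite -row_mul LP row0.
Qed.

Lemma small_set1 bl i : small bl [set i].
Proof.
have h (p : pred 'I_n) : (#|[set j in [set i] | p j]| <= 1)%N.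
  rewrite -(cards1 i); apply: subset_leq_card; apply/subsetP => j.
  by rewrite !inE => /andP[].
by rewrite /small cards1 !(leq_trans (h _)).
Qed.

Lemma small_set2 bl i j : small bl [set i; j].
Proof.
have c2 : (#|[set i; j]| <= 2)%N by rewrite cards2; case: eqP.
have h (p : pred 'I_n) : (#|[set k in [set i; j] | p k]| <= 2)%N.
  apply: leq_trans c2; apply: subset_leq_card; apply/subsetP => k.
  by rewrite !inE => /andP[].
by rewrite /small (leq_trans c2) // !(leq_trans (h _)).
Qed.

Lemma good_empty bl e : (forall i j, ~~ e i j) -> good bl e.
Proof.
move=> e0; have [P cP gP] := general_pos_exists bl; exists P => // L [_ sL LP].
apply/matrixP => i j; rewrite mxE.
apply: (general_row gP LP (small_set1 bl i)) => k.
by rewrite inE => ki; apply: sL; rewrite // eq_sym.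
Qed.

Definition del_vertex (v : 'I_n) e : rel 'I_n :=
  fun i j => [&& i != v, j != v & e i j].

(** Row [v] of a stress is supported on [v] and [w], whose positions are independent; once it
    vanishes, the stress lives on the graph without [v]. *)
Lemma good_leaf bl e v w : symmetric e -> (forall j, e v j -> j = w) ->
  good bl (del_vertex v e) -> good bl e.
Proof.
move=> se evw /good_general[P cP [iP gP]]; exists P => // L [tL sL LP].
have Lv j : L v j = 0.
  apply: (general_row gP LP (small_set2 bl v w)) => k.
  rewrite !inE negb_or => /andP[kv kw]; apply: sL; first by rewrite eq_sym.
  by apply: contraNN kw => /evw ->.
apply: iP; split=> // i j ij; rewrite /del_vertex !negb_and !negbK.
case/or3P => [/eqP -> //|/eqP -> |]; last exact: sL.
by rewrite -tL mxE.
Qed.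

Definition restrict (A : {set 'I_n}) e : rel 'I_n :=
  fun i j => [&& i \in A, j \in A & e i j].

(* The part of a stress carried by one side of a clique cut loads the clique;
   as the clique has linearly independent positions, this load is resolved by
   the edges of the clique, which splits the stress. *)
Lemma good_glue bl e (A B : {set 'I_n}) :
  A :|: B = setT -> (forall i j, e i j -> restrict A e i j || restrict B e i j) ->
  {in A :&: B &, forall i j, i != j -> e i j} -> small bl (A :&: B) ->
  good bl (restrict A e) -> good bl (restrict B e) -> good bl e.
Proof.
move=> AB eAB clq smallC gA gB.
have [P cP [[iA gP] iB]] : exists2 P, colored_pos bl P &
    (independent (restrict A e) P /\ general_pos bl P) /\
    independent (restrict B e) P.
  apply: colored_pos_meet gB; last exact: good_general.
    by apply: open_and; [exact: open_independent|exact: open_general_pos].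
  exact: open_independent.
exists P => // L [tL sL LP].
pose D (S : {set 'I_n}) : 'M[F]_n := diag_mx (\row_i (i \in S)%:R).
have DM (S : {set 'I_n}) (M : 'M[F]_n) i j : (D S *m M) i j = (i \in S)%:R * M i j.
  by rewrite mul_diag_mx !mxE.
have MD (S : {set 'I_n}) (M : 'M[F]_n) i j : (M *m D S) i j = M i j * (j \in S)%:R.
  by rewrite mul_mx_diag !mxE.
have addE (M N : 'M[F]_n) i j : (M + N) i j = M i j + N i j by rewrite mxE.
have oppE (M : 'M[F]_n) i j : (- M) i j = - M i j by rewrite mxE.
have DD S : D S *m D S = D S.
  apply/matrixP => i j; rewrite DM !mxE; case: (i =P j) => [->|_].
    by rewrite !mulr1n -natrM mulnb andbb.
  by rewrite !mulr0n mulr0.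
have tD S : (D S)^T = D S by rewrite tr_diag_mx.
pose S := ~: B; pose C := A :&: B.
have inA i : (i \in A) = (i \in S) || (i \in C).
  have := in_setT i; rewrite -AB !inE.
  by case: (i \in A); case: (i \in B).
have SC i : i \in S -> i \notin C by rewrite !inE negb_and orbC => ->.
have LSA i j : i \in S -> j \notin A -> L i j = 0.
  move=> iS jA; apply: sL.
    by apply: contraNneq jA => <-; rewrite inA iS.
  apply/negP => /eAB; rewrite /restrict (negbTE jA) andbF /=.
  by move: iS; rewrite inE => /negbTE ->.
have DSL : D S *m L = D S *m L *m D S + D S *m L *m D C.
  apply/matrixP => i j; rewrite [RHS]mxE !MD !DM.
  case iS : (i \in S); last by rewrite !mul0r addr0.
  rewrite !mul1r -mulrDr -natrD; case jA : (j \in A); last first.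
    by rewrite LSA ?jA ?mul0r.
  move: jA; rewrite inA; case jS : (j \in S) => /=.
    by rewrite (negbTE (SC _ jS)) mulr1.
  by move=> ->; rewrite mulr1.
have SLP : D S *m L *m D S *m P + D S *m L *m D C *m P = 0.
  by rewrite -mulmxDl -DSL -mulmxA LP mulmx0.
(* The positions of the clique are independent, so their matrix can be inverted on the right. *)
have [R RE] : exists R : 'M[F]_(4, n), D C *m P *m R = D C.
  suff /submxP[R RE] : (D C <= (D C *m P)^T)%MS.
    by exists R^T; rewrite -[LHS]trmxK trmx_mul trmxK -RE tD.
  rewrite submxE; apply/eqP/trmx_inj; rewrite trmx_mul tD trmx0.
  apply/row_matrixP => i; rewrite row0 row_mul.
  set y := row i _.
  have yP : y *m (D C *m P) = 0.
    have := mulmx_coker (D C *m P)^T.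
    move/(congr1 trmx); rewrite trmx_mul trmxK trmx0 => /(congr1 (row i)).
    by rewrite row_mul row0.
  have [s1 s2 s3] := and3P smallC.
  apply: (gP C s1 s2 s3); last by rewrite -mulmxA.
  by move=> k kC; rewrite mul_mx_diag !mxE (negbTE kC) mulr0.
(* The load that the side [S] exerts on the clique. *)
pose l := D C *m L *m D S *m P.
have lC : D C *m l = l by rewrite /l !mulmxA DD.
(* The load has no torque, since the forces inside [S] balance symmetrically; this is what a
   symmetric [K] with [l = K *m P] requires. *)
have symX : (D C *m P)^T *m l = l^T *m (D C *m P).
  have -> : l^T *m (D C *m P) = P^T *m (D S *m L *m D C *m P).
    by rewrite /l !trmx_mul !tD tL !mulmxA -[P^T *m _ *m _ *m _ *m D C]mulmxA DD.
  have -> : (D C *m P)^T *m l = P^T *m (D S *m L *m D C)^T *m P.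
    by rewrite /l !trmx_mul !tD tL !mulmxA -[P^T *m _ *m D C]mulmxA DD.
  have X1 : D S *m L *m D C *m P = - (D S *m L *m D S *m P).
    by apply/eqP; rewrite -addr_eq0 addrC SLP.
  rewrite X1 -trmx_mul X1 linearN /= mulNmx mulmxN; congr (- _).
  by rewrite !trmx_mul !tD tL !mulmxA.
pose K := R^T *m l^T *m D C.
have lK : l = K *m P.
  rewrite /K -!mulmxA -symX mulmxA -trmx_mul RE tD.
  by rewrite lC.
have KT : K^T = K.
  rewrite {1}/K !trmx_mul !trmxK tD mulmxA lC {1}lK /K.
  by rewrite -!mulmxA [D C *m _]mulmxA RE.
have KC : D C *m K *m D C = K.
  have KD : K *m D C = K by rewrite /K -mulmxA DD.
  by rewrite -mulmxA KD -[LHS]trmxK trmx_mul tD KT KD.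
move: K lK KT KC => K lK KT KC.
(* The stress on the side [A], its clique part replaced by [- K], which resolves the load;
   independence on [A] makes it vanish, hence all rows of [L] in [S]. *)
pose L1 := D S *m L *m D S + D S *m L *m D C + D C *m L *m D S - K.
have L1E i j : L1 i j = (i \in S)%:R * L i j * (j \in S)%:R
    + (i \in S)%:R * L i j * (j \in C)%:R + (i \in C)%:R * L i j * (j \in S)%:R
    - (i \in C)%:R * K i j * (j \in C)%:R.
  have -> : L1 = D S *m L *m D S + D S *m L *m D C + D C *m L *m D S
    - D C *m K *m D C by rewrite KC.
  by rewrite !addE oppE !MD !DM.
have L10 : L1 = 0.
  apply: iA; split.
  - rewrite /L1 !linearD linearN /= KT !trmx_mul !tD tL !mulmxA.
    by rewrite -!addrA; congr (_ + _); rewrite addrCA.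
  - move=> i j ij nij; rewrite L1E; case iS : (i \in S).
      rewrite (negbTE (SC _ iS)) !mul0r subr0 addr0 mul1r -mulrDr -natrD.
      case jA : (j \in A); last by rewrite LSA ?jA ?mul0r.
      rewrite sL ?mul0r //; move: nij.
      by rewrite /restrict jA inA iS.
    rewrite !mul0r !add0r; case iC : (i \in C); last by rewrite !mul0r subr0.
    rewrite !mul1r; case jS : (j \in S).
      rewrite (negbTE (SC _ jS)) mulr0 subr0 mulr1.
      by apply: sL => //; move: nij; rewrite /restrict !inA iC jS orbT.
    rewrite mulr0 sub0r; case jC : (j \in C); last by rewrite mulr0 oppr0.
    by move: nij; rewrite /restrict !inA iC jC !orbT /= clq.
  - rewrite /L1 mulmxBl !mulmxDl SLP add0r -lK.
    by rewrite /l subrr.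
have Srow i j : i \in S -> L i j = 0.
  move=> iS; have /matrixP/(_ i j) := L10.
  rewrite L1E iS (negbTE (SC _ iS)) !mul0r subr0 addr0 mul1r -mulrDr -natrD.
  rewrite mxE; case jA : (j \in A); last by rewrite LSA ?jA.
  move: jA; rewrite inA; case jS : (j \in S) => /=.
    by rewrite (negbTE (SC _ jS)) mulr1.
  by move=> ->; rewrite mulr1.
apply: iB; split=> // i j ij; rewrite /restrict !negb_and.
case/or3P => [iB'|jB'|]; last exact: sL.
  by apply: Srow; rewrite inE.
by rewrite -tL mxE; apply: Srow; rewrite inE.
Qed.

(* With the position of v tending to that of x along direction P v, the
   variables of the merged system (rows x and v added, the row of v kept aside)
   depend polynomially on the parameter t down to t = 0. *)
Lemma good_split bl e (x v : 'I_n) : symmetric e -> bl x -> bl v -> x != v ->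
  small bl ([set x; v] :|: common x v e) -> good bl (contract x v e) ->
  good bl e.
Proof.
move=> se bx bv xv sm /good_general[P cP [iP gP]].
pose E : 'M[F]_n := delta_mx v v; pose D : 'M[F]_n := 1%:M - E.
have EM m (M : 'M[F]_(n, m)) i j : (E *m M) i j = (i == v)%:R * M v j.
  rewrite mxE (bigD1 v) //= big1 ?addr0; last first.
    by move=> k kv; rewrite !mxE (negbTE kv) andbF mul0r.
  by rewrite !mxE eqxx andbT.
have ME (M : 'M[F]_n) i j : (M *m E) i j = M i v * (j == v)%:R.
  rewrite mxE (bigD1 v) //= big1 ?addr0; last first.
    by move=> k kv; rewrite !mxE (negbTE kv) mulr0.
  by rewrite !mxE eqxx.
have addE m (M N : 'M[F]_(n, m)) i j : (M + N) i j = M i j + N i j.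
  by rewrite mxE.
have scaleE m a (M : 'M[F]_(n, m)) i j : (a *: M) i j = a * M i j.
  by rewrite mxE.
have subE m (M N : 'M[F]_(n, m)) i j : (M - N) i j = M i j - N i j.
  by rewrite !mxE.
have DM m (M : 'M[F]_(n, m)) i j : (D *m M) i j = (i != v)%:R * M i j.
  rewrite /D mulmxBl mul1mx subE EM.
  by case: eqP => [->|_]; rewrite ?mul1r ?mul0r ?subrr ?subr0.
have MD (M : 'M[F]_n) i j : (M *m D) i j = M i j * (j != v)%:R.
  rewrite /D mulmxBr mulmx1 subE ME.
  by case: eqP => [->|_]; rewrite ?mulr1 ?mulr0 ?subrr ?subr0.
have Edef : E = delta_mx v v by [].
have Ddef : D = 1%:M - E by [].
clearbody D E.
have EE : E *m E = E by rewrite Edef mul_delta_mx.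
have DE : D *m E = 0 by rewrite Ddef mulmxBl mul1mx EE subrr.
have ED : E *m D = 0 by rewrite Ddef mulmxBr mulmx1 EE subrr.
have DD : D *m D = D by rewrite {1}Ddef mulmxBl mul1mx ED subr0.
pose bad i j := if (i == v) || (j == v) || (i == x) || (j == x)
  then false else (i != j) && ~~ e i j.
(* The unknown [N] has column [x] equal to the sum of the old columns [x] and [v], so a missing edge
   [i x] reads [N i x = N i v]. The last block is the equilibrium at t = 0, with the row of [v] kept
   apart. *)
pose f (N : 'M[F]_n) : 'M[F]_(n, n + (n + (n + 4))) :=
  row_mx (N - N^T) (row_mx (\matrix_(i, j) if bad i j then N i j else 0)
    (row_mx (\matrix_(i, j) if (i == v) || (i == x) then 0 else
       if j == v then if e i v then 0 else N i v else
       if j == x then if e i x then 0 else N i x - N i v else 0)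
    (D *m N *m D *m P + E *m N *m P))).
pose g (N : 'M[F]_n) : 'M[F]_(n, n + (n + (n + 4))) :=
  row_mx 0 (row_mx 0 (row_mx 0 (D *m N *m E *m P))).
have lf : linear f.
  move=> a M N; rewrite /f scale_row_mx add_row_mx; congr row_mx.
    rewrite linearD linearZ /=.
    by rewrite scalerBr opprD addrACA.
  rewrite scale_row_mx add_row_mx; congr row_mx.
    by apply/matrixP => i j; rewrite !mxE; case: ifP; rewrite ?mulr0 ?addr0.
  rewrite scale_row_mx add_row_mx; congr row_mx.
    apply/matrixP => i j; rewrite !mxE.
    by do ![case: ifP => _]; rewrite ?mulr0 ?addr0 //; ring.
  rewrite !mulmxDr !mulmxDl -!scalemxAr -!scalemxAl scalerDr.
  by rewrite addrACA.
have lg : linear g.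
  move=> a M N; rewrite /g !scale_row_mx !add_row_mx !scaler0 !addr0.
  by rewrite !mulmxDr !mulmxDl -!scalemxAr -!scalemxAl.
have xv' : (x == v) = false by apply: negbTE.
have fP N : f N = 0 <-> [/\ N^T = N,
    forall i j, bad i j -> N i j = 0,
    forall i, i != v -> i != x -> ~~ e i v -> N i v = 0,
    forall i, i != v -> i != x -> ~~ e i x -> N i x = N i v &
    D *m N *m D *m P + E *m N *m P = 0].
  split.
    move/eqP; rewrite !row_mx_eq0.
    case/and4P => /eqP/subr0_eq h1 /eqP h2 /eqP h3 /eqP h4; split=> //.
    - by move=> i j bij; move/matrixP/(_ i j): h2; rewrite !mxE bij.
    - move=> i iv ix iv'; move/matrixP/(_ i v): h3; rewrite !mxE.
      by rewrite (negbTE iv) (negbTE ix) (negbTE iv') eqxx.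
    - move=> i iv ix iv'; move/matrixP/(_ i x): h3; rewrite !mxE xv'.
      by rewrite (negbTE iv) (negbTE ix) (negbTE iv') eqxx => /subr0_eq.
  case=> h1 h2 h3 h4 h5; apply/eqP; rewrite !row_mx_eq0 h5 [in N - N^T]h1 subrr.
  rewrite !eqxx /= andbT; apply/andP; split; apply/eqP/matrixP => i j; rewrite !mxE.
    by case: ifP => // /h2.
  case: ifP => // /norP[iv ix]; case: eqP => _.
    by case: ifPn => // /h3 ->.
  by case: eqP => // _; case: ifPn => // /h4 ->; rewrite // subrr.
have [|q q0 hq] := linear_injective_perturb lf lg.
  (* At t = 0 the rows other than [v] form a stress of the contraction and vanish. Row [v] is then a
     relation supported on [x], [v] and their common neighbours, which general position excludes. *)
  move=> N /fP[h1 h2 h3 h4 h5].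
  have symN i j : N i j = N j i by rewrite -{1}h1 mxE.
  have DNDP : D *m N *m D *m P = 0.
    have := congr1 (mulmx D) h5.
    by rewrite mulmxDr !mulmxA DD DE !mul0mx addr0 mulmx0.
  have ENP : E *m N *m P = 0 by move: h5; rewrite DNDP add0r.
  have N'0 : D *m N *m D = 0.
    apply: iP; split=> //.
      apply/matrixP => i j; rewrite [LHS]mxE !MD !DM (symN j i).
      by ring.
    move=> i j ij; rewrite MD DM; case: (eqVneq i v) => [_|iv]; first by rewrite !mul0r.
    case: (eqVneq j v) => [_|jv]; first by rewrite mulr0.
    rewrite mul1r mulr1 /contract iv jv ij /= !negb_or => /and3P[nij].
    case: (eqVneq i x) ij nij => [->|ix] ij nij /=.
      move=> nvj _; have jx : j != x by rewrite eq_sym.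
      have njx : ~~ e j x by rewrite se.
      have njv : ~~ e j v by rewrite se.
      by rewrite symN h4 // h3.
    move=> _; case: (eqVneq j x) nij => [->|jx] nij /=.
      by move=> niv; rewrite h4 // h3.
    by move=> _; apply: h2; rewrite /bad (negbTE iv) (negbTE jv) (negbTE ix)
      (negbTE jx) ij.
  have Nij i j : i != v -> j != v -> N i j = 0.
    move=> iv jv; have := congr1 (fun M : 'M[F]_n => M i j) N'0.
    by rewrite MD DM iv jv mul1r mulr1 mxE.
  have Nv j : N v j = 0.
    have ENP' : row v N *m P = 0.
      rewrite -row_mul; apply/rowP => k; rewrite !mxE.
      have := congr1 (fun M : 'M[F]_(n, 4) => M v k) ENP.
      by rewrite -mulmxA EM eqxx mul1r !mxE.
    suff /rowP/(_ j) : row v N = 0 by rewrite !mxE.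
    have [s1 s2 s3] := and3P sm; apply: (gP _ s1 s2 s3) ENP' => k.
    rewrite !inE !negb_or => /andP[/andP[kx kv]]; rewrite mxE symN negb_and.
    case: (boolP (e k v)) => [ekv|]; last by move=> /h3 ->.
    by rewrite -(se k v) ekv orbF se => /h4 <- //; rewrite Nij.
  apply/matrixP => i j; rewrite mxE.
  case: (eqVneq i v) => [->//|iv]; case: (eqVneq j v) => [->|jv]; last exact: Nij.
  by rewrite symN.
(* The factor ['X] keeps [t] nonzero, so [L v v] can be recovered from [t * L v v]. *)
have [t] := poly_nonroot infF (mulf_neq0 q0 (negbT (polyX_eq0 F))).
rewrite hornerM hornerX mulf_eq0 negb_or => /andP[qt t0].
(* The new position of [v] is that of [x] displaced by [t] times row [v] of [P]. *)
pose T : 'M[F]_n := D + delta_mx v x + t *: E.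
exists (T *m P).
  move=> i k ik.
  case: (eqVneq i v) => [iv|iv]; last first.
    rewrite /T !mulmxDl -scalemxAl !addE scaleE DM EM (negbTE iv) mul1r mul0r.
    rewrite mulr0 addr0 [X in _ + X]mxE big1 ?addr0; first exact: cP.
    by move=> j _; rewrite !mxE (negbTE iv) mul0r.
  rewrite iv /T !mulmxDl -scalemxAl !addE scaleE DM EM eqxx mul0r mul1r add0r.
  rewrite mxE (bigD1 x) //= !mxE !eqxx mul1r big1 ?addr0; last first.
    by move=> j jx; rewrite !mxE (negbTE jx) andbF mul0r.
  move: ik; rewrite iv bv => ik.
  by rewrite !cP ?bx ?bv // mulr0 addr0.
move=> L [tL sL LP].
have symL i j : L i j = L j i by rewrite -{1}tL mxE.
pose U : 'M[F]_n := 1%:M + delta_mx v x.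
pose N0 := U^T *m L *m U.
have LTP : N0 *m D *m P + t *: (N0 *m E *m P) = 0.
  have UD : U *m D = D + delta_mx v x.
    by rewrite /U mulmxDl mul1mx {2}Ddef mulmxBr mulmx1 Edef mul_delta_mx_0 ?subr0.
  have UE : U *m E = E.
    by rewrite /U mulmxDl mul1mx {2}Edef mul_delta_mx_0 ?addr0.
  have -> : N0 *m D *m P + t *: (N0 *m E *m P) = U^T *m (L *m (T *m P)).
    have -> : N0 *m D = U^T *m L *m (D + delta_mx v x) by rewrite /N0 -[LHS]mulmxA UD.
    have -> : N0 *m E = U^T *m L *m E by rewrite /N0 -[LHS]mulmxA UE.
    rewrite /T [(_ + _ + _) *m P]mulmxDl [L *m (_ + _)]mulmxDr.
    rewrite [U^T *m (_ + _)]mulmxDr -!scalemxAl -!scalemxAr.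
    by rewrite !mulmxA.
  by rewrite LP mulmx0.
have N0E i j : N0 i j = L i j + (i == x)%:R * L v j + (j == x)%:R * L i v
   + ((i == x) && (j == x))%:R * L v v.
  have MU (M : 'M[F]_n) k l : (M *m U) k l = M k l + (l == x)%:R * M k v.
    rewrite /U mulmxDr mulmx1 addE; congr (_ + _).
    rewrite mxE (bigD1 v) //= big1 ?addr0; last first.
      by move=> h hv; rewrite !mxE (negbTE hv) mulr0.
    by rewrite !mxE eqxx mulrC.
  have UM k l : (U^T *m L) k l = L k l + (k == x)%:R * L v l.
    have -> : U^T *m L = (L *m U)^T by rewrite trmx_mul tL.
    by rewrite [LHS]mxE MU (symL l k) (symL l v).
  by rewrite /N0 MU !UM mulrDr -mulnb natrM; ring.
have symN0 : N0^T = N0 by rewrite /N0 !trmx_mul trmxK tL mulmxA.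
clearbody N0.
(* Multiplying the diagonal entry at [v] by [t] absorbs the factor [t] in row [v], whose equation
   then no longer depends on [t]. *)
pose N := N0 + (t - 1) *: (E *m N0 *m E).
have NE i j : ~~ ((i == v) && (j == v)) -> N i j = N0 i j.
  rewrite negb_and /N addE scaleE ME EM.
  by case/orP => /negbTE ->; rewrite ?mul0r !mulr0 addr0.
have ENE : E *m N0 *m E *m E = E *m N0 *m E by rewrite -mulmxA EE.
have NE' w z : w != x -> w != v -> N w z = L w z + (z == x)%:R * L w v.
  move=> wx wv; rewrite NE ?(negbTE wv) // N0E (negbTE wx).
  by rewrite !mul0r !addr0.
have symN : N^T = N.
  have tE : E^T = E by rewrite Edef trmx_delta.
  by rewrite /N linearD linearZ /= !trmx_mul tE symN0 mulmxA.
have symN' i j : N i j = N j i by rewrite -{1}symN mxE.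
have N00 : N = 0.
  apply: (hq t qt).
  rewrite /f /g !scale_row_mx !add_row_mx !scaler0 !addr0 symN subrr.
  have -> : D *m N *m D *m P + E *m N *m P + t *: (D *m N *m E *m P) = 0.
    have DN : D *m N = D *m N0.
      by rewrite /N mulmxDr -scalemxAr !mulmxA DE !mul0mx scaler0 addr0.
    have EN : E *m N = E *m (N0 *m D + t *: (N0 *m E)).
      rewrite /N mulmxDr -scalemxAr !mulmxA EE mulmxDr -scalemxAr !mulmxA.
      rewrite scalerBl scale1r addrCA addrC; congr (_ + _).
      by rewrite Ddef mulmxBr mulmx1.
    rewrite DN EN addrAC.
    have -> : D *m N0 *m D *m P + t *: (D *m N0 *m E *m P) =
        D *m (N0 *m D *m P + t *: (N0 *m E *m P)).
      by rewrite mulmxDr -scalemxAr !mulmxA.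
    by rewrite LTP mulmx0 add0r -mulmxA mulmxDl -scalemxAl LTP mulmx0.
  have -> : (\matrix_(i, j) if bad i j then N i j else 0) = 0.
    apply/matrixP => i j; rewrite [LHS]mxE [RHS]mxE; case b : (bad i j) => //.
    move: b; rewrite /bad; case: ifP => // /negbT; rewrite !negb_or -!andbA.
    case/and4P => iv jv ix jx /andP[ij nij].
    by rewrite NE' // (negbTE jx) mul0r addr0 sL.
  have -> : (\matrix_(i, j) if (i == v) || (i == x) then 0 else
       if j == v then if e i v then 0 else N i v else
       if j == x then if e i x then 0 else N i x - N i v else 0) = 0.
    apply/matrixP => i j; rewrite [LHS]mxE [RHS]mxE.
    case: ifP => // /norP[iv ix]; case: eqP => _.
      by case: ifPn => // niv; rewrite NE' // eq_sym xv' mul0r addr0 sL.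
    case: eqP => // _; case: ifPn => // nix.
    by rewrite !NE' // eqxx mul1r [v == x]eq_sym xv' mul0r addr0 addrK sL.
  by rewrite !row_mx0.
have Nz i j : N i j = 0 by rewrite N00 mxE.
have Lvv : L v v = 0.
  have := Nz v v; rewrite /N addE scaleE ME EM !eqxx N0E eq_sym xv' /=.
  rewrite !mul0r !addr0 mulr1 mul1r => h.
  have /eqP : t * L v v = 0 by rewrite -[RHS]h; ring.
  by rewrite mulf_eq0 (negbTE t0) => /eqP.
have Lwv w : w != v -> L w v = 0.
  move=> wv; have := Nz w v; rewrite NE ?(negbTE wv) // N0E [v == x]eq_sym xv'.
  by rewrite andbF Lvv !mulr0 !mul0r !addr0.
apply/matrixP => i j; rewrite mxE.
case: (eqVneq j v) => [->|jv].
  by case: (eqVneq i v) => [->//|]; exact: Lwv.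
case: (eqVneq i v) => [->|iv]; first by rewrite symL Lwv.
have := Nz i j; rewrite NE ?(negbTE iv) // N0E Lvv (Lwv _ iv) (symL v j).
by rewrite (Lwv _ jv) !mulr0 !addr0.
Qed.

End Generic.

(** * Sparse planar graphs have no stress *)

Section Sparse.
Variables (V : finType) (bl : pred V).
Implicit Types (e : rel V) (W : {set V}).

Definition laman_sparse e := forall W, (forall v, v \in W -> bl v) ->
  (2 <= #|W|)%N -> (#|pairs e W| + 6 <= 4 * #|W|)%N.

(** A single blue edge attains the bound too; only sets of three or more vertices can block a
    contraction. *)
Definition tight e W :=
  [&& [forall v in W, bl v], (3 <= #|W|)%N & #|pairs e W| + 6 == 4 * #|W|]%N.

Lemma pairs_mono e e' W : subrel e' e -> (#|pairs e' W| <= #|pairs e W|)%N.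
Proof.
move=> sub; apply: subset_leq_card; apply/subsetP => p; rewrite !inE.
by case/and3P => -> -> /sub.
Qed.

Lemma pairsUI e (A B : {set V}) :
  (#|pairs e A| + #|pairs e B| <= #|pairs e (A :|: B)| + #|pairs e (A :&: B)|)%N.
Proof.
rewrite -cardsUI; apply: leq_add; apply: subset_leq_card; apply/subsetP => p.
  by rewrite !inE => /orP[] /and3P[-> -> ->]; rewrite ?orbT.
by rewrite !inE => /andP[/and3P[-> -> ->] /and3P[-> -> _]].
Qed.

Lemma pairsUI_lt e (A B : {set V}) a b : e a b -> a \in A -> a \notin B ->
  b \in B -> b \notin A ->
  (#|pairs e A| + #|pairs e B| < #|pairs e (A :|: B)| + #|pairs e (A :&: B)|)%N.
Proof.
move=> ab aA aB bB bA; rewrite -cardsUI -addSn; apply: leq_add.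
  apply: proper_card; apply/properP; split.
    apply/subsetP => p; rewrite !inE.
    by move=> /orP[] /and3P[-> -> ->]; rewrite ?orbT.
  exists (a, b); rewrite !inE /= ?aA ?bB ?ab ?orbT //.
  by rewrite (negbTE aB) (negbTE bA).
apply: subset_leq_card; apply/subsetP => p.
by rewrite !inE => /andP[/and3P[-> -> ->] /and3P[-> -> _]].
Qed.

(** Pair counts are supermodular. With two common vertices the bound holds for both intersection and
    union, so both are equalities, and an edge between the two differences would exceed them. *)
Lemma tightU e (A B : {set V}) a b : laman_sparse e -> tight e A -> tight e B ->
  a != b -> a \in A :&: B -> b \in A :&: B ->
  tight e (A :|: B) /\
  forall i j, e i j -> i \in A -> i \notin B -> j \in B -> j \notin A -> False.
Proof.
move=> sp /and3P[/forall_inP bA A3 /eqP tA] /and3P[/forall_inP bB B3 /eqP tB].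
move=> ab aI bI.
have bU v : v \in A :|: B -> bl v by rewrite inE => /orP[/bA|/bB].
have bI' v : v \in A :&: B -> bl v by rewrite inE => /andP[/bA].
have cI : (2 <= #|A :&: B|)%N.
  have <- : #|[set a; b]| = 2%N by rewrite cards2 ab.
  by apply: subset_leq_card; rewrite subUset !sub1set aI bI.
have cU : (3 <= #|A :|: B|)%N.
  by apply: leq_trans A3 _; apply: subset_leq_card; exact: subsetUl.
have s1 := sp _ bI' cI; have s2 := sp _ bU (ltnW cU).
have := cardsUI A B; have := pairsUI e A B => h1 h2.
split.
  apply/and3P; split=> //; first by apply/forall_inP.
  by apply/eqP; lia.
by move=> i j ij iA iB jB jA; have := pairsUI_lt ij iA iB jB jA; lia.
Qed.

(* Among the blue triangles xyz, with W a largest tight set containing x and y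
   but not z, take one minimizing #|W|.  A triangle inside W then has two sides
   whose tight sets both contain z, hence a union that is too dense. *)
Lemma unblocked_edge e a b : graph e -> laman_sparse e -> e a b -> bl a -> bl b ->
  (forall W, (forall v, v \in W -> bl v) -> (3 <= #|W|)%N ->
     (forall x y z, x \in W -> y \in W -> z \in W ->
        e x y -> e y z -> e x z -> False) ->
     (#|pairs e W| + 8 <= 4 * #|W|)%N) ->
  exists x v, [/\ e x v, bl x, bl v,
    forall k k', bl k -> bl k' -> k \in common x v e -> k' \in common x v e ->
      k = k' &
    forall W, (forall v, v \in W -> bl v) -> (3 <= #|W|)%N -> x \in W -> v \in W ->
      (#|pairs e W| + 8 <= 4 * #|W|)%N \/ exists2 k, k \in W & k \in common x v e].
Proof.
move=> ge sp eab ba bb dense; have [se ie] := ge.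
have ne i j : e i j -> i != j by apply: contraTneq => ->; rewrite ie.
(* The number of ordered pairs is even, so missing the bound means missing it by 2. *)
have even8 W : (forall v, v \in W -> bl v) -> (3 <= #|W|)%N -> ~~ tight e W ->
    (#|pairs e W| + 8 <= 4 * #|W|)%N.
  move=> bW W3 nt; have := sp W bW (ltnW W3).
  have : (#|pairs e W| + 6 != 4 * #|W|)%N.
    by move: nt; rewrite /tight W3 /=; case: forall_inP.
  by rewrite (card_pairs_orient W ge); lia.
pose tri (t : V * V * V) := let: (x, y, z) := t in
  [&& bl x, bl y, bl z, e x y, e y z & e x z].
case: (pickP tri) => [t0 tri0|notri]; last first.
  exists a, b; split=> //.
    move=> k k' bk bk'; rewrite !inE => /andP[ak bek]; have := notri (a, b, k).
    by rewrite /= ba bb bk eab bek ak.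
  move=> W bW W3 _ _; left; apply: dense => // x y z xW yW zW xy yz xz.
  by have := notri (x, y, z); rewrite /= !bW // xy yz xz.
pose blk (t : V * V * V) W := let: (x, y, z) := t in
  [&& tight e W, x \in W, y \in W & z \notin W].
case: (pickP [pred t | tri t && ~~ [exists W, blk t W]]).
  case=> [[x v] z] /= /andP[/and5P[bx bv bz xv /andP[vz xz]] /existsPn nb].
  have zc : z \in common x v e by rewrite inE xz vz.
  have zW W : tight e W -> x \in W -> v \in W -> z \in W.
    by move=> tW xW vW; have := nb W; rewrite tW xW vW /= negbK.
  (* A second blue common neighbour [k] would make [x v k] a tight set without [z]. *)
  have kz k : bl k -> k \in common x v e -> k = z.
    move=> bk; rewrite inE => /andP[xk vk].
    have tW : tight e [set x; v; k].
      have c3 : #|[set x; v; k]| = 3%N.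
        by rewrite setUC cardsU1 cards2 !inE negb_or ![k == _]eq_sym (ne _ _ xk)
             (ne _ _ vk) (ne _ _ xv).
      apply/and3P; rewrite c3; split=> //.
        by apply/forall_inP => u; rewrite !inE => /orP[/orP[]|] /eqP ->.
      have bW u : u \in [set x; v; k] -> bl u.
        by rewrite !inE => /orP[/orP[]|] /eqP ->.
      rewrite card_pairs_clique ?c3 // => i j.
      rewrite !inE => /orP[/orP[]|] /eqP -> /orP[/orP[]|] /eqP ->; rewrite ?eqxx //.
      - by rewrite [e v x]se.
      - by rewrite [e k x]se.
      - by rewrite [e k v]se.
    have := zW _ tW; rewrite !inE !eqxx !orbT => /(_ isT isT).
    by rewrite ![z == _]eq_sym (negbTE (ne _ _ xz)) (negbTE (ne _ _ vz)) /= =>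
       /eqP.
  exists x, v; split=> //.
    by move=> k k' bk bk' /(kz _ bk) -> /(kz _ bk') ->.
  move=> W bW W3 xW vW; case tW : (tight e W).
    by right; exists z => //; apply: zW.
  by left; apply: even8; rewrite ?tW.
move=> allblk.
pose s t := (\max_(W | blk t W) #|W|)%N.
have exblk t : tri t -> exists2 W, blk t W & #|W| = s t.
  move=> tt; have := allblk t; rewrite /= tt => /negbFE/existsP[W bW].
  have [|W' bW' sW'] := @eq_bigmax_cond _ (blk t) (fun W => #|W|).
    by apply/card_gt0P; exists W.
  exact (ex_intro2 _ _ W' bW' (esym sW')).
case: (arg_minnP s tri0) => [[[x y] z] trit smin].
have [W] := exblk _ trit; rewrite /blk => /and4P[tW xW yW zW] sW.
have [[[x1 y1] z1] [/= x1W y1W z1W tri1]] : exists t : V * V * V,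
   [/\ t.1.1 \in W, t.1.2 \in W, t.2 \in W & tri t].
  apply: contrapT => h; case/and3P: tW => /forall_inP bW W3 /eqP cW.
  suff : (#|pairs e W| + 8 <= 4 * #|W|)%N by lia.
  apply: dense => // p q r pW qW rW pq qr pr; apply: h; exists (p, q, r).
  by split=> //=; rewrite !bW // pq qr pr.
have /and5P[bx1 by1 bz1 xy1 /andP[yz1 xz1]] := tri1.
have tri2 : tri (y1, z1, x1).
  by rewrite /= bx1 by1 bz1 yz1 [e z1 x1]se xz1 [e y1 x1]se xy1.
(* If [W'] missed [z], its union with [W] would block [(x, y, z)]; maximality of [W] gives
   [W' \subset W], properly because of [w], against the minimality of [s]. *)
have key u v w : tri (u, v, w) -> u \in W -> v \in W -> w \in W ->
    exists W', [/\ tight e W', u \in W', v \in W', w \notin W' & z \in W'].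
  move=> triu uW vW wW; have [W'] := exblk _ triu.
  rewrite /blk => /and4P[tW' uW' vW' wW'] sW'.
  exists W'; split=> //; apply: contraT => zW'.
  have uv : u != v by case/and5P: triu => _ _ _ /ne.
  have [] := @tightU e W W' u v sp tW tW' uv; rewrite ?inE ?uW ?uW' ?vW ?vW' //.
  move=> tU _.
  have : (#|W :|: W'| <= s (x, y, z))%N.
    apply: (@leq_bigmax_cond _ (blk (x, y, z)) (fun W => #|W|)).
    by rewrite /blk tU !inE xW yW (negbTE zW) (negbTE zW').
  rewrite -sW => UW; have WU : W' \subset W.
    have /eqP -> : W == W :|: W' by rewrite eqEcard subsetUl.
    exact: subsetUr.
  have : (#|W'| < #|W|)%N.
    by apply: proper_card; apply/properP; split=> //; exists w.
  by rewrite sW' sW ltnNge smin.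
have [W1 [tW1 x1W1 y1W1 z1W1 zW1]] := key _ _ _ tri1 x1W y1W z1W.
have [W2 [tW2 y1W2 z1W2 x1W2 zW2]] := key _ _ _ tri2 y1W z1W x1W.
have y1z : y1 != z by apply: contraNneq zW => <-.
have [] := @tightU e W1 W2 y1 z sp tW1 tW2 y1z.
- by rewrite inE y1W1.
- by rewrite inE zW1.
by move=> _ /(_ x1 z1 xz1 x1W1 x1W2 z1W2 z1W1).
Qed.
End Sparse.

(** * The induction on sparse planar graphs *)

Section Main.
Variables (F : fieldType) (n : nat) (bl : pred 'I_n).
Hypothesis infF : forall k, exists s : 'I_k -> F, injective s.
Implicit Types (e : rel 'I_n) (W S : {set 'I_n}).

Definition support_of e := [set i | [exists j, e i j]].

Definition admissible e := [/\ graph e, planar e,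
  forall i j, e i j -> bl i || bl j & laman_sparse bl e].

Lemma supportP e i j : e i j -> i \in support_of e.
Proof. by move=> ij; rewrite inE; apply/existsP; exists j. Qed.

Lemma support_lt e e' i : (forall j k, e' j k -> j \in support_of e) ->
  i \in support_of e -> (forall j, ~~ e' i j) ->
  (#|support_of e'| < #|support_of e|)%N.
Proof.
move=> sub ie ie'; apply: proper_card; apply/properP; split.
  by apply/subsetP => j; rewrite inE => /existsP[k /sub].
by exists i => //; rewrite inE; apply/existsPn.
Qed.

Lemma admissible_sub e e' : admissible e -> graph e' -> subrel e' e ->
  admissible e'.
Proof.
case=> ge pe semi sp ge' sub; split=> //.
- exact: planar_sub pe.
- by move=> i j /sub /semi.
- move=> W bW W2; apply: leq_trans (sp W bW W2); rewrite leq_add2r.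
  exact: pairs_mono.
Qed.

Lemma graph_restrict W e : graph e -> graph (restrict W e).
Proof.
by case=> se ie; split=> [i j|i]; rewrite /restrict ?ie ?andbF // se andbCA.
Qed.

Lemma restrict_sub W e : subrel (restrict W e) e.
Proof. by move=> i j /and3P[]. Qed.

Lemma good_sub e e' : subrel e' e -> good F bl e -> good F bl e'.
Proof.
move=> sub [P cP iP]; exists P => // L [tL sL LP]; apply: iP; split=> // i j ij.
by move=> nij; apply: sL => //; apply: contra nij => /sub.
Qed.

Lemma dense_triangle_free e : graph e -> planar e ->
  forall W, (3 <= #|W|)%N -> (forall x y z, x \in W -> y \in W -> z \in W ->
     e x y -> e y z -> e x z -> False) -> (#|pairs e W| + 8 <= 4 * #|W|)%N.
Proof.
move=> ge pe W W3 tri.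
have -> : pairs e W = pairs (restrict W e) W.
  apply/setP => p; rewrite !inE /restrict.
  by case: (p.1 \in W); case: (p.2 \in W).
apply: planar_triangle_free => //; first exact: graph_restrict.
- by apply: planar_sub pe; [exact: graph_restrict|exact: restrict_sub].
- by move=> i j /and3P[].
- move=> a b d /and3P[aW bW ab] /and3P[_ dW bd] /and3P[_ _ ad].
  exact: tri ab bd ad.
Qed.

Section Step.
Variable e : rel 'I_n.
Hypothesis adm : admissible e.
Hypothesis IH : forall e', admissible e' ->
  (#|support_of e'| < #|support_of e|)%N -> good F bl e'.

(** By planarity some triangle [x], [v], [c k] separates [c i] from [c j]. At most one of its
    vertices is red, so it is a small clique, and each side of the cut loses [c i] or [c j] from its
    support. *)
Lemma good_clique_cut x v (c : 'I_3 -> 'I_n) : bl x -> bl v -> e x v ->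
  injective c -> (forall i, e x (c i)) -> (forall i, e v (c i)) -> good F bl e.
Proof.
move=> bx bv xv cinj xc vc; have [ge pe semi sp] := adm; have [se ie] := ge.
have ne i j : e i j -> i != j by apply: contraTneq => ->; rewrite ie.
have [k [i [j [ik jk nij]]]] : exists k i j, [/\ i != k, j != k &
    ~~ connect (avoid [set x; v; c k] e) (c i) (c j)].
  apply: contrapT => h; apply: (planar_three_common ge pe cinj xv xc vc).
  move=> k i j ik jk; apply: contrapT => /negP nij.
  by apply: h; exists k, i, j.
have [S SE] : exists S, S = [set x; v; c k] by exists [set x; v; c k].
rewrite -SE in nij.
have cS l : l != k -> c l \notin S.
  move=> lk; rewrite SE !inE !negb_or (inj_eq cinj) lk.
  by rewrite ![c l == _]eq_sym (ne _ _ (xc l)) (ne _ _ (vc l)).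
pose K := [set u | connect (avoid S e) (c i) u].
have iK : c i \in K by rewrite inE connect0.
have jK : c j \notin K by rewrite inE.
have KS u : u \in K -> u \notin S.
  rewrite inE => /connectP[p]; elim/last_ind: p => [_ ->|p w _]; first exact: cS.
  by rewrite rcons_path last_rcons => /andP[_ /and3P[_ wS _]] ->.
have Kstep a b : e a b -> a \in K -> b \notin S -> b \in K.
  move=> ab aK bS; have aS := KS _ aK.
  rewrite inE in aK; rewrite inE; apply: (connect_trans aK (connect1 _)).
  by rewrite /avoid aS bS.
have capE : (S :|: K) :&: ~: K = S.
  apply/setP => u; rewrite in_setI in_setU in_setC.
  case uK : (u \in K); last by rewrite orbF andbT.
  by rewrite andbF; apply/esym/negbTE/KS.
have r1 (A : {set _}) : admissible (restrict A e).
  by apply: admissible_sub; [exact: adm|exact: graph_restrict|exact: restrict_sub].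
have r2 (A : {set _}) l : c l \notin A -> (#|support_of (restrict A e)| < #|support_of e|)%N.
  move=> lA; apply: (@support_lt _ _ (c l)).
  - by move=> a b /and3P[_ _ /supportP].
  - by apply: (@supportP _ _ x); rewrite se.
  - by move=> b; rewrite /restrict (negbTE lA).
apply: (@good_glue _ _ infF _ _ (S :|: K) (~: K)).
- by rewrite -setUA setUCr setUT.
- move=> a b ab; rewrite /restrict !in_setU !in_setC ab !andbT.
  case aK : (a \in K); case bK : (b \in K); rewrite ?orbT //=.
    by rewrite !orbF; apply: contraT => bS; rewrite (Kstep _ _ ab aK bS) in bK.
  rewrite !orbF andbT; apply: contraT => aS.
  by rewrite (Kstep b a) ?bK // 1?se // in aK.
- rewrite capE SE => a b; rewrite !inE.
  move=> /orP[/orP[]|] /eqP -> /orP[/orP[]|] /eqP ->; rewrite ?eqxx ?xv ?xc ?vc //.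
  + by rewrite se xv.
  + by rewrite se xc.
  + by rewrite se vc.
- rewrite capE; have c3 : (#|S| <= 3)%N.
    by rewrite SE setUC cardsU1 cards2; case: (_ \notin _); case: (x != v).
  have cS' (p : pred 'I_n) : (#|[set i in S | p i]| <= #|S|)%N.
    by apply: subset_leq_card; apply/subsetP => u; rewrite inE => /andP[].
  rewrite /small (leq_trans c3) // (leq_trans (cS' _)) //=.
  apply: (@leq_trans #|[set c k]|); last by rewrite cards1.
  apply: subset_leq_card; apply/subsetP => u; rewrite SE !inE.
  by move=> /andP[/orP[/orP[]|] /eqP ->]; rewrite ?bx ?bv // eqxx.
- apply: IH; first exact: r1.
  by apply: (r2 _ j); rewrite in_setU negb_or cS.
- apply: IH; first exact: r1.
  by apply: (r2 _ i); rewrite in_setC iK.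
Qed.

(** For a blue set through [x], merging [v] lowers the bound by 4 pairs. The edge [x v] accounts for
    2; the other 2 come from slack in the bound or from a common neighbour inside the set, whose two
    edges are identified. *)
Lemma good_contract x v : e x v -> bl x -> bl v ->
  (forall k k', bl k -> bl k' -> k \in common x v e -> k' \in common x v e ->
      k = k') ->
  (#|common x v e| <= 2)%N ->
  (forall W, (forall v, v \in W -> bl v) -> (3 <= #|W|)%N -> x \in W -> v \in W ->
     (#|pairs e W| + 8 <= 4 * #|W|)%N \/ exists2 k, k \in W & k \in common x v e) ->
  good F bl e.
Proof.
move=> xv bx bv uniqb c2 unb; have [ge pe semi sp] := adm; have [se ie] := ge.
have ne i j : e i j -> i != j by apply: contraTneq => ->; rewrite ie.
apply: (good_split infF se bx bv (ne _ _ xv)).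
  have xvC : [set x; v] :&: common x v e = set0.
    apply/setP => u; rewrite !inE.
    by apply/negP => /andP[/orP[] /eqP ->]; rewrite ie ?andbF.
  have bC : (#|[set u in common x v e | bl u]| <= 1)%N.
    rewrite leqNgt; apply/negP => /card_gt1P[k [k' [+ + kk']]].
    rewrite !in_set -!(in_set (fun k => e x k && e v k)) => /andP[kc bk] /andP[k'c bk'].
    by rewrite (uniqb k k') ?eqxx in kk'.
  have rC : (#|[set u in [set x; v] :|: common x v e | ~~ bl u]| <=
      #|common x v e|)%N.
    apply: subset_leq_card; apply/subsetP => u; rewrite in_set in_setU.
    by case/andP => /orP[|//]; rewrite !inE => /orP[] /eqP ->; rewrite ?bx ?bv.
  rewrite /small (leq_trans rC) // andbT; apply/andP; split.
    by rewrite cardsU xvC cards0 subn0 cards2 (ne _ _ xv) (leq_add (leqnn 2)).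
  apply: (@leq_trans #|[set x; v] :|: [set u in common x v e | bl u]|).
    apply: subset_leq_card; apply/subsetP => u; rewrite !in_set.
    by case/andP => /orP[->//|->] ->; rewrite orbT.
  apply: leq_trans (leq_card_setU _ _) _.
  by rewrite cards2 (ne _ _ xv) (leq_add (leqnn 2)).
apply: IH; last first.
  apply: (@support_lt _ _ v).
  - move=> i j /and4P[_ _ _ /or3P[/supportP //|/andP[/eqP -> _]|/andP[_ /supportP //]]].
    exact: supportP xv.
  - by apply: (@supportP _ _ x); rewrite se.
  - by move=> j; rewrite /contract eqxx.
split.
- exact: graph_contract.
- exact: planar_contract.
- move=> i j /and4P[_ _ _ /or3P[/semi //|/andP[/eqP -> _]|/andP[/eqP -> _]]].
    by rewrite bx.
  by rewrite bx orbT.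
- have vb W : (forall i, i \in W -> bl i) -> forall i, i \in v |: W -> bl i.
    by move=> bW i; rewrite !inE => /orP[/eqP ->|/bW].
  have main W : v \notin W -> (forall i, i \in W -> bl i) -> (2 <= #|W|)%N ->
      (#|pairs (contract x v e) W| + 6 <= 4 * #|W|)%N.
    move=> vW bW W2; case xW : (x \in W); last first.
      apply: leq_trans (sp W bW W2); rewrite leq_add2r.
      apply: subset_leq_card; apply/subsetP => -[i j]; rewrite !inE /=.
      case/and3P => iW jW /and4P[_ _ _ /or3P[ij|/andP[/eqP ix _]|/andP[/eqP jx _]]].
      + by rewrite iW jW.
      + by rewrite -ix iW in xW.
      + by rewrite -jx jW in xW.
    have cW : #|v |: W| = #|W|.+1 by rewrite cardsU1 vW.
    have bvW := vb W bW; have vx : v != x by rewrite eq_sym ne.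
    have c3 : (3 <= #|v |: W|)%N by rewrite cW ltnS.
    have xvW : x \in v |: W by rewrite !inE xW orbT.
    have vvW : v \in v |: W by rewrite !inE eqxx.
    have [dense|[k kW]] := unb _ bvW c3 xvW vvW.
      pose Z := [set (x, v); (v, x)].
      have := @contract_pairs_sub _ x v e Z W ge vW; rewrite xW mul0n addn0.
      have -> : #|Z :&: pairs e (v |: W)| = 2%N.
        rewrite (setIidPl _); first by rewrite cards2 xpair_eqE negb_and vx orbT.
        apply/subsetP => p; rewrite !inE => /orP[] /eqP -> /=;
          by rewrite eqxx xW ?orbT ?xv // se xv.
      move=> H; suff : (#|pairs (contract x v e) W| + 2 <= #|pairs e (v |: W)|)%N.
        move: dense; rewrite cW.
        move: #|pairs e _| #|pairs _ W| #|W| => p q r; clear; lia.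
      apply: H => p; rewrite !inE => /orP[] /eqP -> /=; rewrite ?eqxx ?orbT //.
      by move=> xv'; rewrite xv' eqxx in vx.
    rewrite inE => /andP[xk vk].
    have kx : k != x by rewrite eq_sym ne.
    have kv : k != v by rewrite eq_sym ne.
    have {}kW : k \in W by move: kW; rewrite !inE (negbTE kv).
    pose Z := [set (x, v); (v, x)] :|: [set (k, v); (v, k)].
    have := @contract_pairs_sub _ x v e Z W ge vW; rewrite xW mul0n addn0.
    have -> : #|Z :&: pairs e (v |: W)| = 4%N.
      rewrite (setIidPl _).
        rewrite cardsU !cards2 !xpair_eqE !negb_and vx kv !orbT /=.
        rewrite (eqP (_ : #|_ :&: _| == 0%N)) // cards_eq0 setI_eq0.
        rewrite disjoints_subset; apply/subsetP => p; rewrite !inE.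
        move=> /orP[] /eqP ->; rewrite !xpair_eqE !negb_or !negb_and;
          by rewrite ?[x == k]eq_sym ?kx ?vx ?kv ?[x == v]eq_sym ?vx ?[v == k]eq_sym ?kv ?orbT.
      apply/subsetP => p; rewrite !inE => /orP[] /orP[] /eqP -> /=;
        by rewrite eqxx ?xW ?kW ?orbT ?xv ?vk // se ?xv ?vk.
    move=> H; suff : (#|pairs (contract x v e) W| + 4 <= #|pairs e (v |: W)|)%N.
      have := sp _ bvW (ltnW c3); rewrite cW.
      move: #|pairs e _| #|pairs _ W| #|W| => p q r; clear; lia.
    apply: H => p; rewrite !inE => /orP[] /orP[] /eqP -> /=; rewrite ?eqxx ?orbT //;
      by [move=> xv'; rewrite xv' eqxx in vx|move=> kv'; rewrite kv' eqxx in kv|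
          rewrite ?[e k x]se xk].
  move=> W bW W2; case vW : (v \in W); last by apply: main; rewrite ?vW.
  have pE : pairs (contract x v e) W = pairs (contract x v e) (W :\ v).
    apply/setP => p; rewrite !inE /contract.
    by case: (p.1 == v); case: (p.2 == v); rewrite /= ?andbF.
  have cW : #|W| = #|W :\ v|.+1 by rewrite (cardsD1 v W) vW.
  have [W1|W1] := leqP 2 #|W :\ v|.
    have h : (#|pairs (contract x v e) (W :\ v)| + 6 <= 4 * #|W :\ v|)%N.
      by apply: main => //; rewrite ?inE ?eqxx // => i; rewrite inE => /andP[_ /bW].
    by rewrite pE cW; move: h; lia.
  rewrite pE; suff -> : pairs (contract x v e) (W :\ v) = set0 by rewrite cards0; lia.
  have /cards1P[w wE] : #|W :\ v| == 1%N by move: W1 W2; rewrite cW; lia.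
  rewrite wE; apply/setP => -[i j]; rewrite !inE /=.
  apply/negP => /and3P[/eqP -> /eqP ->].
  by rewrite /contract eqxx !andbF.
Qed.

Lemma good_blue_edge a b : e a b -> bl a -> bl b -> good F bl e.
Proof.
move=> ab ba bb; have [ge pe semi sp] := adm.
have [|x [v [xv bx bv uniqb unb]]] := unblocked_edge ge sp ab ba bb.
  by move=> W _ W3; exact: dense_triangle_free.
have [c2|] := leqP #|common x v e| 2; first exact: good_contract uniqb c2 unb.
move=> c3; have inc (i : 'I_3) : enum_val (widen_ord c3 i) \in common x v e.
  exact: enum_valP.
apply: (@good_clique_cut x v (fun i => enum_val (widen_ord c3 i))) => //.
- by move=> i j /enum_val_inj /(congr1 val) /= /val_inj.
- by move=> i; have := inc i; rewrite inE => /andP[].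
- by move=> i; have := inc i; rewrite inE => /andP[].
Qed.

End Step.

(* Induction on the number of non-isolated vertices.  If there is a blue edge, a
   blue edge is contracted, or the graph is cut along a clique.  Otherwise a
   vertex of degree one is removed or, at a corner y - r - u of a face with r
   red, the blue edge uy is added, which keeps the graph planar. *)
Theorem admissible_good e : admissible e -> good F bl e.
Proof.
have [m] := ubnP #|support_of e|; elim: m e => // m IHm e; rewrite ltnS => em adm.
have [ge pe semi sp] := adm; have [se ie] := ge.
have IH e1 : (#|support_of e1| <= #|support_of e|)%N ->
    forall e', admissible e' -> (#|support_of e'| < #|support_of e1|)%N ->
    good F bl e'.
  move=> e1e e' adm' lt; apply: IHm adm'.
  exact: leq_trans (leq_trans lt e1e) em.
have ne i j : e i j -> i != j by apply: contraTneq => ->; rewrite ie.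
case: (pickP [pred p : 'I_n * 'I_n | [&& e p.1 p.2, bl p.1 & bl p.2]]).
  case=> a b /= /and3P[ab ba bb].
  exact: good_blue_edge adm (IH e (leqnn _)) _ _ ab ba bb.
move=> nobb; have nbb i j : e i j -> bl i -> bl j -> False.
  by move=> ij bi bj; have := nobb (i, j); rewrite /= ij bi bj.
case: (pickP [pred p : 'I_n * 'I_n | e p.1 p.2]); last first.
  by move=> noe; apply: good_empty infF _ _ _ => i j; have /= -> := noe (i, j).
case=> a b /= ab.
case: (pickP [pred p : 'I_n * 'I_n | e p.1 p.2 && [forall j, e p.1 j ==> (j == p.2)]]).
  case=> v w /= /andP[vw /forallP leaf].
  apply: (@good_leaf _ _ infF _ e v w) => //.
    by move=> j vj; apply/eqP; have := leaf j; rewrite vj.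
  apply: (IH e (leqnn _)).
    apply: (admissible_sub adm); last by move=> i j /and3P[].
    split=> [i j|i]; rewrite /del_vertex ?ie ?andbF // se.
    by rewrite andbCA.
  apply: (@support_lt _ _ v).
  - by move=> i j /and3P[_ _ /supportP].
  - exact: supportP vw.
  - by move=> j; rewrite /del_vertex eqxx.
move=> noleaf.
(* Without leaves every vertex of the support has degree at least 2, too much for a forest. *)
have [z [cz z0]] : exists z, cycle_on e z /\ z != 0.
  apply: contrapT => noz.
  have := @planar_forest _ e (support_of e) a ge pe (supportP ab).
  move=> /(_ (fun i j => @supportP e i j)) H.
  suff : (#|pairs e (support_of e)| + 2 <= #|support_of e|.*2)%N -> False.
    by apply; apply: H => z cz; apply/eqP/contraT => z0; case: noz; exists z.
  suff : (#|support_of e|.*2 <= #|pairs e (support_of e)|)%N by lia.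
  have -> : #|pairs e (support_of e)| = (\sum_(i in support_of e) #|[set j | e i j]|)%N.
    rewrite -sum1dep_card (eq_bigl (fun p => (p.1 \in support_of e) && e p.1 p.2)).
      rewrite -(pair_big_dep (fun i => i \in support_of e) (fun i j => e i j) (fun _ _ => 1%N)) /=.
      by apply: eq_bigr => i _; rewrite sum1dep_card.
    case=> i j /=; case ij : (e i j); last by rewrite !andbF.
    by rewrite (supportP ij) (@supportP e j i) // se.
  rewrite -muln2 -sum_nat_const; apply: leq_sum => i; rewrite inE => /existsP[j ij].
  have := noleaf (i, j); rewrite /= ij /= => /negbT/forallPn[k].
  rewrite negb_imply => /andP[ik kj].
  apply/card_gt1P; exists j, k; split; rewrite ?inE // eq_sym.
  by [].
have [u [r [zur bu br]]] : exists u r, [/\ z (u, r), bl u & ~~ bl r].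
  have [u [r zur]] := cycle_edge z0; have [z1 z2 _] := cz.
  have := semi _ _ (z2 _ _ zur); case bu : (bl u).
    move=> _; exists u, r; split=> //; apply/negP => br.
    exact: nbb (z2 _ _ zur) bu br.
  by move=> /= br; exists r, u; split; rewrite ?bu // z1.
have [y [yu ry chord]] := planar_chord ge pe cz zur.
have by' : bl y by have := semi _ _ ry; rewrite (negbTE br).
have nuy : ~~ e u y by apply/negP => uy; exact: nbb uy bu by'.
have ur : e u r by have [_ z2 _] := cz; exact: z2.
pose e1 := add_edge u y e.
have adm1 : admissible e1.
  split.
  - split=> [i j|i]; rewrite /e1 /add_edge.
      by rewrite se [X in _ || X]orbC ![(i == _) && _]andbC.
    rewrite ie /=; apply/negP => /orP[] /andP[/eqP h1 /eqP h2];
      by rewrite -h1 -h2 eqxx in yu.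
  - exact: chord.
  - move=> i j /orP[/semi //|/orP[] /andP[/eqP -> _]]; first by rewrite bu.
    by rewrite by'.
  (* The chord is the only blue edge, and [2 + 6 <= 4 * #|W|]. *)
  - move=> W bW W2; suff : (#|pairs e1 W| <= 2)%N.
      move: #|pairs e1 W| #|W| W2 => p q; clear; lia.
    apply: (@leq_trans #|[set (u, y); (y, u)]|); last first.
      by rewrite cards2; case: eqP.
    apply: subset_leq_card; apply/subsetP => -[i j].
    rewrite !inE /= !xpair_eqE => /and3P[iW jW /orP[ij|//]].
    by case: (nbb _ _ ij); apply: bW.
(* The blue-edge step is applied to [e1] with an induction hypothesis about [e], so the chord must
   not enlarge the support. *)
have sup1 : (#|support_of e1| <= #|support_of e|)%N.
  apply: subset_leq_card; apply/subsetP => i; rewrite inE => /existsP[j].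
  move=> /orP[/supportP //|/orP[] /andP[/eqP -> _]]; first exact: supportP ur.
  by apply: (@supportP _ _ r); rewrite se.
apply: (@good_sub e1); first by move=> i j; rewrite /e1 /add_edge => ->.
apply: (good_blue_edge adm1 (IH e1 sup1) (a := u) (b := y)) => //.
by rewrite /e1 /add_edge !eqxx orbT.
Qed.

End Main.

(** * From stresses to the Stanley-Reisner ring *)

Section Ideal.
Variables (A : comNzRingType) (S : set A).

Lemma ideal_gen_mem q : S q -> ideal_gen S q.
Proof.
move=> Sq; exists [:: (1, q)]; last by rewrite big_seq1 mul1r.
by move=> p; rewrite inE => /eqP ->.
Qed.

Lemma ideal_gen0 : ideal_gen S 0.
Proof. by exists [::] => //; rewrite big_nil. Qed.

Lemma ideal_genD p q : ideal_gen S p -> ideal_gen S q -> ideal_gen S (p + q).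
Proof.
move=> [s Ss ->] [t St ->]; exists (s ++ t); last by rewrite big_cat.
by move=> x; rewrite mem_cat => /orP[/Ss|/St].
Qed.

Lemma ideal_genM p q : ideal_gen S q -> ideal_gen S (p * q).
Proof.
move=> [s Ss ->]; exists [seq (p * x.1, x.2) | x <- s].
  by move=> _ /mapP[x xs ->] /=; apply: Ss.
by rewrite big_map big_distrr; apply: eq_bigr => x _ /=; rewrite mulrA.
Qed.

Lemma ideal_gen_sum (I : Type) (r : seq I) (P : pred I) (f : I -> A) :
  (forall i, P i -> ideal_gen S (f i)) -> ideal_gen S (\sum_(i <- r | P i) f i).
Proof.
by move=> h; elim/big_rec: _ => [|i x Pi]; [exact: ideal_gen0|apply/ideal_genD/h].
Qed.
End Ideal.

(** Dual of independence: the map sending [L] to its defects is injective, so its transpose is onto.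
    The three summands are the transposes of equilibrium, symmetry and vanishing off the edges. *)
Lemma independent_span (F : fieldType) (n : nat) (e : rel 'I_n)
    (P : 'M[F]_(n, 4)) : independent e P -> forall M : 'M[F]_n,
  exists (B : 'M[F]_(n, 4)) (C D : 'M[F]_n),
    (forall i j, (i == j) || e i j -> D i j = 0) /\ M = B *m P^T + (C - C^T) + D.
Proof.
move=> ind M.
pose f (L : 'M[F]_n) : 'M[F]_(n, 4 + (n + n)) :=
  row_mx (L *m P) (row_mx (L - L^T)
    (\matrix_(i, j) if (i != j) && ~~ e i j then L i j else 0)).
have lf : linear f.
  move=> a x y; rewrite /f scale_row_mx add_row_mx; congr row_mx.
    by rewrite mulmxDl scalemxAl.
  rewrite scale_row_mx add_row_mx; congr row_mx.
    rewrite linearD linearZ /=.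
    by rewrite scalerBr opprD addrACA.
  by apply/matrixP => i j; rewrite !mxE; case: ifP; rewrite ?mulr0 ?addr0.
pose f' : {linear 'M[F]_n -> 'M[F]_(n, 4 + (n + n))} :=
  HB.pack f (GRing.isLinear.Build _ _ _ _ f lf).
have fE x : mxvec x *m lin_mx f' = mxvec (f x) by exact: (mul_vec_lin f').
have Af : row_free (lin_mx f').
  rewrite -kermx_eq0 -submx0; apply/rV_subP => v.
  move/sub_kermxP; rewrite -[v]vec_mxK fE => /eqP; rewrite mxvec_eq0 => /eqP.
  move/eqP; rewrite !row_mx_eq0 => /and3P[/eqP h1 /eqP/subr0_eq h2 /eqP h3].
  rewrite (ind (vec_mx v)) ?linear0 ?sub0mx //; split=> // i j ij nij.
  by move/matrixP/(_ i j): h3; rewrite !mxE ij nij.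
have [G AG] := row_freeP Af.
pose Y := vec_mx (mxvec M *m G^T) : 'M[F]_(n, 4 + (n + n)).
(* Entry [i j] of [M] is the pairing of the preimage [Y] with the defects of a matrix unit. *)
have ME i j : M i j = \sum_a \sum_b Y a b * f (delta_mx i j) a b.
  have -> : M i j = (mxvec Y *m (lin_mx f')^T) 0 (mxvec_index i j).
    by rewrite /Y vec_mxK -mulmxA -trmx_mul AG trmx1 mulmx1 mxvecE.
  rewrite mxE (reindex _ (curry_mxvec_bij _ _)) /= pair_big /=.
  apply: eq_bigr => -[a b] _; rewrite /= mxvecE; congr (_ * _).
  by rewrite -[RHS]mxvecE -fE mxvec_delta -rowE !mxE.
clearbody Y; pose B := lsubmx Y; pose C := lsubmx (rsubmx Y); pose D' := rsubmx (rsubmx Y).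
pose D : 'M[F]_n := \matrix_(i, j) if (i != j) && ~~ e i j then D' i j else 0.
exists B, C, D; split.
  by move=> i j; rewrite mxE -negb_or => ->.
have pick (X : 'M[F]_n) i j :
    \sum_a \sum_b X a b * (delta_mx i j : 'M[F]_n) a b = X i j.
  rewrite (bigD1 i) //= [X in _ + X]big1 ?addr0; last first.
    by move=> a ai; rewrite big1 // => b _; rewrite mxE (negbTE ai) mulr0.
  rewrite (bigD1 j) //= big1 ?addr0 ?mxE ?eqxx ?mulr1 // => b bj.
  by rewrite mxE (negbTE bj) andbF mulr0.
apply/matrixP => i j; rewrite ME.
have -> : (B *m P^T + (C - C^T) + D) i j =
    (B *m P^T) i j + (C i j - C j i + D i j).
  have aE (X Z : 'M[F]_n) : (X + Z) i j = X i j + Z i j by rewrite mxE.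
  have sE (X : 'M[F]_n) : (X - X^T) i j = X i j - X j i by rewrite !mxE.
  by rewrite -sE -addrA !aE.
under eq_bigr => a _ do rewrite big_split_ord big_split_ord /=.
rewrite !big_split /=; congr (_ + (_ + _)).
- rewrite [RHS]mxE (bigD1 i) //= addrC big1 ?add0r; last first.
    move=> a ai; rewrite big1 // => b _; rewrite row_mxEl [X in _ * X]mxE big1 ?mulr0 //.
    by move=> k _; rewrite mxE (negbTE ai) mul0r.
  apply: eq_bigr => b _; rewrite row_mxEl !mxE; congr (_ * _).
  rewrite (bigD1 j) //= big1 ?addr0 ?mxE ?eqxx ?mul1r // => k kj.
  by rewrite mxE (negbTE kj) andbF mul0r.
- have -> : C i j - C j i = \sum_a \sum_b (C a b * (delta_mx i j : 'M[F]_n) a b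
      - C a b * (delta_mx j i : 'M[F]_n) a b).
    under eq_bigr => a _ do rewrite big_split sumrN /=.
    by rewrite big_split sumrN /= !pick.
  apply: eq_bigr => a _; apply: eq_bigr => b _.
  rewrite row_mxEr row_mxEl -mulrBr; congr (_ * _); first by rewrite !mxE.
  by rewrite !mxE [(b == i) && _]andbC.
- have -> : D i j = \sum_a \sum_b D a b * (delta_mx i j : 'M[F]_n) a b.
    by rewrite pick.
  apply: eq_bigr => a _; apply: eq_bigr => b _.
  rewrite !row_mxEr !mxE.
  by case: ifP => _; rewrite ?mulr0 ?mul0r.
Qed.

Section Translate.
Variables (F : fieldType) (V : finType) (D : {set {set V}}) (c : V -> color).

Definition skeleton_rel : rel 'I_#|V| := fun i j =>
  (i != j) && ([set enum_val i; enum_val j]%SET \in D).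

Definition is_blue (v : V) := if c v is Blue then true else false.

(* By duality, the absence of stresses says that the degree-2 part vanishes. *)
Lemma good_colored_SLP :
  good F (fun i => is_blue (enum_val i)) skeleton_rel -> colored_SLP F D c.
Proof.
case=> P cP indP.
pose th (k : 'I_4) := linear_form (fun v : V => P (enum_rank v) k).
have thE k : th k = \sum_i P i k *: mpolyX F (mnm1 i).
  rewrite /th /linear_form (reindex (fun i : 'I_#|V| => enum_val i)) /=; last first.
    by exists enum_rank => i _; rewrite ?enum_valK ?enum_rankK.
  by apply: eq_bigr => i _; rewrite /varV enum_valK.
exists (th 0), (th 1), (th 2%:R), (fun v : V => P (enum_rank v) 3%:R); split.
- exists (fun v : V => P (enum_rank v) 0) => // v cv; apply: cP.
  by rewrite /is_blue enum_rankK; case: (c v) cv.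
- exists (fun v : V => P (enum_rank v) 1) => // v cv; apply: cP.
  by rewrite /is_blue enum_rankK; case: (c v) cv.
- exists (fun v : V => P (enum_rank v) 2%:R) => // v cv; apply: cP.
  by rewrite /is_blue enum_rankK; case: (c v) cv.
rewrite /sr_quotient_part_eq0; set S := (X in ideal_gen X).
have Sth k : S (th k).
  right; case: k => -[|[|[|[|//]]]] k4; rewrite /=.
  - by do 3 left; congr th; apply: val_inj.
  - by do 2 left; right; congr th; apply: val_inj.
  - by left; right; congr th; apply: val_inj.
  - by right; congr linear_form; apply/funext => v; congr (P _ _); apply: val_inj.
have ID := @ideal_genD _ S; have IM := @ideal_genM _ S.
have IZ (a : F) q : ideal_gen S q -> ideal_gen S (a *: q).
  by move=> Iq; rewrite -mul_mpolyC; apply: IM.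
have Iedge i j : i != j -> ~~ skeleton_rel i j ->
    ideal_gen S (mpolyX F (mnm1 i) * mpolyX F (mnm1 j)).
  move=> ij; rewrite /skeleton_rel ij /= => nD; apply: ideal_gen_mem; left.
  apply: ideal_gen_mem; exists [set enum_val i; enum_val j]%SET => //.
  rewrite big_setU1 ?big_set1 /= /varV ?enum_valK // inE.
  by rewrite (inj_eq enum_val_inj).
have IX i j : ideal_gen S (mpolyX F (mnm1 i) * mpolyX F (mnm1 j)).
  (* Read as a quadratic form in the variables, [B *m P^T] gives multiples of the four linear forms,
     [C - C^T] gives 0 by commutativity, and [E] only involves monomials of non-edges. *)
  have [B [C [E [E0 M]]]] := independent_span indP (delta_mx i j).
  pose q (M : 'M[F]_#|V|) :=
    \sum_k \sum_l M k l *: (mpolyX F (mnm1 k) * mpolyX F (mnm1 l)).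
  have qD M1 M2 : q (M1 + M2) = q M1 + q M2.
    rewrite -big_split; apply: eq_bigr => k _ /=; rewrite -big_split.
    by apply: eq_bigr => l _; rewrite /= mxE scalerDl.
  have -> : mpolyX F (mnm1 i) * mpolyX F (mnm1 j) = q (delta_mx i j).
    rewrite /q (bigD1 i) //= [X in _ + X]big1 ?addr0; last first.
      by move=> k ki; rewrite big1 // => l _; rewrite mxE (negbTE ki) scale0r.
    rewrite (bigD1 j) //= big1 ?addr0 ?mxE ?eqxx ?scale1r // => l lj.
    by rewrite mxE (negbTE lj) andbF scale0r.
  rewrite M qD qD; apply: (ID); first apply: (ID).
  - have -> : q (B *m P^T) = \sum_k (\sum_i B i k *: mpolyX F (mnm1 i)) * th k.
      rewrite /q.
      transitivity (\sum_k \sum_l \sum_h (B k h *: mpolyX F (mnm1 k)) *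
                      (P l h *: mpolyX F (mnm1 l))).
        apply: eq_bigr => k _; apply: eq_bigr => l _; rewrite mxE scaler_suml.
        by apply: eq_bigr => h _; rewrite mxE -scalerAl -scalerAr scalerA.
      under eq_bigr => k _ do rewrite exchange_big /=.
      rewrite exchange_big; apply: eq_bigr => h _ /=.
      rewrite big_distrl; apply: eq_bigr => k _ /=.
      by rewrite thE big_distrr.
    by apply: ideal_gen_sum => k _; apply: IM; apply: ideal_gen_mem.
  - suff -> : q (C - C^T) = 0 by exact: ideal_gen0.
    rewrite /q.
    under eq_bigr => k _ do under eq_bigr => l _ do
      rewrite mxE scalerDl.
    under eq_bigr => k _ do rewrite big_split /=.
    rewrite big_split /= [X in _ + X]exchange_big -big_split /=.
    rewrite big1 // => k _; rewrite -big_split big1 //= => l _.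
    by rewrite !mxE [X in _ + _ *: X]mulrC scaleNr subrr.
  - apply: ideal_gen_sum => k _; apply: ideal_gen_sum => l _.
    case kl : ((k == l) || skeleton_rel k l).
      by rewrite E0 // scale0r; exact: ideal_gen0.
    by move/negbT: kl; rewrite negb_or => /andP[kl nkl]; apply/IZ/Iedge.
move=> p /=; rewrite dhomogE => /allP hp; rewrite (mpolyE p) big_seq.
apply: ideal_gen_sum => m /hp /= /eqP m2; apply: IZ.
have [i mi] : exists i, m i != 0%N.
  apply: contrapT => h; move: m2; rewrite mdegE big1 // => i _.
  by apply/eqP/negPn/negP => mi; apply: h; exists i.
have mE : mnm_add (mnm_sub m (mnm1 i)) (mnm1 i) = m by apply: submK; rewrite lep1mP.
have : mdeg (mnm_sub m (mnm1 i)) == 1%N.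
  by move: m2; rewrite -{1}mE mdegD mdeg1 addn1 => -[->].
move=> /mdeg1P[j /eqP mj]; rewrite -mE mpolyXD mj; exact: IX.
Qed.

End Translate.

(** * Drawings of K33 and sums over a grid *)

(** Linear duality over the field with two elements: a vector outside a span is detected by a
    functional vanishing on the span. *)
Lemma bool_span (I X : finType) (f : I -> {ffun X -> bool}) (z : {ffun X -> bool}) :
  (forall phi : X -> bool, (forall i, \sum_x f i x * phi x = 0) ->
     \sum_x z x * phi x = 0) ->
  exists J : {set I}, z = \sum_(i in J) f i.
Proof.
move=> h.
pose A : 'M[bool]_(#|I|, #|X|) := \matrix_(i, x) f (enum_val i) (enum_val x).
pose zr : 'rV[bool]_#|X| := \row_x z (enum_val x).
have sumE (y : X -> bool) (phi : 'I_#|X| -> bool) :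
    \sum_(x < #|X|) y (enum_val x) * phi x = \sum_x y x * phi (enum_rank x).
  rewrite [RHS](reindex (fun x : 'I_#|X| => enum_val x)) /=; last first.
    by exists enum_rank => x _; rewrite ?enum_valK ?enum_rankK.
  by apply: eq_bigr => x _; rewrite enum_valK.
have : (zr <= A)%MS.
  rewrite submxE; apply/eqP/rowP => j; rewrite !mxE.
  under eq_bigr => x _ do rewrite mxE.
  rewrite (sumE z (fun x => cokermx A x j)); apply: h => i.
  transitivity ((A *m cokermx A) (enum_rank i) j); last by rewrite mulmx_coker mxE.
  rewrite mxE -(sumE (f i) (fun x => cokermx A x j)).
  by apply: eq_bigr => x _; rewrite [A _ _]mxE enum_rankK.
case/submxP => C zC; exists [set i | C 0 (enum_rank i)].
apply/ffunP => x; rewrite sum_ffunE.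
have := congr1 (fun M : 'rV[bool]_#|X| => M 0 (enum_rank x)) zC.
rewrite !mxE enum_rankK => ->.
rewrite [RHS]big_mkcond /= (reindex (fun i : I => enum_rank i)) /=; last first.
  by exists enum_val => i _; rewrite ?enum_valK ?enum_rankK.
apply: eq_bigr => i _; rewrite mxE !enum_rankK inE.
by case: (C 0 _); rewrite ?mul1r ?mul0r.
Qed.

(** Stokes modulo 2: adding the relation around every cell, the interior sides cancel and the
    boundary remains. *)
Lemma grid_stokes (T : Type) (k : T -> T -> bool) (l : nat -> nat -> T) (m : nat) :
  (forall i j, (i < m)%N -> (j < m)%N ->
    k (l i j) (l i j.+1) + k (l i.+1 j) (l i.+1 j.+1) =
    k (l i j) (l i.+1 j) + k (l i j.+1) (l i.+1 j.+1)) ->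
  \sum_(0 <= j < m) k (l 0%N j) (l 0%N j.+1) +
  \sum_(0 <= j < m) k (l m j) (l m j.+1) =
  \sum_(0 <= i < m) k (l i 0%N) (l i.+1 0%N) +
  \sum_(0 <= i < m) k (l i m) (l i.+1 m).
Proof.
move=> h.
pose row i := \sum_(0 <= j < m) k (l i j) (l i j.+1).
have step i : (i < m)%N -> row i + row i.+1 =
    k (l i 0%N) (l i.+1 0%N) + k (l i m) (l i.+1 m).
  move=> im; rewrite -big_split /=.
  have H p : (p <= m)%N -> \sum_(0 <= j < p)
      (k (l i j) (l i j.+1) + k (l i.+1 j) (l i.+1 j.+1)) =
      k (l i 0%N) (l i.+1 0%N) + k (l i p) (l i.+1 p).
    elim: p => [|p IHp] pm; first by rewrite big_geq // addbb0.
    rewrite big_nat_recr //= IHp ?(ltnW pm) // h //.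
    by case: (k (l i 0%N) _); case: (k (l i p) _); case: (k (l i p.+1) _).
  exact: H.
suff H p : (p <= m)%N -> row 0%N + row p =
    \sum_(0 <= i < p) k (l i 0%N) (l i.+1 0%N) +
    \sum_(0 <= i < p) k (l i m) (l i.+1 m) by exact: H.
elim: p => [|p IHp] pm; first by rewrite !big_geq // addbb0.
rewrite !big_nat_recr //= addrACA -IHp ?(ltnW pm) // -step //.
by case: (row 0%N); case: (row p); case: (row p.+1).
Qed.

Lemma telescope_bool (a : nat -> bool) m :
  \sum_(0 <= i < m) (a i + a i.+1) = a 0%N + a m.
Proof.
elim: m => [|m IHm]; first by rewrite big_geq // addbb0.
by rewrite big_nat_recr //= IHm; case: (a 0%N); case: (a m); case: (a m.+1).
Qed.

(** * Crossing parity and the mod 2 obstruction to drawing K33 *)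

Section Parity.
Variable R : realFieldType.
Implicit Types p q r s : R * R.

(** The vertical line through [p] separates [q] from [r]. Written as an exclusive or, this
    telescopes along a polygonal path. *)
Definition between p q r := (q.1 < p.1) (+) (r.1 < p.1).

Definition height q r (x : R) := q.2 + (r.2 - q.2) * ((x - q.1) / (r.1 - q.1)).

Definition below p q r := between p q r && (p.2 < height q r p.1).

Definition above p q r := between p q r && (height q r p.1 < p.2).

Definition on_segment p q r := exists2 t : R, 0 <= t <= 1 &
  p = ((1 - t) * q.1 + t * r.1, (1 - t) * q.2 + t * r.2).

Definition disjoint_segments p q r s :=
  forall o, on_segment o p q -> on_segment o r s -> False.

Lemma on_segmentC p q r : on_segment p q r -> on_segment p r q.
Proof.
case=> t /andP[t0 t1] ->; exists (1 - t); first by apply/andP; split; lra.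
by congr (_, _); ring.
Qed.

Lemma betweenC p q r : between p q r = between p r q.
Proof. by rewrite /between addbC. Qed.

Lemma heightC q r x : q.1 != r.1 -> height q r x = height r q x.
Proof.
move=> qr; rewrite /height.
have h1 : r.1 - q.1 != 0 by rewrite subr_eq0 eq_sym.
have h2 : q.1 - r.1 != 0 by rewrite subr_eq0.
by field; apply/andP.
Qed.

Lemma between_ne p q r : between p q r -> q.1 != r.1.
Proof. by apply: contraTneq; rewrite /between => ->; rewrite addbb. Qed.

Lemma belowC p q r : below p q r = below p r q.
Proof.
rewrite /below betweenC; case b : (between p r q) => //=.
by rewrite heightC // eq_sym (between_ne b).
Qed.

Lemma aboveC p q r : above p q r = above p r q.
Proof.
rewrite /above betweenC; case b : (between p r q) => //=.
by rewrite heightC // eq_sym (between_ne b).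
Qed.

Lemma on_height q r x : q.1 < r.1 -> q.1 <= x <= r.1 ->
  on_segment (x, height q r x) q r.
Proof.
move=> qr /andP[qx xr]; have d0 : 0 < r.1 - q.1 by rewrite subr_gt0.
exists ((x - q.1) / (r.1 - q.1)).
  by rewrite divr_ge0 ?ler_pdivrMr ?mul1r ?subr_ge0 // ?lerD2r // ltW.
by congr (_, _); rewrite /height; field; rewrite gt_eqF.
Qed.

(* Two graphs of affine functions that change order cross in between. *)
Lemma heights_cross p q r s x1 x2 : p.1 < q.1 -> r.1 < s.1 ->
  p.1 <= x1 <= q.1 -> r.1 <= x1 <= s.1 -> p.1 <= x2 <= q.1 -> r.1 <= x2 <= s.1 ->
  height p q x1 <= height r s x1 -> height r s x2 <= height p q x2 ->
  disjoint_segments p q r s -> False.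
Proof.
move=> pq rs p1 r1 p2 r2 h1 h2 dis.
have d0 : q.1 - p.1 != 0 by rewrite subr_eq0 gt_eqF.
have d1 : s.1 - r.1 != 0 by rewrite subr_eq0 gt_eqF.
pose D x := height r s x - height p q x.
have Daff t : D ((1 - t) * x1 + t * x2) = (1 - t) * D x1 + t * D x2.
  by rewrite /D /height; field; apply/andP.
suff [t t01 Dt] : exists2 t, 0 <= t <= 1 & D ((1 - t) * x1 + t * x2) = 0.
  pose x := (1 - t) * x1 + t * x2.
  have bnd a b : a <= x1 <= b -> a <= x2 <= b -> a <= x <= b.
    move=> /andP[? ?] /andP[? ?]; case/andP: t01 => ? ?.
    by rewrite /x; apply/andP; split; nra.
  apply: (dis (x, height p q x)); first by apply: on_height => //; exact: bnd.
  have -> : height p q x = height r s x by apply/esym/eqP; rewrite -subr_eq0 -/(D x) Dt.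
  by apply: on_height => //; exact: bnd.
have D1 : 0 <= D x1 by rewrite subr_ge0.
have D2 : D x2 <= 0 by rewrite subr_le0.
case: (eqVneq (D x1) (D x2)) => [D12|D12].
  by exists 0; rewrite ?lexx ?ler01 // Daff; lra.
have D0 : 0 < D x1 - D x2.
  by rewrite subr_gt0 lt_neqAle eq_sym D12 (le_trans D2 D1).
exists (D x1 / (D x1 - D x2)).
  by rewrite divr_ge0 ?(ltW D0) //= ler_pdivrMr // mul1r; lra.
by rewrite Daff; field; rewrite gt_eqF.
Qed.

Lemma height_left q r : height q r q.1 = q.2.
Proof. by rewrite /height subrr mul0r mulr0 addr0. Qed.

Lemma height_right q r : q.1 != r.1 -> height q r r.1 = r.2.
Proof.
move=> qr; rewrite /height divff ?mulr1; first by rewrite addrC subrK.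
by rewrite subr_eq0 eq_sym.
Qed.

(* Modulo 2, the number of crossings of two segments is a coboundary. *)
Lemma segment_parity p q r s :
  (p.1 = q.1 -> p = q) -> (r.1 = s.1 -> r = s) ->
  p.1 != r.1 -> p.1 != s.1 -> q.1 != r.1 -> q.1 != s.1 ->
  disjoint_segments p q r s ->
  (below p r s + below q r s) + (above r p q + above s p q) = 0.
Proof.
move=> ipq irs.
case: (eqVneq p.1 q.1) => [/ipq <- _ _ _ _ _|pq].
  by rewrite addbb0 /above /between !addbb.
case: (eqVneq r.1 s.1) => [/irs <- _ _ _ _ _|rs].
  by rewrite addbb0 /below /between !addbb.
wlog lpq : p q pq {ipq} / p.1 < q.1.
  move=> H pr ps qr qs dis; case: (ltgtP p.1 q.1) pq => // lt pq.
    by apply: H => //; rewrite lt_eqF.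
  rewrite ![above _ p q]aboveC [below p r s + _]addrC; apply: H => //.
    by rewrite lt_eqF.
  by move=> o /on_segmentC; exact: dis.
wlog lrs : r s rs {irs} / r.1 < s.1.
  move=> H pr ps qr qs dis; case: (ltgtP r.1 s.1) rs => // lt rs.
    by apply: H => //; rewrite lt_eqF.
  rewrite ![below _ r s]belowC [above r p q + _]addrC; apply: H => //.
    by rewrite lt_eqF.
  by move=> o op /on_segmentC; exact: dis op.
move=> pr ps qr qs dis.
have cross1 x1 x2 := @heights_cross p q r s x1 x2 lpq lrs.
have hp := height_left p q; have hq := height_right pq.
have hr := height_left r s; have hs := height_right rs.
have bnd x a b : a < x -> x < b -> a <= x <= b by move=> /ltW -> /ltW ->.
have bl a b : a < b -> a <= a <= b by move=> /ltW ->; rewrite lexx.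
have br a b : a < b -> a <= b <= b by move=> /ltW ->; rewrite lexx.
rewrite /below /above /between.
(* In each of the four overlapping orders of the abscissae, the two surviving terms compare heights
   at the ends of the common range; a disagreement would be a crossing. *)
case: (ltgtP p.1 r.1) pr => // pr _; case: (ltgtP q.1 r.1) qr => // qr _;
case: (ltgtP p.1 s.1) ps => // ps _; case: (ltgtP q.1 s.1) qs => // qs _ //=;
try (by exfalso; lra).
- case: ltP => c1; case: ltP => c2 //; exfalso.
    by apply: (cross1 q.1 r.1); rewrite ?br ?bl ?bnd ?hr ?hq ?(ltW c1).
  by apply: (cross1 r.1 q.1); rewrite ?br ?bl ?bnd ?hr ?hq ?(ltW c2).
- case: ltP => c1; case: ltP => c2 //; exfalso.
    by apply: (cross1 r.1 s.1); rewrite ?br ?bl ?bnd ?hr ?hs ?(ltW c1).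
  by apply: (cross1 s.1 r.1); rewrite ?br ?bl ?bnd ?hr ?hs ?(ltW c2).
- case: ltP => c1; case: ltP => c2 //; exfalso.
    by apply: (cross1 p.1 q.1); rewrite ?br ?bl ?bnd ?hp ?hq ?(ltW c1).
  by apply: (cross1 q.1 p.1); rewrite ?br ?bl ?bnd ?hp ?hq ?(ltW c2).
- case: ltP => c1; case: ltP => c2 //; exfalso.
    by apply: (cross1 p.1 s.1); rewrite ?br ?bl ?bnd ?hp ?hs ?(ltW c1).
  by apply: (cross1 s.1 p.1); rewrite ?br ?bl ?bnd ?hp ?hs ?(ltW c2).
Qed.

Lemma below_above p q r : ~ on_segment p q r ->
  above p q r = below p q r (+) between p q r.
Proof.
move=> nseg; rewrite /above /below; case b : (between p q r) => //=.
case: (ltgtP p.2 (height q r p.1)) => // pE; case: nseg.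
wlog lt : q r b pE / q.1 < r.1.
  move=> H; case: (ltgtP q.1 r.1) (between_ne b) => // lt _; first exact: H.
  by apply/on_segmentC/H; rewrite ?(betweenC _ r) // pE heightC // gt_eqF.
rewrite [p]surjective_pairing pE; apply: on_height => //.
move: b; rewrite /between.
by case: (ltgtP q.1 p.1) => // h1; case: (ltgtP r.1 p.1) => // h2 _;
  rewrite ?(ltW h1) ?(ltW h2) // -?h2 ?lexx ?h1 ?(ltW lt) //; lra.
Qed.

Lemma affine_on_segment (u : R) p q r : on_segment p q r ->
  on_segment (p.1 + u * p.2, p.2) (q.1 + u * q.2, q.2) (r.1 + u * r.2, r.2).
Proof. by case=> t t01 ->; exists t => //=; congr (_, _); ring. Qed.

(** Two distinct points get the same abscissa for at most one [u]; the value 1 plus the sum of all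
    [|x|] over these exceptions avoids them. *)
Lemma shear_separates (I : finType) (P : I -> R * R) :
  exists u : R, forall i j, (P i).1 + u * (P i).2 = (P j).1 + u * (P j).2 ->
    P i = P j.
Proof.
pose bad := [seq ((P k.1).1 - (P k.2).1) / ((P k.2).2 - (P k.1).2) | k : I * I].
have [u ubad] : exists u, u \notin bad.
  exists (1 + \sum_(x <- bad) `|x|); apply/negP => ub.
  have : 1 + \sum_(x <- bad) `|x| <= \sum_(x <- bad) `|x|.
    rewrite [leRHS](big_rem _ ub) /=.
    apply: le_trans (ler_norm _) _; rewrite lerDl.
    by apply: sumr_ge0.
  by lra.
exists u => i j Pij.
case: (eqVneq (P i).2 (P j).2) => [e2|n2].
  rewrite [P i]surjective_pairing [P j]surjective_pairing e2; congr (_, _).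
  by move: Pij; rewrite e2 => /addIr.
case/negP: ubad; apply/mapP; exists (i, j); first by rewrite mem_enum.
have d : (P j).2 - (P i).2 != 0 by rewrite subr_eq0 eq_sym.
by rewrite /=; apply: (mulIf d); rewrite divfK //; lra.
Qed.

(* Every term but the last one occurs an even number of times in the sum over
   i < i' and j != j'. *)
Lemma K33_parity (Ua Ub : 'I_3 -> 'I_3 -> 'I_3 -> nat)
    (La Lba Lab Lb : 'I_3 -> 'I_3 -> nat) :
  (forall i i' j j', i != i' -> j != j' -> exists t,
     (Ua i i' j' + Ub j i' j' + Ua i' i j + Ub j' i j +
      La i i' + Lba j i' + Lab i j' + Lb j j' = t + t)%N) ->
  (forall j j', j != j' -> Lb j j' + Lb j' j = 1)%N -> False.
Proof.
move=> E L; pose o0 := @Ordinal 3 0 isT; pose o1 := @Ordinal 3 1 isT.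
pose o2 := @Ordinal 3 2 isT.
have [t1 e1] := E o0 o1 o0 o1 erefl erefl.
have [t2 e2] := E o0 o1 o0 o2 erefl erefl.
have [t3 e3] := E o0 o1 o1 o0 erefl erefl.
have [t4 e4] := E o0 o1 o1 o2 erefl erefl.
have [t5 e5] := E o0 o1 o2 o0 erefl erefl.
have [t6 e6] := E o0 o1 o2 o1 erefl erefl.
have [t7 e7] := E o0 o2 o0 o1 erefl erefl.
have [t8 e8] := E o0 o2 o0 o2 erefl erefl.
have [t9 e9] := E o0 o2 o1 o0 erefl erefl.
have [t10 e10] := E o0 o2 o1 o2 erefl erefl.
have [t11 e11] := E o0 o2 o2 o0 erefl erefl.
have [t12 e12] := E o0 o2 o2 o1 erefl erefl.
have [t13 e13] := E o1 o2 o0 o1 erefl erefl.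
have [t14 e14] := E o1 o2 o0 o2 erefl erefl.
have [t15 e15] := E o1 o2 o1 o0 erefl erefl.
have [t16 e16] := E o1 o2 o1 o2 erefl erefl.
have [t17 e17] := E o1 o2 o2 o0 erefl erefl.
have [t18 e18] := E o1 o2 o2 o1 erefl erefl.
have := L o0 o1 erefl; have := L o0 o2 erefl; have := L o1 o2 erefl.
clear E L; clearbody o0 o1 o2.
lia.
Qed.

Section VanKampen.
Variable m : nat.
Variable P : 'I_3 -> 'I_3 -> nat -> R * R.
Variables a b : 'I_3 -> R * R.
Hypothesis m0 : (0 < m)%N.
Hypothesis P0 : forall i j, P i j 0%N = a i.
Hypothesis Pm : forall i j, P i j m = b j.
Hypothesis dis : forall i j i' j' k l, i != i' -> j != j' ->
  (k < m)%N -> (l < m)%N ->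
  disjoint_segments (P i j k) (P i j k.+1) (P i' j' l) (P i' j' l.+1).

Lemma on_segment_left p q : on_segment p p q.
Proof.
exists 0; first by rewrite lexx ler01.
by rewrite [LHS]surjective_pairing; congr (_, _); ring.
Qed.

Lemma on_segment_right p q : on_segment q p q.
Proof. exact/on_segmentC/on_segment_left. Qed.

Lemma vertex_on_path i j k : (k <= m)%N ->
  exists2 k', (k' < m)%N & on_segment (P i j k) (P i j k') (P i j k'.+1).
Proof.
rewrite leq_eqVlt => /orP[/eqP ->|km]; last first.
  by exists k => //; exact: on_segment_left.
exists m.-1; first by rewrite prednK.
by rewrite prednK //; exact: on_segment_right.
Qed.

(** The segment parities of two disjoint edges telescope to terms at their four end points. Above is
    then traded for below plus comparisons of abscissae; over all pairs of disjoint edges everything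
    cancels but the comparisons among the [b j], three in number, hence odd. *)
Lemma van_kampen_generic :
  (forall i j i' j' k l, (k <= m)%N -> (l <= m)%N -> (P i j k).1 = (P i' j' l).1 ->
      P i j k = P i' j' l) -> False.
Proof.
move=> gen.
have xne i j i' j' k l : i != i' -> j != j' -> (k <= m)%N -> (l <= m)%N ->
    (P i j k).1 != (P i' j' l).1.
  move=> ii jj km lm; apply/eqP => /(gen _ _ _ _ _ _ km lm) e.
  have [k' k'm sk] := vertex_on_path i j km.
  have [l' l'm sl] := vertex_on_path i' j' lm.
  by apply: (dis ii jj k'm l'm sk); rewrite e.
have nseg i j i' j' k l : i != i' -> j != j' -> (k < m)%N -> (l <= m)%N ->
    ~ on_segment (P i' j' l) (P i j k) (P i j k.+1).
  move=> ii jj km lm h; have [l' l'm sl] := vertex_on_path i' j' lm.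
  exact: (dis ii jj km l'm h sl).
pose U p i j := \sum_(0 <= k < m) below p (P i j k) (P i j k.+1).
pose A p i j := \sum_(0 <= k < m) above p (P i j k) (P i j k.+1).
have AU i j i' j' l : i != i' -> j != j' -> (l <= m)%N ->
    A (P i' j' l) i j = U (P i' j' l) i j + between (P i' j' l) (a i) (b j).
  move=> ii jj lm; rewrite /A /U.
  rewrite (eq_big_nat _ _ (F2 := fun k => below (P i' j' l) (P i j k) (P i j k.+1) +
     (((P i j k).1 < (P i' j' l).1) + ((P i j k.+1).1 < (P i' j' l).1)))).
    rewrite big_split /= (telescope_bool (fun k => (P i j k).1 < (P i' j' l).1)).
    by rewrite P0 Pm.
  by move=> k km; rewrite below_above //; exact: nseg.
have key i j i' j' : i != i' -> j != j' ->
    (U (a i) i' j' + U (b j) i' j') + (A (a i') i j + A (b j') i j) = 0.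
  move=> ii jj.
  have : \sum_(0 <= k < m) \sum_(0 <= l < m)
     ((below (P i j k) (P i' j' l) (P i' j' l.+1) +
       below (P i j k.+1) (P i' j' l) (P i' j' l.+1)) +
      (above (P i' j' l) (P i j k) (P i j k.+1) +
       above (P i' j' l.+1) (P i j k) (P i j k.+1))) = 0.
    rewrite big_nat big1 // => k km; rewrite big_nat big1 // => l lm.
    apply: segment_parity; rewrite ?xne // ?(ltnW km) ?(ltnW lm) //.
    - by apply: gen => //; exact: ltnW.
    - by apply: gen => //; exact: ltnW.
    - exact: dis.
  under eq_bigr => k _ do rewrite big_split big_split /=.
  rewrite big_split /= (telescope_bool (fun k => U (P i j k) i' j')) P0 Pm.
  rewrite exchange_big /=.
  under eq_bigr => l _ do rewrite big_split /=.
  by rewrite (telescope_bool (fun l => A (P i' j' l) i j)) P0 Pm.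
pose lt (p q : R * R) : nat := p.1 < q.1.
apply: (@K33_parity (fun i i' j' => U (a i) i' j' : nat)
   (fun j i' j' => U (b j) i' j' : nat)
   (fun i i' => lt (a i) (a i')) (fun j i' => lt (b j) (a i'))
   (fun i j' => lt (a i) (b j')) (fun j j' => lt (b j) (b j'))).
  move=> i i' j j' ii jj; have := key i j i' j' ii jj.
  have := AU i j i' j' 0%N ii jj (leq0n _); rewrite P0 => ->.
  have := AU i j i' j' m ii jj (leqnn _); rewrite Pm => ->.
  rewrite /between /lt.
  move: (U _ _ _) (U _ _ _) (U _ _ _) (U _ _ _) (_ < _) (_ < _) (_ < _) (_ < _).
  move=> b1 b2 b3 b4 b5 b6 b7 b8 b0; set t := (X in exists _, X = _).
  exists t./2; rewrite addnn -[LHS]odd_double_half.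
  suff -> : odd t = false by [].
  rewrite /t !oddD !oddb -[RHS]b0.
  by case: b1 b2 b3 b4 b5 b6 b7 b8 {t b0} => [] [] [] [] [] [] [] [].
move=> j j' jj; rewrite /lt.
have : (b j).1 != (b j').1.
  by rewrite -(Pm 0 j) -(Pm 1 j'); apply: xne.
by case: ltgtP.
Qed.

End VanKampen.

(* P i j is the polygonal path drawing the edge of K33 from a i to b j. *)
Lemma van_kampen (m : nat) (P : 'I_3 -> 'I_3 -> nat -> R * R)
    (a b : 'I_3 -> R * R) : (0 < m)%N ->
  (forall i j, P i j 0%N = a i) -> (forall i j, P i j m = b j) ->
  (forall i j i' j' k l, i != i' -> j != j' -> (k < m)%N -> (l < m)%N ->
     disjoint_segments (P i j k) (P i j k.+1) (P i' j' l) (P i' j' l.+1)) -> False.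
Proof.
move=> m0 P0 Pm dis.
have [u hu] := shear_separates
  (fun t : 'I_3 * 'I_3 * 'I_m.+1 => P t.1.1 t.1.2 t.2).
pose S p := (p.1 + u * p.2, p.2) : R * R.
have SK : cancel S (fun p => (p.1 - u * p.2, p.2)).
  by case=> x y; rewrite /S /=; congr (_, _); ring.
have unS o p q : on_segment o (S p) (S q) ->
    on_segment (o.1 - u * o.2, o.2) p q.
  move/(affine_on_segment (- u)); rewrite /S /= !mulNr.
  by rewrite !addrK -!surjective_pairing.
apply: (@van_kampen_generic m (fun i j k => S (P i j k)) (fun i => S (a i))
         (fun j => S (b j)) m0).
- by move=> i j; rewrite P0.
- by move=> i j; rewrite Pm.
- move=> i j i' j' k l ii jj km lm o /unS h1 /unS h2.
  exact: dis ii jj km lm _ h1 h2.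
move=> i j i' j' k l km lm e; congr (S _).
have km' : (k < m.+1)%N by []; have lm' : (l < m.+1)%N by [].
exact: (hu (i, j, Ordinal km') (i', j', Ordinal lm') e).
Qed.

End Parity.

(** * Complexes with a planar 1-skeleton *)

Lemma sum_bool_odd (T : finType) (P : pred T) :
  \sum_i (P i : bool) = odd #|P|.
Proof.
transitivity (\sum_(i | P i) true).
  by rewrite [RHS]big_mkcond; apply: eq_bigr => i _; case: (P i).
by rewrite big_const; elim: #|P| => //= k ->.
Qed.

Section Complex.
Variables (V : finType) (K : pred {set V}).
Hypothesis Ksub : forall s t : {set V}, K s -> t \subset s -> K t.

(** Degenerate triples are included: they give [k a a = 0] and [k a b = k b a]. *)
Definition cocycle (k : V -> V -> bool) := forall s : {set V}, K s ->
  {in s & &, forall a b c, k a b + k b c = k a c}.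

Definition edge_rel : rel V := fun u v => (u != v) && K [set u; v].

Definition triangle_bd (t : {set V}) : {ffun V * V -> bool} :=
  [ffun p => [&& K t, #|t| == 3%N, p.1 \in t, p.2 \in t & p.1 != p.2]].

Lemma graph_edge_rel : graph edge_rel.
Proof.
by split=> [u v|u]; rewrite /edge_rel ?eqxx // eq_sym setUC.
Qed.

Lemma triangle_bd_cycle t : cycle_on edge_rel (triangle_bd t).
Proof.
split=> [u v|u v|u].
- rewrite !ffunE /= [v == u]eq_sym.
  by case: (u \in t); case: (v \in t).
- rewrite ffunE /= => /and5P[Kt _ ut vt uv].
  by rewrite /edge_rel uv (Ksub Kt) // subUset !sub1set ut vt.
- under eq_bigr => v _ do rewrite ffunE /=.
  case Kt : (K t); last by rewrite big1.
  case t3 : (#|t| == 3%N); last by rewrite big1.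
  case ut : (u \in t); last by rewrite big1.
  rewrite /= (sum_bool_odd (fun v => (v \in t) && (u != v))).
  have -> : #|(fun v => (v \in t) && (u != v))| = #|t :\ u|.
    by apply: eq_card => v; rewrite !inE andbC eq_sym.
  by move: t3; rewrite (cardsD1 u) ut add1n eqSS => /eqP ->.
Qed.

Lemma cocycle_of_functional (phi : V * V -> bool) :
  (forall t, \sum_p triangle_bd t p * phi p = 0) ->
  cocycle (fun a b => phi (a, b) + phi (b, a)).
Proof.
move=> h s Ks a b c aS bS cS.
case: (eqVneq a b) => [->|ab]; first by rewrite addbb0 add0r.
case: (eqVneq b c) => [->|bc]; first by rewrite addbb0 addr0.
case: (eqVneq a c) => [->|ac]; first by rewrite [RHS]addbb0 [X in _ + X]addrC addbb0.
pose t := [set a; b; c].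
have Kt : K t by apply: (Ksub Ks); rewrite !subUset !sub1set aS bS cS.
have t3 : #|t| = 3%N by rewrite /t setUC cardsU1 cards2 !inE negb_or ![c == _]eq_sym ac bc ab.
have := h t.
have -> : \sum_p triangle_bd t p * phi p =
    \sum_x \sum_y triangle_bd t (x, y) * phi (x, y).
  by rewrite pair_big; apply: eq_bigr => -[x y].
have tE x y : triangle_bd t (x, y) = [&& x \in t, y \in t & x != y].
  by rewrite ffunE /= Kt t3.
have inner x : x \in t -> \sum_y triangle_bd t (x, y) * phi (x, y) =
    (x != a) * phi (x, a) + ((x != b) * phi (x, b) + (x != c) * phi (x, c)).
  move=> xt; have ba : b != a by rewrite eq_sym.
  have cab : (c != a) && (c != b) by rewrite ![c == _]eq_sym ac bc.
  rewrite (bigD1 a) //= (bigD1 b) //= (bigD1 c) //= big1 ?addr0.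
    by rewrite !tE xt !inE !eqxx !orbT.
  move=> y /andP[/andP[ya yb] yc].
  by rewrite tE !inE (negbTE ya) (negbTE yb) (negbTE yc) andbF mul0r.
have ba : b != a by rewrite eq_sym.
have cab : (c != a) && (c != b) by rewrite ![c == _]eq_sym ac bc.
have sum3 (g : V -> bool) : (forall x, x \notin t -> g x = 0) ->
    \sum_x g x = g a + (g b + g c).
  move=> g0; rewrite (bigD1 a) //= (bigD1 b) //= (bigD1 c) //= big1 ?addr0 //.
  move=> y /andP[/andP[ya yb] yc]; apply: g0.
  by rewrite !inE (negbTE ya) (negbTE yb) (negbTE yc).
rewrite sum3; last by move=> x xt; rewrite big1 // => y _; rewrite tE (negbTE xt) mul0r.
rewrite !inner ?inE ?eqxx ?orbT // !(eq_sym b a) !(eq_sym c) ab bc ac.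
by case: (phi (a, b)); case: (phi (b, a)); case: (phi (a, c)); case: (phi (c, a));
   case: (phi (b, c)); case: (phi (c, b)).
Qed.

(* By duality, every even subgraph missing an edge ab is a sum of triangle
   boundaries: a functional killing the boundaries is symmetrized into a cocycle,
   which off ab is a coboundary.  So the triangles, together with their sum,
   serve as faces; when the whole graph is the only nonzero even subgraph, two
   copies of it do. *)
Lemma planar_of_complex :
  (forall u v, u != v -> #|[set t | [&& K t, #|t| == 3%N, u \in t & v \in t]]| <= 2)%N ->
  (forall a b, edge_rel a b -> forall k, cocycle k -> exists h : V -> bool,
     forall u v, edge_rel u v -> [set u; v] != [set a; b] -> k u v = h u + h v) ->
  planar edge_rel.
Proof.
move=> two coh.
have span a b z : edge_rel a b -> cycle_on edge_rel z -> z (a, b) = false ->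
    exists J : {set {set V}}, z = \sum_(t in J) triangle_bd t.
  move=> ab [z1 z2 z3] zab; apply: bool_span => phi hphi.
  have [h hk] := coh a b ab _ (cocycle_of_functional hphi).
  (* Adding [h u] does not change the sum over [z], whose degrees are even, and makes the summand
     symmetric, so the handshake lemma applies. *)
  pose y u v := z (u, v) * (phi (u, v) + h u).
  have ys u v : y u v = y v u.
    rewrite /y (z1 v u); case zuv : (z (u, v)); last by rewrite !mul0r.
    have : [set u; v] != [set a; b].
      apply/negP => /eqP e; have uab : u \in [set a; b] by rewrite -e !inE eqxx.
      have vab : v \in [set a; b] by rewrite -e !inE eqxx orbT.
      have := z2 _ _ zuv; rewrite /edge_rel; move: uab vab zuv; rewrite !inE.
      by do 2 (case/orP => /eqP ->); rewrite ?eqxx // ?zab // z1 zab.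
    move/(hk _ _ (z2 _ _ zuv)); rewrite !mul1r.
    by case: (phi _); case: (phi _); case: (h u); case: (h v).
  have y0 u : y u u = false.
    rewrite /y; case zuu : (z (u, u)) => //.
    by have := z2 _ _ zuu; rewrite /edge_rel eqxx.
  have := sum_sym_bool ys y0.
  have -> : \sum_u \sum_v y u v = \sum_u \sum_v z (u, v) * phi (u, v).
    apply: eq_bigr => u _; have zh : \sum_v z (u, v) * h u = 0.
      by rewrite -mulr_suml z3 mul0r.
    rewrite -[RHS]addr0 -[X in _ = _ + X]zh.
    by rewrite -big_split; apply: eq_bigr => v _; rewrite /= -mulrDr.
  by rewrite pair_big /= => s0; rewrite -[RHS]s0; apply: eq_bigr => -[u v].
have [[z1 [cz1 [z10 [[a b] [ab z1ab]]]]]|nomiss] := pselect (exists z, cycle_on edge_rel z /\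
    z != 0 /\ exists p, edge_rel p.1 p.2 /\ z p = false); last first.
  have full z : cycle_on edge_rel z -> z != 0 -> forall u v, edge_rel u v -> z (u, v).
    move=> cz z0 u v uv; apply: contraT => zuv; case: nomiss; exists z; split=> //.
    by split=> //; exists (u, v); rewrite (negbTE zuv).
  have uniq y z : cycle_on edge_rel y -> cycle_on edge_rel z -> y != 0 -> z != 0 -> y = z.
    move=> cy cz y0 z0; apply/ffunP => -[u v].
    have [_ ye _] := cy; have [_ ze _] := cz.
    by apply/idP/idP => [/ye|/ze] uv; apply: full.
  have [[w [cw w0]]|now] := pselect (exists w, cycle_on edge_rel w /\ w != 0).
    exists bool, (fun=> w); split=> // [p|z cz].
      have -> : [set i : bool | w p] = if w p then setT else set0.
        by apply/setP => i; rewrite inE; case: (w p); rewrite inE.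
      by case: (w p); rewrite ?cards0 ?cardsT ?card_bool !inE.
    case: (eqVneq z 0) => [->|z0]; first by exists set0; rewrite big_set0.
    by exists [set true]; rewrite big_set1; apply: uniq.
  exists bool, (fun=> 0); split=> [_|p|z cz].
  - split=> [u v|u v|u]; rewrite ?ffunE //.
    by rewrite big1 // => v _; rewrite ffunE.
  - by rewrite (_ : [set i | _] = set0) ?cards0 //; apply/setP => i; rewrite !inE ffunE.
  - exists set0; rewrite big_set0; apply/eqP; apply: contraT => z0.
    by case: now; exists z.
have cspan z : cycle_on edge_rel z -> exists J : {set {set V}}, z = \sum_(t in J) triangle_bd t.
  move=> cz; have [zab|zab] := boolP (z (a, b)); last exact: span ab cz (negbTE zab).
  (* A cycle through both [a b] and an edge [u v] of [z1] is corrected by [z1]: the sum misses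
     [u v], and [z1] misses [a b]. *)
  have [u [v zuv]] := cycle_edge z10; have [_ z1e _] := cz1.
  have [zuv'|zuv'] := boolP (z (u, v)); last exact: span (z1e _ _ zuv) cz (negbTE zuv').
  have [J1 J1E] := span _ _ _ ab cz1 z1ab.
  have [|J2 J2E] := span _ _ (z + z1) (z1e _ _ zuv) (cycle_add cz cz1).
    by rewrite addffE zuv' zuv.
  have ffbb (h : {ffun V * V -> bool}) : h + h = 0.
    by apply/ffunP => p; rewrite !ffunE; exact: addbb0.
  exists ((J2 :\: J1) :|: (J1 :\: J2)).
  have -> : z = (z + z1) + z1 by rewrite -addrA ffbb addr0.
  rewrite J2E J1E (big_setID J1) /= [X in _ + X](big_setID J2) /=.
  rewrite [J1 :&: J2]setIC addrACA ffbb add0r.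
  rewrite [RHS](big_setID (J2 :\: J1)) /= ; congr (_ + _); apply: eq_bigl => t; rewrite !inE;
    by case: (t \in J1); case: (t \in J2).
pose f (o : option {set V}) := if o is Some t then triangle_bd t else \sum_t triangle_bd t.
exists (option {set V}), f; split.
- case=> [t|] /=; first exact: triangle_bd_cycle.
  have -> : \sum_t triangle_bd t = \sum_(t in [set: {set V}]) triangle_bd t.
    by apply: eq_bigl => t; rewrite inE.
  by apply: cycle_sum => t; exact: triangle_bd_cycle.
- move=> [u v]; have sinj : injective (@Some {set V}) by move=> i j [].
  rewrite (cardsD1 None) in_set [f None]/= sum_ffunE (sum_bool_odd (fun t => triangle_bd t (u, v))).
  have -> : [set i | f i (u, v)] :\ None = [set Some t | t in [set t | triangle_bd t (u, v)]].
    apply/setP => -[t|]; rewrite !inE /=; last by apply/esym/negP => /imsetP[].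
    apply/idP/imsetP => [h|[t' + [->]]]; last by rewrite inE.
    by exists t; rewrite ?inE.
  rewrite card_imset // cardsE.
  suff : (#|(fun t => triangle_bd t (u, v))| <= 2)%N.
    by case: #|_| => [|[|[|k]]].
  case: (eqVneq u v) => [->|uv].
    by rewrite eq_card0 // => t; rewrite unfold_in ffunE /= eqxx !andbF.
  apply: leq_trans (two u v uv); apply: subset_leq_card; apply/subsetP => t.
  move=> tuv; have {tuv} : triangle_bd t (u, v) by exact: tuv.
  by rewrite ffunE inE /= => /and5P[-> -> -> ->].
- move=> z /cspan[J ->]; exists [set Some t | t in J].
  by rewrite big_imset // => i j _ _ [].
Qed.

End Complex.

(** * Continuity on a set *)

Section Continuity.
Local Open Scope classical_set_scope.
Variable R : realType.

Definition cont_on (T U : topologicalType) (A : set T) (f : T -> U) :=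
  forall x, A x -> f @ within A (nbhs x) --> f x.

Lemma within_cont_on (T U : topologicalType) (A : set T) (f : T -> U) :
  {within A, continuous f} -> cont_on A f.
Proof. by move/subspace_continuousP. Qed.

Lemma continuous_cont_on (T U : topologicalType) (A : set T) (f : T -> U) :
  continuous f -> cont_on A f.
Proof. by move=> cf x _; apply: cvg_within_filter; exact: cf. Qed.

Lemma cont_on_comp (T U W : topologicalType) (A : set T) (B : set U)
    (f : T -> U) (g : U -> W) :
  (forall x, A x -> B (f x)) -> cont_on A f -> cont_on B g -> cont_on A (g \o f).
Proof.
move=> AB cf cg x Ax s /(cg _ (AB _ Ax)) gs.
have h : \forall z \near x, A z -> B (f z) -> s (g (f z)) by exact: (cf _ Ax _ gs).
by apply: filterS h => z h Az; apply: h => //; exact: AB.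
Qed.

Lemma coord_norm n (x : 'rV[R]_n) i : `|x 0 i| <= `|x|.
Proof.
have -> : `|x| = \big[Num.max/0]_ij `|x ij.1 ij.2| := mx_normrE x.
exact: (le_bigmax _ (fun ij : 'I_1 * 'I_n => `|x ij.1 ij.2|) (0, i)).
Qed.

Lemma cont_onE (T U : normedModType R) (A : set T) (f : T -> U) x e :
  cont_on A f -> A x -> 0 < e ->
  exists2 d, 0 < d & forall y, A y -> `|x - y| < d -> `|f x - f y| < e.
Proof.
move=> cf Ax e0.
have h : \forall y \near within A (nbhs x), `|f x - f y| < e.
  exact: ((cvgrPdist_lt _ _).1 (cf _ Ax) e e0).
have [d /= d0 {}h] := (nbhs_normP x (fun y => A y -> `|f x - f y| < e)).1 h.
by exists d => // y Ay xy; exact: h.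
Qed.

Lemma cont_on_uniform (T U : normedModType R) (A : set T) (f : T -> U) e :
  compact A -> cont_on A f -> 0 < e ->
  exists2 d, 0 < d & forall x y, A x -> A y -> `|x - y| < d -> `|f x - f y| < e.
Proof.
move=> /compact_near_coveringP cA cf e0.
(* The radius [d] is a parameter tending to 0 from the right; compactness turns the local statements
   into one [d] for all points. *)
pose P (d : R) x := A x -> forall y, A y -> `|x - y| < d -> `|f x - f y| < e.
have e2 : 0 < e / 2 by rewrite divr_gt0.
have nP x : A x -> \forall x' \near x & d \near (0:R)^'+, P d x'.
  move=> Ax; have [r r0 hr] := cont_onE cf Ax e2.
  have r2 : 0 < r / 2 by rewrite divr_gt0.
  exists ([set x' | `|x - x'| < r / 2], [set d | d < r / 2]) => /=.
    split; last exact: nbhs_right_lt.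
    by apply/nbhs_normP; exists (r / 2).
  case=> x' d /= [xx' dr] Ax' y Ay x'y.
  have -> : f x' - f y = (f x - f y) - (f x - f x') by rewrite opprB [RHS]addrC addrA subrK.
  rewrite (le_lt_trans (ler_normB _ _)) // (splitr e) ltrD // hr //.
    rewrite -(subrK x' x) -addrA (le_lt_trans (ler_normD _ _)) // (splitr r) ltrD //.
    exact: lt_trans x'y dr.
  by rewrite (lt_trans xx') // ltr_pdivrMr // ltr_pMr // ltr1n.
have [d [d0 h]] := filter_ex (filterI (nbhs_right_gt (0:R)) (cA _ _ P _ nP)).
by exists d => // x y Ax Ay; exact: h.
Qed.

Lemma cont_on_norm_ge (T U : normedModType R) (A : set T) (f : T -> U) :
  compact A -> cont_on A f -> (forall x, A x -> f x != 0) ->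
  exists2 r, 0 < r & forall x, A x -> r <= `|f x|.
Proof.
move=> /compact_near_coveringP cA cf f0.
pose P (d : R) x := A x -> d <= `|f x|.
have nP x : A x -> \forall x' \near x & d \near (0:R)^'+, P d x'.
  move=> Ax; have m0 : 0 < `|f x| / 2 by rewrite divr_gt0 ?normr_gt0 ?f0.
  have [r r0 hr] := cont_onE cf Ax m0.
  exists ([set x' | `|x - x'| < r], [set d | d < `|f x| / 2]) => /=.
    split; last exact: nbhs_right_lt.
    by apply/nbhs_normP; exists r.
  case=> x' d /= [xx' dm] Ax'; have := hr _ Ax' xx'.
  have := ler_normD (f x') (f x - f x'); rewrite addrC subrK => h1 h2.
  lra.
have [d [d0 h]] := filter_ex (filterI (nbhs_right_gt (0:R)) (cA _ _ P _ nP)).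
by exists d => // x Ax; exact: h.
Qed.

Section Algebra.
Variables (T : topologicalType) (U : normedModType R) (A : set T).
Implicit Types (f g : T -> U) (s t : T -> R).

Lemma cont_on_cst (W : topologicalType) (a : W) : cont_on A (fun=> a).
Proof. by move=> x _; exact: cvg_cst. Qed.

Lemma cont_onD f g : cont_on A f -> cont_on A g -> cont_on A (fun x => f x + g x).
Proof. by move=> cf cg x Ax; apply: cvgD; [exact: cf|exact: cg]. Qed.

Lemma cont_onB f g : cont_on A f -> cont_on A g -> cont_on A (fun x => f x - g x).
Proof. by move=> cf cg x Ax; apply: cvgB; [exact: cf|exact: cg]. Qed.

Lemma cont_onZ s f : cont_on A s -> cont_on A f -> cont_on A (fun x => s x *: f x).
Proof. by move=> cs cf x Ax; apply: cvgZ; [exact: cs|exact: cf]. Qed.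

Lemma cont_onM s t : cont_on A s -> cont_on A t -> cont_on A (fun x => s x * t x).
Proof. by move=> cs ct x Ax; apply: cvgM; [exact: cs|exact: ct]. Qed.

Lemma cont_onV s : cont_on A s -> (forall x, A x -> s x != 0) ->
  cont_on A (fun x => (s x)^-1).
Proof. by move=> cs s0 x Ax; apply: cvgV; [exact: s0|exact: cs]. Qed.

Lemma cont_on_sum (I : finType) (f : I -> T -> R) :
  (forall i, cont_on A (f i)) -> cont_on A (fun x => \sum_i f i x).
Proof.
by move=> cf x Ax; apply: cvg_big => [|i _]; [exact: add_continuous|exact: cf].
Qed.

Lemma cont_on_entry n (f : T -> 'rV[R]_n) i :
  cont_on A f -> cont_on A (fun x => f x 0 i).
Proof.
move=> cf x Ax; apply: (@cvg_comp _ _ _ f (fun M : 'rV[R]_n => M 0 i)).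
  exact: cf.
exact: coord_continuous.
Qed.

Lemma cont_on_pair (W W' : topologicalType) (f : T -> W) (g : T -> W') :
  cont_on A f -> cont_on A g -> cont_on A (fun x => (f x, g x)).
Proof. by move=> cf cg x Ax; apply: cvg_pair; [exact: cf|exact: cg]. Qed.

End Algebra.

Definition segment01 : set R := [set s | 0 <= s <= 1].

Lemma compact_segment01 : compact segment01.
Proof.
rewrite (_ : segment01 = `[0, 1]); first exact: segment_compact.
by apply/seteqP; split => x /=; rewrite in_itv.
Qed.

Lemma compact_square : compact (segment01 `*` segment01).
Proof. by apply: compact_setX; exact: compact_segment01. Qed.

Lemma subdivision (d : R) : 0 < d -> exists N0 : nat, forall N, (N0 < N)%N -> N%:R^-1 < d.
Proof.
move=> d0; exists (Num.truncn d^-1) => N hN.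
have N0 : (0 : R) < N%:R by rewrite ltr0n; lia.
rewrite invf_plt ?posrE //.
by rewrite (lt_le_trans (truncnS_gt _)) // ler_nat.
Qed.

End Continuity.

Lemma segment01_div (R : realType) k N : (k <= N)%N -> (0 < N)%N ->
  segment01 (k%:R / N%:R : R).
Proof.
move=> kN N0; rewrite /segment01 /= divr_ge0 ?ler0n //=.
by rewrite ler_pdivrMr ?ltr0n // mul1r ler_nat.
Qed.

Lemma div_succ_dist (R : realType) k N : (0 < N)%N ->
  `|k%:R / N%:R - k.+1%:R / N%:R : R| = N%:R^-1.
Proof.
move=> N0; rewrite -mulrBl -natr1 opprD addrA subrr sub0r mulN1r normrN.
by rewrite ger0_norm // invr_ge0 ler0n.
Qed.

Lemma on_segment_dist (R : realType) (o a b : R * R) :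
  on_segment o a b -> `|a - o| <= `|a - b|.
Proof.
case=> t /andP[t0 t1] ->.
have -> : a - ((1 - t) * a.1 + t * b.1, (1 - t) * a.2 + t * b.2) = t *: (a - b).
  case: a b => a1 a2 [b1 b2]; congr (_, _) => /=; rewrite /GRing.scale /=; ring.
by rewrite normrZ ger0_norm // ler_piMl.
Qed.

(** By compactness the paths stay at some distance r > 0 from each other. Once each moves by less
    than r/2 per step, a common point of two chords would be too close to both paths. *)
Lemma paths_disjoint (R : realType) (p q : R -> R * R) :
  cont_on (@segment01 R) p -> cont_on (@segment01 R) q ->
  (forall s t, segment01 s -> segment01 t -> p s != q t) ->
  exists N0 : nat, forall N, (N0 < N)%N -> forall k l, (k < N)%N -> (l < N)%N ->
  disjoint_segments (p (k%:R / N%:R)) (p (k.+1%:R / N%:R))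
                    (q (l%:R / N%:R)) (q (l.+1%:R / N%:R)).
Proof.
move=> cp cq pq.
pose f (z : R * R) := p z.1 - q z.2.
have cf : cont_on (@segment01 R `*` @segment01 R)%classic f.
  apply: cont_onB.
    apply: (cont_on_comp (f := fst) _ _ cp) => [z []//|].
    by apply: continuous_cont_on => z; exact: cvg_fst.
  apply: (cont_on_comp (f := snd) _ _ cq) => [z []//|].
  by apply: continuous_cont_on => z; exact: cvg_snd.
have [|r r0 hr] := cont_on_norm_ge (@compact_square R) cf.
  by case=> s t [/= s1 t1]; rewrite subr_eq0 pq.
have r2 : 0 < r / 2 by rewrite divr_gt0.
have [d1 d10 h1] := cont_on_uniform (@compact_segment01 R) cp r2.
have [d2 d20 h2] := cont_on_uniform (@compact_segment01 R) cq r2.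
have [N1 hN1] := subdivision d10; have [N2 hN2] := subdivision d20.
exists (maxn N1 N2) => N; rewrite gtn_max => /andP[N1N N2N] k l kN lN o op oq.
have N0 : (0 < N)%N by exact: leq_ltn_trans N1N.
have sk := segment01_div R (ltnW kN) N0; have sk' := segment01_div R kN N0.
have sl := segment01_div R (ltnW lN) N0; have sl' := segment01_div R lN N0.
have := h1 _ _ sk sk'; rewrite div_succ_dist // => /(_ (hN1 _ N1N)) e1.
have := h2 _ _ sl sl'; rewrite div_succ_dist // => /(_ (hN2 _ N2N)) e2.
have := hr (k%:R / N%:R, l%:R / N%:R) (conj sk sl); rewrite /f /= => hge.
have := le_trans hge (ler_distD o _ _).
rewrite (distrC o); have := on_segment_dist op; have := on_segment_dist oq.
lra.
Qed.

(** * Stereographic projection *)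

Section Sphere.
Variable R : realType.

Definition dot n (x y : 'rV[R]_n) := \sum_i x 0 i * y 0 i.

Lemma sphere_dot d (x : 'rV[R]_d.+1) : unit_sphere x <-> dot x x = 1.
Proof.
rewrite /unit_sphere /= /dot.
by under [X in X = 1 <-> _]eq_bigr => i _ do rewrite expr2.
Qed.

Lemma dotB n (x y : 'rV[R]_n) : dot (x - y) (x - y) = dot x x - 2 * dot x y + dot y y.
Proof.
rewrite /dot mulr_sumr -sumrB -big_split /=; apply: eq_bigr => i _.
rewrite !mxE; ring.
Qed.

Lemma dot_eq0 n (x : 'rV[R]_n) : dot x x = 0 -> x = 0.
Proof.
move=> h; apply/rowP => i; rewrite mxE.
have sq j : true -> 0 <= x 0 j * x 0 j by rewrite -expr2 sqr_ge0.
by apply/eqP; have /eqP := psumr_eq0P sq h (i := i) erefl; rewrite mulf_eq0 orbb.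
Qed.

Lemma sphere_dot_neq1 d (x y : 'rV[R]_d.+1) :
  unit_sphere x -> unit_sphere y -> x != y -> 1 - dot x y != 0.
Proof.
move=> /sphere_dot xx /sphere_dot yy xy; apply: contra xy => /eqP h.
rewrite -subr_eq0; apply/eqP/dot_eq0; rewrite dotB xx yy; lra.
Qed.

(** Central projection from [z], with one coordinate dropped. The centre is arbitrary because it
    will be the image of a vertex; a nonzero coordinate [k] of [z] tells which one to drop. *)
Lemma stereographic (z : 'rV[R]_3) : unit_sphere z ->
  exists2 pi : 'rV[R]_3 -> R * R,
    cont_on (@unit_sphere R 2 `&` [set x | x != z])%classic pi &
    forall x y, unit_sphere x -> unit_sphere y -> x != z -> y != z ->
      pi x = pi y -> x = y.
Proof.
move=> zS; have zz := (sphere_dot z).1 zS.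
have [k zk] : exists k, z 0 k != 0.
  apply: contrapT => h; have : z == 0.
    apply/eqP/rowP => i; rewrite mxE; apply: contrapT => /eqP zi.
    by apply: h; exists i.
  move=> /eqP z0; move: zz; rewrite z0 /dot big1 => [/eqP|i _].
    by rewrite eq_sym oner_eq0.
  by rewrite mxE mul0r.
pose s x := (1 - dot x z)^-1.
pose w x : 'rV[R]_3 := s x *: (x - z).
(* [w x] is recovered from two coordinates by <w x, z> = -1, and x from [w x] by
   |w x|^2 = 2 * s x. *)
exists (fun x => (w x 0 (lift k 0), w x 0 (lift k 1))).
  have cw : cont_on (@unit_sphere R 2 `&` [set x | x != z])%classic w.
    apply: cont_onZ.
      apply: cont_onV => [|x [xS xz]]; last exact: sphere_dot_neq1.
      apply: cont_onB; first exact: cont_on_cst.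
      apply: cont_on_sum => i; apply: cont_onM; last exact: cont_on_cst.
      by apply: cont_on_entry; apply: continuous_cont_on => y; exact: cvg_id.
    apply: cont_onB; last exact: cont_on_cst.
    by apply: continuous_cont_on => y; exact: cvg_id.
  by apply: cont_on_pair; exact: cont_on_entry.
move=> x y xS yS xz yz [e1 e2].
have sE t : unit_sphere t -> t != z -> s t != 0 /\ s t * (1 - dot t z) = 1.
  by move=> tS tz; rewrite invr_eq0 mulVf sphere_dot_neq1.
have wz t : unit_sphere t -> t != z -> dot (w t) z = -1.
  move=> tS tz; have [_ h] := sE t tS tz.
  rewrite -h /dot; have -> : s t * (1 - dot t z) = - (s t * (dot t z - dot z z)).
    by rewrite zz; ring.
  rewrite opprK /dot -sumrB mulr_sumr; apply: eq_bigr => i _; rewrite !mxE; ring.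
have ww t : unit_sphere t -> t != z -> dot (w t) (w t) = 2 * s t.
  move=> tS tz; have [_ h] := sE t tS tz; have tt := (sphere_dot t).1 tS.
  have -> : dot (w t) (w t) = s t ^+ 2 * dot (t - z) (t - z).
    by rewrite /dot mulr_sumr; apply: eq_bigr => i _; rewrite !mxE; ring.
  rewrite dotB tt zz; transitivity (2 * s t * (s t * (1 - dot t z))); first ring.
  by rewrite h mulr1.
have off i : i != k -> w x 0 i = w y 0 i.
  move=> ik; case: (unliftP k i) => [j ->|ik']; last by rewrite ik' eqxx in ik.
  case: j => -[|[|//]] lj; [rewrite (_ : Ordinal _ = 0) //|rewrite (_ : Ordinal _ = 1) //];
    exact: val_inj.
have wk : w x 0 k = w y 0 k.
  have := wz y yS yz; rewrite -(wz x xS xz) /dot (bigD1 k) //= [RHS](bigD1 k) //=.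
  have -> : \sum_(i | i != k) w y 0 i * z 0 i = \sum_(i | i != k) w x 0 i * z 0 i.
    by apply: eq_bigr => i /off ->.
  by move/addIr/(mulIf zk).
have wE : w x = w y.
  by apply/rowP => i; case: (eqVneq i k) => [->|/off].
have ss : s x = s y.
  have := ww y yS yz; rewrite -wE ww // => h; lra.
have [s0 _] := sE x xS xz; apply: (addIr (- z)); apply: (scalerI s0).
by rewrite [in RHS]ss; exact: wE.
Qed.

End Sphere.

(** * Triangulated spheres *)

Section Realization.
Variables (R : realType) (V : finType) (D : {set {set V}}).

Definition ord_face : pred {set 'I_#|V|} := fun s => [set enum_val i | i in s] \in D.

Lemma realization_face (x : 'rV[R]_#|V|) :
  geometric_realization D x <->
  [/\ forall i, 0 <= x 0 i, \sum_i x 0 i = 1 & ord_face [set i | x 0 i != 0]].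
Proof.
rewrite /geometric_realization /ord_face /=.
suff -> : [set enum_val i | i in [set i | x 0 i != 0]] = [set v | x 0 (enum_rank v) != 0] by [].
apply/setP => v; rewrite inE; apply/imsetP/idP => [[i + ->]|h].
  by rewrite inE enum_valK.
by exists (enum_rank v); rewrite ?inE ?enum_rankK.
Qed.

Hypothesis cD : simplicial_complex D.

Lemma ord_face_sub (s t : {set 'I_#|V|}) : ord_face s -> t \subset s -> ord_face t.
Proof. by move=> h /(imsetS enum_val); exact: cD.2. Qed.

Hypothesis sphere : homeomorphic (@geometric_realization R V D) (@unit_sphere R 2).

(* Otherwise K33, with the vertices of uv and its midpoint on one side and the
   barycentres of three triangles on the other, embeds in the realization minus
   a vertex, hence in the plane. *)
Lemma edge_in_two_triangles (u v : 'I_#|V|) : u != v ->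
  (#|[set t | [&& ord_face t, #|t| == 3%N, u \in t & v \in t]]| <= 2)%N.
Proof.
move=> uv; rewrite leqNgt; apply/negP; set T := [set t | _] => T3.
pose t k := enum_val (widen_ord T3 k : 'I_#|T|).
have tT k : [/\ ord_face (t k), #|t k| = 3%N, u \in t k & v \in t k].
  by have := enum_valP (widen_ord T3 k); rewrite inE => /and4P[? /eqP ? ? ?].
have tinj : injective t.
  by move=> i j /enum_val_inj /(congr1 val) ij; exact: val_inj.
have /choice[x hx] : forall k, exists y, [/\ y != u, y != v & t k = [set u; v; y]].
  move=> k; have [_ tk3 utk vtk] := tT k.
  have /eqP : #|t k :\ u :\ v| = 1%N.
    have := cardsD1 u (t k); rewrite utk tk3.
    by have := cardsD1 v (t k :\ u); rewrite !inE eq_sym uv vtk /= => -> [].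
  case/cards1P => y hy; have : y \in t k :\ u :\ v by rewrite hy inE.
  rewrite !inE => /and3P[yv yu ytk]; exists y; split=> //.
  apply/setP => j; have := congr1 (fun s : {set _} => j \in s) hy; rewrite !inE.
  case: (eqVneq j u) => [->|ju]; first by rewrite utk.
  case: (eqVneq j v) => [->|jv]; first by rewrite vtk.
  by [].
have xinj : injective x.
  move=> i j xij; apply: tinj; have [_ _ ->] := hx i; have [_ _ ->] := hx j.
  by rewrite xij.
have [f [g [/within_cont_on cf _ fg _]]] := sphere.
(* The values 0, 1/2, 1 give [v], the midpoint and [u] on the edge. *)
pose al (i : 'I_3) : R := i%:R / 2.
have alinj : injective al.
  move=> i j h; apply: val_inj; apply/eqP; rewrite -(eqr_nat R); apply/eqP.
  by move: h; rewrite /al; lra.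
have al01 i : 0 <= al i <= 1.
  rewrite /al divr_ge0 ?ler0n //= ler_pdivrMr // mul1r ler_nat.
  by have := ltn_ord i; lia.
pose e w : 'rV[R]_#|V| := delta_mx 0 w.
(* The straight path from point [al i] of the edge, at s = 0, to the barycentre of the triangle [u],
   [v], [x k], at s = 1. *)
pose sg i k s : 'rV[R]_#|V| := ((1 - s) * al i + s / 3) *: e u +
   ((1 - s) * (1 - al i) + s / 3) *: e v + (s / 3) *: e (x k).
have sgE i k s j : sg i k s 0 j = (if j == u then (1 - s) * al i + s / 3 else
   if j == v then (1 - s) * (1 - al i) + s / 3 else
   if j == x k then s / 3 else 0).
  rewrite !mxE !eqxx /=; have [xu xv _] := hx k.
  case: (eqVneq j u) => [->|ju].
    by rewrite (negbTE uv) eq_sym (negbTE xu) /=; ring.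
  case: (eqVneq j v) => [->|jv].
    by rewrite eq_sym (negbTE xv) /=; ring.
  case: (eqVneq j (x k)) => _ /=; ring.
have csg i k : cont_on (@segment01 R) (sg i k).
  have cid : cont_on (@segment01 R) id by apply: continuous_cont_on => y; exact: cvg_id.
  have c3 : cont_on (@segment01 R) (fun s => s / 3).
    by apply: cont_onM => //; exact: cont_on_cst.
  have c1 (a : R) : cont_on (@segment01 R) (fun s => (1 - s) * a + s / 3).
    apply: cont_onD => //; apply: cont_onM; last exact: cont_on_cst.
    by apply: cont_onB => //; exact: cont_on_cst.
  rewrite /sg; apply: cont_onD; first apply: cont_onD.
  - by apply: cont_onZ; [exact: c1|exact: cont_on_cst].
  - by apply: cont_onZ; [exact: c1|exact: cont_on_cst].
  - by apply: cont_onZ; [exact: c3|exact: cont_on_cst].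
have sgA i k s : segment01 s -> geometric_realization D (sg i k s).
  case/andP => s0 s1; have /andP[a0 a1] := al01 i; have [xu xv tk] := hx k.
  apply/realization_face; split=> [j||].
  - rewrite sgE; have h3 : 0 <= s / 3 by rewrite divr_ge0.
    have h1 : 0 <= (1 - s) * al i by rewrite mulr_ge0 ?subr_ge0.
    have h2 : 0 <= (1 - s) * (1 - al i) by rewrite mulr_ge0 ?subr_ge0.
    by case: ifP => _; [exact: addr_ge0|case: ifP => _; [exact: addr_ge0|case: ifP]].
  - rewrite (bigD1 u) //= (bigD1 v) ?(eq_sym v) //= (bigD1 (x k)) ?xu ?xv //= big1.
      rewrite !sgE !eqxx [v == u]eq_sym (negbTE uv) (negbTE xu) (negbTE xv); by field.
    move=> j /andP[/andP[ju jv] jx].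
    by rewrite sgE (negbTE ju) (negbTE jv) (negbTE jx).
  have [kt _ _ _] := tT k; apply: ord_face_sub kt _; rewrite tk; apply/subsetP => j.
  rewrite !inE sgE; case: (j == u) => //; case: (j == v) => //.
  by case: (j == x k) => //; rewrite eqxx.
(* The centre of projection is the image of this vertex: on every path the coordinate at [x ord0] is
   at most 1/3, so no path meets it. *)
have e0A : geometric_realization D (e (x ord0)).
  apply/realization_face; split=> [j||].
  - by rewrite mxE ler0n.
  - rewrite (bigD1 (x ord0)) //= big1 => [|j /negbTE jx]; first by rewrite mxE !eqxx addr0.
    by rewrite mxE jx.
  have [kt _ _ _] := tT ord0; have [_ _ tk] := hx ord0.
  apply: ord_face_sub kt _; rewrite tk; apply/subsetP => j.
  rewrite !inE mxE; case: (j == x ord0); rewrite ?orbT //=; by rewrite eqxx.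
have [zS _] := fg _ e0A.
have [pi cpi piinj] := stereographic zS.
have finj y y' : geometric_realization D y -> geometric_realization D y' ->
    f y = f y' -> y = y'.
  by move=> yA y'A h; have [_ <-] := fg _ yA; have [_ <-] := fg _ y'A; rewrite h.
have fsg i k s : segment01 s ->
    (@unit_sphere R 2 `&` [set w | w != f (e (x ord0))])%classic (f (sg i k s)).
  move=> s01; split; first by have [] := fg _ (sgA i k s s01).
  apply/negP => /eqP /(finj _ _ (sgA i k s s01) e0A) /rowP /(_ (x ord0)).
  have [xu xv _] := hx ord0; case/andP: s01 => s0 s1.
  rewrite sgE mxE !eqxx (negbTE xu) (negbTE xv) /=.
  by case: ifP => _; lra.
pose P i k s := pi (f (sg i k s)).
have cP i k : cont_on (@segment01 R) (P i k).
  apply: (cont_on_comp (f := f \o sg i k) _ _ cpi); first by move=> s; exact: fsg.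
  by apply: (cont_on_comp _ (csg i k) cf); exact: sgA.
have disj (q : 'I_3 * 'I_3 * ('I_3 * 'I_3)) : exists N0 : nat,
    q.1.1 != q.2.1 -> q.1.2 != q.2.2 ->
    forall N, (N0 < N)%N -> forall k l, (k < N)%N -> (l < N)%N ->
    disjoint_segments (P q.1.1 q.1.2 (k%:R / N%:R)) (P q.1.1 q.1.2 (k.+1%:R / N%:R))
      (P q.2.1 q.2.2 (l%:R / N%:R)) (P q.2.1 q.2.2 (l.+1%:R / N%:R)).
  case: q => -[i k] [i' k'] /=.
  have [->|ii'] := eqVneq i i'; first by exists 0%N.
  have [->|kk'] := eqVneq k k'; first by exists 0%N.
  have [|N0 hN0] := paths_disjoint (cP i k) (cP i' k'); last by exists N0.
  move=> s s' s01 s'01; apply/negP => /eqP.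
  have [fs fz] := fsg i k s s01; have [fs' fz'] := fsg i' k' s' s'01.
  move/(piinj _ _ fs fs' fz fz')/(finj _ _ (sgA i k s s01) (sgA i' k' s' s'01)).
  move=> /rowP h; move: (h u) (h (x k)) (h (x k')); rewrite !sgE !eqxx.
  have [xu xv _] := hx k; have [xu' xv' _] := hx k'.
  rewrite !(inj_eq xinj) (negbTE xu) (negbTE xv) (negbTE xu') (negbTE xv').
  rewrite (eq_sym k') (negbTE kk') => h1 h2 h3.
  case/eqP: ii'; apply: alinj.
  have s0 : s = 0 by lra.
  have s'0 : s' = 0 by lra.
  by move: h1; rewrite s0 s'0; lra.
have [M hM] := choice disj.
pose N := (\max_q M q).+1.
have MN q : (M q < N)%N by rewrite ltnS; exact: leq_bigmax.
apply: (@van_kampen R N (fun i k j => P i k (j%:R / N%:R)) (fun i => P i ord0 0)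
   (fun k => P ord0 k 1)) => //.
- move=> i j; rewrite mul0r /P; congr (pi (f _)).
  by rewrite /sg mul0r !scale0r.
- move=> i j; rewrite divff ?pnatr_eq0 // /P; congr (pi (f _)).
  by rewrite /sg subrr !mul0r.
move=> i k i' k' a b ii' kk' aN bN.
exact: (hM (i, k, (i', k')) ii' kk' N (MN _)).
Qed.

Lemma unit_cont_on n : cont_on [set w : 'rV[R]_n | w != 0]%classic
  (fun w => (Num.sqrt (dot w w))^-1 *: w).
Proof.
have cid : cont_on [set w : 'rV[R]_n | w != 0]%classic id.
  by apply: continuous_cont_on => w; exact: cvg_id.
apply: cont_onZ => //; apply: cont_onV.
  apply: (@cont_on_comp _ _ _ _ [set: R]%classic (fun w => dot w w) Num.sqrt) => //.
    by apply: cont_on_sum => i; apply: cont_onM; exact: cont_on_entry.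
  by apply: continuous_cont_on; exact: sqrt_continuous.
move=> w /= w0; rewrite sqrtr_eq0 -ltNge lt_def.
have h : 0 <= dot w w by apply: sumr_ge0 => i _; rewrite -expr2 sqr_ge0.
by rewrite h andbT; apply: contra w0 => /eqP /dot_eq0 ->.
Qed.

Lemma dotZ n (s : R) (w : 'rV[R]_n) : dot (s *: w) (s *: w) = s ^+ 2 * dot w w.
Proof. by rewrite /dot mulr_sumr; apply: eq_bigr => i _; rewrite !mxE; ring. Qed.

Lemma unit_sphere_unit (w : 'rV[R]_3) : w != 0 ->
  unit_sphere ((Num.sqrt (dot w w))^-1 *: w).
Proof.
move=> w0; have h : 0 <= dot w w by apply: sumr_ge0 => i _; rewrite -expr2 sqr_ge0.
apply/sphere_dot; rewrite dotZ exprVn sqr_sqrtr // mulVf //.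
by apply: contra w0 => /eqP /dot_eq0 ->.
Qed.

(** The coordinates average to [#|V|%:R^-1]. The explicit threshold is what uniform continuity will
    be played against. *)
Lemma realization_label (j0 : 'I_#|V|) : exists lab : 'rV[R]_#|V| -> 'I_#|V|,
  forall x, geometric_realization D x -> #|V|%:R^-1 <= x 0 (lab x).
Proof.
have n0 : (0 < #|V|)%N by apply: leq_ltn_trans (ltn_ord j0).
suff /choice[lab hlab] : forall x : 'rV[R]_#|V|, exists j,
    geometric_realization D x -> #|V|%:R^-1 <= x 0 j by exists lab.
move=> x; have [xA|nA] := pselect (geometric_realization D x); last by exists j0.
have [j hj] : exists j, #|V|%:R^-1 <= x 0 j; last by exists j.
apply: contrapT => h; have [_ x1 _] := (realization_face x).1 xA.
suff : \sum_i x 0 i < \sum_(i < #|V|) #|V|%:R^-1.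
  rewrite x1 sumr_const card_ord -[_ *+ _]mulr_natr mulVf ?ltxx //.
  by rewrite pnatr_eq0 -lt0n.
apply: ltr_sum => [|i _].
  by apply/hasP; exists j0; rewrite // mem_index_enum.
by rewrite ltNge; apply/negP => hi; apply: h; exists i.
Qed.

(* The image of uv in the sphere avoids the image z of the midpoint of ab, so it
   contracts to -z along segments.  Each point of a fine grid is labelled by a
   vertex of largest barycentric coordinate; the four corners of a cell have
   labels in a common face, so k sums to 0 around the cell. *)
Lemma cocycle_off_edge (a b : 'I_#|V|) : edge_rel ord_face a b ->
  forall k, cocycle ord_face k -> exists h : 'I_#|V| -> bool,
  forall u v, edge_rel ord_face u v -> [set u; v] != [set a; b] -> k u v = h u + h v.
Proof.
case/andP => ab abF k kc.
have [f [g [/within_cont_on cf /within_cont_on cg fg gf]]] := sphere.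
have [lab hlab] := realization_label a.
pose e w : 'rV[R]_#|V| := delta_mx 0 w.
pose q u v t : 'rV[R]_#|V| := (1 - t) *: e u + t *: e v.
have qE u v t j : q u v t 0 j = (1 - t) * (j == u)%:R + t * (j == v)%:R.
  by rewrite !mxE !eqxx.
have qA u v t : ord_face [set u; v] -> segment01 t -> geometric_realization D (q u v t).
  move=> uvF /andP[t0 t1]; apply/realization_face; split=> [j||].
  - by rewrite qE addr_ge0 // mulr_ge0 ?ler0n // subr_ge0.
  - under eq_bigr => j _ do rewrite qE.
    have one w : \sum_(j < #|V|) (j == w)%:R = 1 :> R.
      by rewrite (bigD1 w) //= eqxx big1 ?addr0 // => j /negbTE ->.
    by rewrite big_split /= -!mulr_sumr !one !mulr1 subrK.
  apply: ord_face_sub uvF _; apply/subsetP => j; rewrite !inE qE.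
  by case: (j == u); case: (j == v) => //=; rewrite !mulr0 addr0 eqxx.
pose z := f (q a b 2^-1).
have half01 : segment01 (2^-1 : R) by rewrite /segment01 /=; lra.
have mA := qA a b _ abF half01; have [zS gz] := fg _ mA; rewrite -/z in zS gz.
have zz := (sphere_dot z).1 zS.
(* The segment from [y] to [- z] meets the origin only if [y = z], at s = 1/2; elsewhere it can be
   normalized back to the sphere. *)
pose W (y : 'rV[R]_3) s := (1 - s) *: y - s *: z.
pose unit (w : 'rV[R]_3) := (Num.sqrt (dot w w))^-1 *: w.
have W0 y s : unit_sphere y -> y != z -> segment01 s -> W y s != 0.
  move=> yS yz /andP[s0 s1]; apply: contra yz; rewrite subr_eq0 => /eqP h.
  have yy := (sphere_dot y).1 yS.
  have hs : s = 2^-1.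
    have := congr1 (fun w => dot w w) h; rewrite !dotZ yy zz => {}h; nra.
  apply/eqP; apply: (scalerI (a := 2^-1)) => //.
  by move: h; rewrite hs (_ : 1 - 2^-1 = 2^-1) //; lra.
pose H u v (p : R * R) := g (unit (W (f (q u v p.2)) p.1)).
have fqS u v t : ord_face [set u; v] -> [set u; v] != [set a; b] -> segment01 t ->
    unit_sphere (f (q u v t)) /\ f (q u v t) != z.
  move=> uvF uvab t01; have [yS gy] := fg _ (qA u v t uvF t01); split=> //.
  apply: contra uvab => /eqP fz; have := gy; rewrite fz gz => /rowP h.
  suff : [set a; b] \subset [set u; v].
    rewrite eq_sym eqEcard cards2 cards2 ab => ->; by case: (u != v).
  apply/subsetP => j jab; move: (h j); rewrite !qE.
  rewrite !inE; case: (j == u) => //; case: (j == v) => //=.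
  move: jab; rewrite !inE; case: (j == a); case: (j == b) => //= _; lra.
have HA u v p : ord_face [set u; v] -> [set u; v] != [set a; b] ->
    (@segment01 R `*` @segment01 R)%classic p -> geometric_realization D (H u v p).
  move=> uvF uvab [/= p1 p2]; have [yS yz] := fqS u v p.2 uvF uvab p2.
  by apply: (gf _ _).1; apply: unit_sphere_unit; exact: W0.
have cH u v : ord_face [set u; v] -> [set u; v] != [set a; b] ->
    cont_on (@segment01 R `*` @segment01 R)%classic (H u v).
  move=> uvF uvab.
  pose S2 := (@segment01 R `*` @segment01 R)%classic.
  have c1 : cont_on S2 (fun p => p.1) by apply: continuous_cont_on => p; exact: cvg_fst.
  have c2 : cont_on S2 (fun p => p.2) by apply: continuous_cont_on => p; exact: cvg_snd.
  have cq : cont_on S2 (fun p => q u v p.2).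
    apply: cont_onD; last by apply: cont_onZ => //; exact: cont_on_cst.
    by apply: cont_onZ; [apply: cont_onB => //|]; exact: cont_on_cst.
  have cfq : cont_on S2 (fun p => f (q u v p.2)).
    by apply: (cont_on_comp _ cq cf) => p [_ p2]; exact: qA.
  have cW : cont_on S2 (fun p => W (f (q u v p.2)) p.1).
    apply: cont_onB; last by apply: cont_onZ => //; exact: cont_on_cst.
    by apply: cont_onZ => //; apply: cont_onB => //; exact: cont_on_cst.
  have Wn0 p : S2 p -> W (f (q u v p.2)) p.1 != 0.
    by case=> p1 p2; have [yS yz] := fqS u v p.2 uvF uvab p2; exact: W0.
  apply: (@cont_on_comp _ _ _ S2 (@unit_sphere R 2) (fun p => unit (W (f (q u v p.2)) p.1)) g) => //.
    by move=> p /Wn0; exact: unit_sphere_unit.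
  exact: (@cont_on_comp _ _ _ S2 [set w : 'rV[R]_3 | w != 0]%classic
    (fun p => W (f (q u v p.2)) p.1) unit Wn0 cW (@unit_cont_on 3)).
have n0 : (0 < #|V|)%N by apply: leq_ltn_trans (ltn_ord a).
have in0 : (0 : R) < #|V|%:R^-1 by rewrite invr_gt0 ltr0n.
pose l u v N i j := lab (H u v (i%:R / N%:R, j%:R / N%:R)).
have grid (p : 'I_#|V| * 'I_#|V|) : exists N0 : nat,
    ord_face [set p.1; p.2] -> [set p.1; p.2] != [set a; b] ->
    forall N, (N0 < N)%N -> forall i j, (i < N)%N -> (j < N)%N ->
    exists2 s : {set 'I_#|V|}, ord_face s &
      [/\ l p.1 p.2 N i j \in s, l p.1 p.2 N i j.+1 \in s,
          l p.1 p.2 N i.+1 j \in s & l p.1 p.2 N i.+1 j.+1 \in s].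
  case: p => u v /=.
  have [uvF|] := boolP (ord_face [set u; v]); last by exists 0%N.
  have [?|uvab] := eqVneq [set u; v] [set a; b]; first by exists 0%N.
  have [d d0 hd] := cont_on_uniform (@compact_square R) (cH u v uvF uvab) in0.
  have [N0 hN0] := subdivision d0; exists N0 => _ _ N N0N i j iN jN.
  have N1 : (0 < N)%N by exact: leq_ltn_trans N0N.
  pose pt i j : R * R := (i%:R / N%:R, j%:R / N%:R).
  have ptS i' j' : (i' <= N)%N -> (j' <= N)%N ->
      (@segment01 R `*` @segment01 R)%classic (pt i' j').
    by move=> i'N j'N; split; exact: segment01_div.
  have pij := ptS _ _ (ltnW iN) (ltnW jN).
  have [_ _ sF] := (realization_face _).1 (HA u v _ uvF uvab pij).
  exists [set w | H u v (pt i j) 0 w != 0] => //.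
  (* A label has coordinate at least [#|V|%:R^-1] at its own point, and coordinates vary by less
     across a cell, so it lies in the support at the corner [pt i j]. *)
  have mem i' j' : (i' <= N)%N -> (j' <= N)%N -> `|pt i j - pt i' j'| < d ->
      l u v N i' j' \in [set w | H u v (pt i j) 0 w != 0].
    move=> i'N j'N hdist; have p' := ptS _ _ i'N j'N; rewrite inE.
    have h1 := hd _ _ pij p' hdist; have h2 := hlab _ (HA u v _ uvF uvab p').
    have h3 := le_lt_trans (coord_norm _ (l u v N i' j')) h1; rewrite !mxE in h3.
    by apply/eqP => h4; move: h3; rewrite h4 sub0r normrN ger0_norm ?(le_trans (ltW in0) h2) // ltNge h2.
  have dN := hN0 _ N0N.
  have pair_norm (x y : R) : `|x| < d -> `|y| < d -> `|(x, y)| < d.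
    by move=> xd yd; rewrite [X in X < _]/Num.norm /= gt_max xd.
  split; apply: mem; rewrite ?(ltnW iN) ?(ltnW jN) //; apply: pair_norm;
    by rewrite ?subrr ?normr0 // div_succ_dist.
have [M hM] := choice grid.
pose N := (\max_p M p).+1.
have MN p : (M p < N)%N by rewrite ltnS; exact: leq_bigmax.
have N0 : (0 < N)%N by [].
have NN : N%:R / N%:R = 1 :> R by rewrite divff // pnatr_eq0.
pose G u s := g (unit (W (f (e u)) s)).
pose lG u i := lab (G u (i%:R / N%:R)).
(* The potential at [u] is the sum of [k] along the labelled track of [u] under the homotopy. One
   [N] serves all edges, so it depends on [u] alone. *)
exists (fun u => \sum_(0 <= i < N) k (lG u i) (lG u i.+1)).
move=> u v /andP[uv uvF] uvab.
have q0 : q u v 0 = e u by rewrite /q subr0 scale1r scale0r addr0.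
have q1 : q u v 1 = e v by rewrite /q subrr scale1r scale0r add0r.
have gridN := hM (u, v) uvF uvab N (MN _).
have kk s x : ord_face s -> x \in s -> k x x = 0.
  by move=> sF xs; have := kc s sF x x x xs xs xs; case: (k x x).
have stokes := @grid_stokes _ k (l u v N) N.
have l0 i : l u v N i 0 = lG u i by rewrite /l /H /= mul0r q0.
have lN i : l u v N i N = lG v i by rewrite /l /H /= NN q1.
have unitS y : unit_sphere y -> unit y = y.
  by move=> /sphere_dot yy; rewrite /unit yy sqrtr1 invr1 scale1r.
have bottom j : (j <= N)%N -> l u v N 0 j = lab (q u v (j%:R / N%:R)).
  move=> jN; have jS := segment01_div R jN N0.
  rewrite /l /H /= mul0r /W subr0 scale1r scale0r subr0.
  by have [fS gq] := fg _ (qA u v _ uvF jS); rewrite unitS // gq.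
have bottom_mem j : (j <= N)%N -> l u v N 0 j \in [set u; v].
  move=> jN; have jS := segment01_div R jN N0; rewrite bottom //.
  have := hlab _ (qA u v _ uvF jS); rewrite qE !inE.
  case: (_ == u) => //; case: (_ == v) => //=.
  by rewrite !mulr0 addr0 leNgt in0.
have u_in : u \in [set u; v] by rewrite !inE eqxx.
have v_in : v \in [set u; v] by rewrite !inE eqxx orbT.
have lab_e w : w \in [set u; v] -> lab (e w) = w.
  move=> wuv; have ew : e w = q w w 0 by rewrite /q subr0 scale1r scale0r addr0.
  have s0 : segment01 (0 : R) by rewrite /segment01 /= lexx ler01.
  have wF : ord_face [set w; w].
    by apply: ord_face_sub uvF _; rewrite setUid sub1set.
  have := hlab _ (qA w w 0 wF s0); rewrite -ew mxE /=.
  by case: eqP => //= _; rewrite leNgt in0.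
(* On the row s = 0 the labels stay in the face [u v], where [k] is the coboundary of [k u], so the
   sum telescopes to [k u v]. *)
have := stokes _; rewrite (eq_big_nat _ _ (F2 := fun j =>
    k u (l u v N 0 j) + k u (l u v N 0 j.+1))); last first.
  move=> j /andP[_ jN]; have j1 := bottom_mem _ (ltnW jN); have j2 := bottom_mem _ jN.
  have := kc _ uvF u _ _ u_in j1 j2.
  by case: (k u _); case: (k _ _); case: (k u _).
rewrite telescope_bool !bottom // mul0r NN q0 q1 !lab_e // (kk _ _ uvF u_in) add0r.
(* On the row s = 1 the homotopy is constant, so each term has the form [k x x]. *)
rewrite [X in _ + X]big_nat_cond [X in _ + X]big1 => [|j]; last first.
  rewrite andbT => /= jN; have [s sF [_ _ h _]] := gridN N.-1 j (leqnn _) jN.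
  rewrite -[RHS](kk s (l u v N N j) sF h); congr (k _ _).
  by rewrite /l /H /W /= NN subrr !scale0r !sub0r.
rewrite addr0; under [X in _ = X + _]eq_bigr => i _ do rewrite !l0.
under [X in _ = _ + X]eq_bigr => i _ do rewrite !lN.
apply=> i j iN jN; have [s sF [h1 h2 h3 h4]] := gridN i j iN jN.
have := kc s sF _ _ _ h1 h2 h4; have := kc s sF _ _ _ h1 h3 h4.
by case: (k _ _); case: (k _ _); case: (k _ _); case: (k _ _); case: (k _ _).
Qed.

End Realization.

Lemma infinite_injections (F : fieldType) : infinite_set [set: F]%classic ->
  forall k, exists s : 'I_k -> F, injective s.
Proof.
move=> h k; have [B _ kB] := infinite_set_fset k h.
exists (fun i : 'I_k => nth 0 (finmap.enum_fset B) i) => i j /eqP.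
rewrite nth_uniq ?finmap.fset_uniq ?(leq_trans (ltn_ord _) kB) // => /eqP.
exact: val_inj.
Qed.

Lemma edge_rel_skeleton (V : finType) (D : {set {set V}}) :
  edge_rel (ord_face D) = skeleton_rel D.
Proof.
apply/funext => i; apply/funext => j.
by rewrite /edge_rel /ord_face /skeleton_rel imsetU1 imset_set1.
Qed.

(** An edge oriented by rank is determined by its set of end points. The subtraction [2 * #|W| - 3]
    does not truncate, as [#|W|] is at least 2. *)
Lemma laman_sparse_skeleton (V : finType) (D : {set {set V}}) (c : V -> color) :
  (forall s t : {set V}, s \in D -> t \subset s -> t \in D) ->
  (forall W : {set V},
     (forall v, v \in W -> c v = Blue) -> (2 <= #|W|)%N ->
     (#|edges (induced D W)| <= 2 * #|W| - 3)%N) ->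
  laman_sparse (fun i => is_blue c (enum_val i)) (skeleton_rel D).
Proof.
move=> sD h W Wb W2.
have gs : graph (skeleton_rel D).
  by rewrite -edge_rel_skeleton; apply: graph_edge_rel.
pose W' := [set enum_val i | i in W].
have W'E : #|W'| = #|W| by rewrite card_imset //; exact: enum_val_inj.
have := h W'; rewrite W'E => /(_ _ W2) {}h.
have {}h : (#|edges (induced D W')| <= 2 * #|W| - 3)%N.
  by apply: h => v /imsetP[i iW ->]; have := Wb i iW; rewrite /is_blue; case: (c _).
rewrite card_pairs_orient //; set O := [set p in _ | _].
suff : (#|O| <= #|edges (induced D W')|)%N by lia.
pose f (p : 'I_#|V| * 'I_#|V|) := [set enum_val p.1; enum_val p.2].
rewrite -(card_in_imset (f := f)).
  apply: subset_leq_card; apply/subsetP => _ /imsetP[[i j] + ->].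
  rewrite !inE /f /= => /andP[/and3P[iW jW /andP[ij ijD]] _].
  rewrite ijD cards2 (inj_eq enum_val_inj) ij /= andbT.
  by apply/subsetP => v; rewrite !inE => /orP[] /eqP ->; rewrite imset_f.
move=> [i j] [i' j']; rewrite !inE /f /= !enum_rank_ord /=.
move=> /andP[_ ij] /andP[_ ij'] /setP e.
have mem k : (k \in [set i; j]) = (k \in [set i'; j']).
  by have := e (enum_val k); rewrite !inE !(inj_eq enum_val_inj).
move: (mem i) (mem j); rewrite !inE !eqxx orbT.
move=> /esym/orP[]/eqP ei /esym/orP[]/eqP ej; move: ij ij'; rewrite ei ej //.
- by rewrite ltnn.
- by move=> h1 h2; have := ltn_trans h1 h2; rewrite ltnn.
- by rewrite ltnn.
Qed.

Local Close Scope ring_scope.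

Theorem theorem4p6 (R : realType) (F : fieldType) (V : finType)
    (D : {set {set V}}) (c : V -> color) :
  infinite_set [set: F]%classic ->
  simplicial_sphere R 2 D ->
  semi_proper D c ->
  (forall W : {set V},
     (forall v, v \in W -> c v = Blue) -> 2 <= #|W| ->
     #|edges (induced D W)| <= 2 * #|W| - 3) ->
  colored_SLP F D c.
Proof.
move=> /infinite_injections infF [cD sph] semi sparse.
apply: good_colored_SLP; apply: admissible_good => //; split.
- by rewrite -edge_rel_skeleton; apply: graph_edge_rel.
- rewrite -edge_rel_skeleton; apply: planar_of_complex.
  + exact: ord_face_sub cD.
  + exact: edge_in_two_triangles cD sph.
  + exact: cocycle_off_edge cD sph.
- move=> i j /andP[ij ijD]; apply: contraT; rewrite negb_or => /andP[ib jb].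
  case: (semi (enum_val i) (enum_val j)) => //.
    by rewrite (inj_eq enum_val_inj).
  by move: ib jb; rewrite /is_blue; case: (c _) => //; case: (c _).
- exact: laman_sparse_skeleton cD.2 sparse.
Qed.
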